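(* Every $2$-dimensional Banach space has the Mazur--Ulam property. That is: if $X$ is a $2$-dimensional Banach space, $Y$ is an arbitrary Banach space and $f:S_X\to S_Y$ is an isometry of the unit sphere of $X$ onto the unit sphere of $Y$, then $f$ extends to a linear isometry of the Banach spaces $X,Y$.
   Context: Banach spaces are over the field of real numbers. For a Banach space $(X,\|\cdot\|)$, $S_X=\{x\in X:\|x\|=1\}$ denotes its unit sphere, equipped with the metric $(x,y)\mapsto\|x-y\|$. A Banach space $X$ has the Mazur--Ulam property if every isometry $f:S_X\to S_Y$ of $S_X$ onto the unit sphere $S_Y$ of an arbitrary Banach space $Y$ extends to a linear isometry of the Banach spaces $X,Y$ (i.e. a surjective linear isometry $X\to Y$ whose restriction to $S_X$ is $f$). *)

(* Defs.v *)
From mathcomp Require Import all_boot all_order all_algebra.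
From mathcomp Require Import all_classical all_reals all_analysis.

Set Implicit Arguments.
Unset Strict Implicit.
Unset Printing Implicit Defensive.

Import GRing.Theory Num.Theory numFieldNormedType.Exports.

Local Open Scope classical_set_scope.
Local Open Scope ring_scope.

Definition unit_sphere (R : realType) (X : normedModType R) : set X :=
  [set x | `|x| = 1].

(* A map between the spheres is represented by a function on the whole space;
   its values off [unit_sphere X] play no role in the next three definitions. *)
Definition sphere_isometry (R : realType) (X Y : normedModType R)
    (f : X -> Y) : Prop :=
  f @` @unit_sphere R X = @unit_sphere R Y /\
  forall x y, unit_sphere x -> unit_sphere y -> `|f x - f y| = `|x - y|.

Definition extends_to_linear_isometry (R : realType) (X Y : normedModType R)
    (f : X -> Y) : Prop :=
  exists T : {linear X -> Y},
    [/\ range T = [set: Y], forall x y, `|T x - T y| = `|x - y|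
      & forall x, unit_sphere x -> T x = f x].

Definition mazur_ulam_property (R : realType) (X : completeNormedModType R) :
    Prop :=
  forall (Y : completeNormedModType R) (f : X -> Y),
    sphere_isometry f -> extends_to_linear_isometry f.

(* Main.v *)
(* Points at distance 1 on the sphere of a normed plane come in hexagons: if |y - x| = 1 then
   z = y - x is again on the sphere.  If the sphere contains no segment of length at least 1,
   the next point y at distance 1 from x is unique, so an isometry f onto another sphere
   satisfies f(y) = f(x) + f(z).  The one-sided unit tangents e1, e2, e3 at x, y, z and the
   rates at which they turn radially are not matched linearly, but distances determine enough
   of them: in the moving frames (e1, e3) of the two spheres, the coordinates of (x, z) and of
   (f x, f z) differ by a single scalar, the gap.  Differentiating with respect to x (along
   ultrafilters, relative to an increasing function dominating all increments, since the
   curves are merely of bounded variation) gives d(det(x, e1) gap) = - k det(x, e1) gap^2 <= 0,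
   where k >= 0 is the curvature, and the jumps at corners are nonpositive as well.  As
   det(x, e1) gap is periodic it is constant; if it were not 0 the curvature would vanish
   identically.  Hence the gap is 0, so the linear map carrying (x, z) to (f x, f z) has zero
   derivative and does not depend on x.

   A maximal segment of length l >= 1 is mapped onto a maximal segment, and the distances from
   p and - p to its points determine the coordinates of p, so f is again linear.

   Every f preserves antipodes: the map g defined by f(g u) = - f(- u) is isometric with
   |g u + u| = 2, which forces g u = u.  Finally the target has dimension 2: a vector outside
   the span of f(u) and f(v) would give a path on the target sphere from - f(v) to f(v) which
   avoids the line of f(u), whereas its preimage has to cross the line of u. *)
Require Import Defs.
From mathcomp Require Import all_boot all_order all_algebra.
From mathcomp Require Import all_classical all_reals all_analysis.
From HB Require Import structures.
From mathcomp Require Import ring lra.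

Set Implicit Arguments.
Unset Strict Implicit.
Unset Printing Implicit Defensive.

Import Order.TTheory GRing.Theory Num.Theory numFieldNormedType.Exports.

Local Open Scope classical_set_scope.
Local Open Scope ring_scope.

(** * The plane: determinants, limits, norms *)

(** The obstacle is regularity: corners may be dense and the turning of the tangent may be a
    singular measure, so no second derivative with respect to arc length is available. The argument
    rests on one quantity that an isometry respecting antipodes is seen to preserve: the logarithmic
    derivative of [n (r s + r t)] as [r s] moves, per unit of chord length. In terms of supporting
    directions it is a quotient of two determinants. Letting [t] tend to [s] and subtracting two
    such quotients gives the curvature; crossing a corner gives the jump of the tangent. Three
    tangents are used because those at x and z form a frame, while the one at y = x + z supplies the
    equation tying the two unmatched coordinates to one scalar. The absence of long segments enters
    a second time here: it keeps the tangent at x from being parallel to y or z, so the frames are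
    nondegenerate. The weight det(x, e1) in front of the gap is forced: its derivative cancels the
    tangential rate of change of e1, the one unknown that survives in the derivative of the gap. *)

Section Plane.
Variable R : realType.
Local Notation V := (R * R)%type.
Implicit Types p q w : V.

Definition det p q : R := p.1 * q.2 - p.2 * q.1.
Definition rot p : V := (- p.2, p.1).

Lemma add1 p q : (p + q).1 = p.1 + q.1. Proof. by []. Qed.
Lemma add2 p q : (p + q).2 = p.2 + q.2. Proof. by []. Qed.
Lemma opp1 p : (- p).1 = - p.1. Proof. by []. Qed.
Lemma opp2 p : (- p).2 = - p.2. Proof. by []. Qed.
Lemma scale1 (c : R) p : (c *: p).1 = c * p.1. Proof. by []. Qed.
Lemma scale2 (c : R) p : (c *: p).2 = c * p.2. Proof. by []. Qed.
Lemma zero1 : (0 : V).1 = 0. Proof. by []. Qed.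
Lemma zero2 : (0 : V).2 = 0. Proof. by []. Qed.
Lemma rot1 p : (rot p).1 = - p.2. Proof. by []. Qed.
Lemma rot2 p : (rot p).2 = p.1. Proof. by []. Qed.
Definition vE := (add1, add2, opp1, opp2, scale1, scale2, zero1, zero2, rot1, rot2).

Lemma vP p q : p.1 = q.1 -> p.2 = q.2 -> p = q.
Proof. by case: p q => [a b] [c d] /= -> ->. Qed.

Lemma sqr_sum_gt0 p : p != 0 -> 0 < p.1 ^+ 2 + p.2 ^+ 2.
Proof.
move=> p0; rewrite lt_neqAle addr_ge0 ?sqr_ge0// andbT eq_sym.
apply: contra p0; rewrite paddr_eq0 ?sqr_ge0// !sqrf_eq0 => /andP[/eqP a /eqP b].
by apply/eqP/vP.
Qed.

Lemma detrr p : det p p = 0. Proof. by rewrite /det; ring. Qed.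
Lemma detrN p q : det p (- q) = - det p q. Proof. by rewrite /det !vE; ring. Qed.
Lemma detNr p q : det (- p) q = - det p q. Proof. by rewrite /det !vE; ring. Qed.

Lemma eq_divP (a b c d : R) : 0 < b -> 0 < d -> a / b = c / d <-> a * d = c * b.
Proof.
by move=> b0 d0; split=> [/eqP|/eqP h]; [|apply/eqP; move: h];
  rewrite eqr_div ?lt0r_neq0// => /eqP.
Qed.

Lemma vdecomp p q w : det p q != 0 ->
  w = (det w q / det p q) *: p + (det p w / det p q) *: q.
Proof. by rewrite /det => h; apply: vP; rewrite !vE /det; field. Qed.

(* Boxed, so that unification does not unfold the inclusion of filters. *)
Variant slim {T} (F : set_system T) (f : T -> R) (a : R) : Prop :=
  Slim of f @ F --> a.

(** Convergence is taken coordinatewise, so that it does not refer to a norm and serves the spheres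
    of [n] and [m] alike. *)
Definition vlim {T} (F : set_system T) (u : T -> V) (p : V) :=
  slim F (fun t => (u t).1) p.1 /\ slim F (fun t => (u t).2) p.2.

Section Limits.
Context {T : Type} {F : set_system T} {FF : ProperFilter F}.
Implicit Types (u v : T -> V) (f g : T -> R) (a b : R).

Lemma slimP f a : slim F f a <-> (forall d : R, 0 < d -> \forall t \near F, `|f t - a| < d).
Proof.
split=> [[/cvgrPdist_lt h] e e0|h].
  by apply: filterS (h e e0) => t; rewrite distrC.
by split; apply/cvgrPdist_lt => e e0; apply: filterS (h e e0) => t; rewrite distrC.
Qed.

Lemma slim_cst a : slim F (fun=> a) a. Proof. by split; exact: cvg_cst. Qed.

Lemma slim_eq f g a : (\forall t \near F, f t = g t) -> slim F f a -> slim F g a.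
Proof. by move=> fg [h]; split; apply: cvg_trans h; apply: near_eq_cvg. Qed.

Lemma slimD f g a b : slim F f a -> slim F g b -> slim F (fun t => f t + g t) (a + b).
Proof. by move=> [h] [k]; split; exact: cvgD. Qed.

Lemma slimN f a : slim F f a -> slim F (fun t => - f t) (- a).
Proof. by move=> [h]; split; exact: cvgN. Qed.

Lemma slimB f g a b : slim F f a -> slim F g b -> slim F (fun t => f t - g t) (a - b).
Proof. by move=> [h] [k]; split; exact: cvgB. Qed.

Lemma slimM f g a b : slim F f a -> slim F g b -> slim F (fun t => f t * g t) (a * b).
Proof. by move=> [h] [k]; split; exact: cvgM. Qed.

Lemma slimV f a : a != 0 -> slim F f a -> slim F (fun t => (f t)^-1) a^-1.
Proof. by move=> a0 [h]; split; exact: cvgV. Qed.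

Lemma slim_div f g a b : b != 0 -> slim F f a -> slim F g b ->
  slim F (fun t => f t / g t) (a / b).
Proof. by move=> b0 h k; apply: slimM => //; apply: slimV. Qed.

Lemma slim_norm f a : slim F f a -> slim F (fun t => `|f t|) `|a|.
Proof. by move=> [h]; split; exact: cvg_norm. Qed.

Lemma slim_unique f a b : slim F f a -> slim F f b -> a = b.
Proof. by move=> [h] [k]; apply: (cvg_unique (@norm_hausdorff _ _) h k). Qed.

Lemma slim_ge f a b : slim F f a -> (\forall t \near F, b <= f t) -> b <= a.
Proof. by move=> [h]; apply: cvgr_to_ge h. Qed.

Lemma slim_le f a b : slim F f a -> (\forall t \near F, f t <= b) -> a <= b.
Proof. by move=> [h]; apply: cvgr_to_le h. Qed.

Lemma slim_gt f a b : slim F f a -> b < a -> \forall t \near F, b < f t.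
Proof. by move=> [h] ba; apply: cvgr_gt h _ ba. Qed.

Lemma slim_lt f a b : slim F f a -> a < b -> \forall t \near F, f t < b.
Proof. by move=> [h] ba; apply: cvgr_lt h _ ba. Qed.

Lemma slim_squeeze0 f g : (\forall t \near F, `|f t| <= g t) ->
  slim F g 0 -> slim F f 0.
Proof.
move=> fg /slimP h; apply/slimP => e e0.
apply: filterS2 fg (h e e0) => t; rewrite !subr0 => h1.
by apply: le_lt_trans; apply: le_trans h1 (ler_norm _).
Qed.

Lemma slim_sub0 f a : slim F (fun t => f t - a) 0 -> slim F f a.
Proof.
move=> /slimP h; apply/slimP => e e0.
by apply: filterS (h e e0) => t; rewrite subr0.
Qed.

Lemma vlim_cst p : vlim F (fun=> p) p.
Proof. by split; apply: slim_cst. Qed.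

Lemma vlim_eq u v p : (\forall t \near F, u t = v t) -> vlim F u p -> vlim F v p.
Proof. by move=> uv [h1 h2]; split; [move: h1|move: h2]; apply: slim_eq; apply: filterS uv => t ->. Qed.

Lemma vlimD u v p q : vlim F u p -> vlim F v q -> vlim F (fun t => u t + v t) (p + q).
Proof. by move=> [? ?] [? ?]; split; rewrite !vE; apply: slimD. Qed.

Lemma vlimN u p : vlim F u p -> vlim F (fun t => - u t) (- p).
Proof. by move=> [? ?]; split; rewrite !vE; apply: slimN. Qed.

Lemma vlimB u v p q : vlim F u p -> vlim F v q -> vlim F (fun t => u t - v t) (p - q).
Proof. by move=> h k; apply: vlimD => //; apply: vlimN. Qed.

Lemma vlimZ (c : T -> R) u (c0 : R) p :
  slim F c c0 -> vlim F u p -> vlim F (fun t => c t *: u t) (c0 *: p).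
Proof. by move=> h [? ?]; split; rewrite !vE; apply: slimM. Qed.

Lemma vlim_det u v p q : vlim F u p -> vlim F v q ->
  slim F (fun t => det (u t) (v t)) (det p q).
Proof. by move=> [? ?] [? ?]; apply: slimB; apply: slimM. Qed.

Lemma vlim_unique u p q : vlim F u p -> vlim F u q -> p = q.
Proof. by move=> [a b] [c d]; apply: vP; [exact: slim_unique a c|exact: slim_unique b d]. Qed.

End Limits.

(** The image of an ultrafilter is an ultrafilter, and here it contains a compact interval. This
    replaces every extraction of subsequences below. *)
Lemma ultra_cvg {T} (F : set_system T) (FU : UltraFilter F) (f : T -> R) (C : R) :
  (\forall t \near F, `|f t| <= C) -> exists l : R, slim F f l.
Proof.
move=> hC.
have GU : UltraFilter (f @ F).
  split; first exact: fmap_proper_filter.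
  move=> G PG sG; rewrite predeqE => A; split; last exact: sG.
  move=> GA; rewrite /fmap /=.
  have [//|h] := in_ultra_setVsetC (f @^-1` A) FU.
  have : G (~` A) by apply: sG.
  move=> /(filterI GA); rewrite setICr => /filter_ex [] //.
have := @segment_compact R (- C) C; rewrite compact_ultra => /(_ _ GU) [].
  by rewrite /fmap /=; apply: filterS hC => t /=; rewrite in_itv/= -ler_norml.
by move=> l [_ h]; exists l; split.
Qed.

(** A bare function instead of a normed space structure: several norms live on the same [R * R],
    which already carries the maximum norm. *)
Definition plane_norm (n : V -> R) :=
  [/\ forall p q, n (p + q) <= n p + n q,
      forall c p, n (c *: p) = `|c| * n p & forall p, n p = 0 -> p = 0].

Section Norm.
Variable n : V -> R.
Hypothesis nn : plane_norm n.

Lemma nD p q : n (p + q) <= n p + n q. Proof. by case: nn. Qed.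
Lemma nZ c p : n (c *: p) = `|c| * n p. Proof. by case: nn. Qed.
Lemma n0 : n 0 = 0. Proof. by rewrite -(scale0r 0) nZ normr0 mul0r. Qed.
Lemma nN p : n (- p) = n p. Proof. by rewrite -scaleN1r nZ normrN1 mul1r. Qed.
Lemma nB p q : n (p - q) <= n p + n q. Proof. by rewrite (le_trans (nD _ _))// nN. Qed.
Lemma n_subC p q : n (p - q) = n (q - p). Proof. by rewrite -nN opprB. Qed.
Lemma n_ge0 p : 0 <= n p.
Proof. by move: (nB p p); rewrite subrr n0; lra. Qed.
Lemma n_gt0 p : p != 0 -> 0 < n p.
Proof.
move=> h; rewrite lt_neqAle n_ge0 andbT eq_sym; apply: contra h => /eqP h.
by case: nn => _ _ /(_ _ h) ->.
Qed.
Lemma n_neq0 p : 0 < n p -> p != 0.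
Proof. by move=> h; apply: contraTN h => /eqP ->; rewrite n0 ltxx. Qed.
Lemma n_dist p q : `|n p - n q| <= n (p - q).
Proof.
move: (nD (p - q) q) (nD (q - p) p); rewrite !subrK (n_subC q p) => h1 h2.
by rewrite ler_norml; apply/andP; split; lra.
Qed.

Lemma n_le p : n p <= (n (1, 0) + n (0, 1)) * (`|p.1| + `|p.2|).
Proof.
have -> : p = p.1 *: (1, 0) + p.2 *: (0, 1) by apply: vP; rewrite !vE /=; ring.
apply: (le_trans (nD _ _)); rewrite !nZ !vE /= !mulr1 !mulr0 addr0 add0r.
have := n_ge0 (1, 0); have := n_ge0 (0, 1).
have := normr_ge0 p.1; have := normr_ge0 p.2; nra.
Qed.

Lemma vlim_n {T} {F : set_system T} {FF : ProperFilter F} (u : T -> V) p :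
  vlim F u p -> slim F (fun t => n (u t)) (n p).
Proof.
move=> h; have [h1 h2] := vlimB h (vlim_cst p).
have k : slim F (fun t => (n (1, 0) + n (0, 1)) * (`|(u t - p).1| + `|(u t - p).2|))
    ((n (1, 0) + n (0, 1)) * (`|(p - p).1| + `|(p - p).2|)).
  by apply: slimM; [exact: slim_cst|apply: slimD; apply: slim_norm].
rewrite !vE !subrr !normr0 addr0 mulr0 in k; apply: slim_sub0; apply: slim_squeeze0 k.
by apply: nearW => t; apply: le_trans (n_dist _ _) (n_le _).
Qed.

Lemma n_line_cont p q : continuous (fun s : R => n (p + s *: q)).
Proof.
move=> s; have [|//] := @vlim_n _ (nbhs s) _ (fun s => p + s *: q) (p + s *: q).
by apply: vlimD; [exact: vlim_cst|apply: vlimZ; [split; exact: cvg_id|exact: vlim_cst]].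
Qed.

Lemma n_line_bound p q : (forall s : R, p + s *: q != 0) ->
  exists2 c, 0 < c & forall s, `|s| <= 1 -> c <= n (p + s *: q).
Proof.
move=> h; have [] := @EVT_min R (fun s : R => n (p + s *: q)) (-1) 1.
- lra.
- exact/continuous_subspaceT/n_line_cont.
- move=> c _ hc; exists (n (p + c *: q)); first exact/n_gt0/h.
  by move=> s; rewrite ler_norml => hs; apply: hc; rewrite in_itv.
Qed.

(** Equivalence of norms. Dividing by the larger coordinate reduces it to the two segments of points
    [(1, s)] and [(s, 1)] with [s] in [[-1, 1]], on which a continuous positive function has a
    positive minimum. *)
Lemma comp_bound : exists2 C, 0 < C & forall p, `|p.1| <= C * n p /\ `|p.2| <= C * n p.
Proof.
have [|a a0 ha] := @n_line_bound (1, 0) (0, 1).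
  by move=> s; apply/eqP => /(congr1 fst); rewrite !vE /=; lra.
have [|b b0 hb] := @n_line_bound (0, 1) (1, 0).
  by move=> s; apply/eqP => /(congr1 snd); rewrite !vE /=; lra.
exists (a^-1 + b^-1); first by rewrite addr_gt0 ?invr_gt0.
have bnd (x y N : R) (d : R) (d0 : 0 < d) : `|y| <= `|x| ->
    (x != 0 -> d <= N / `|x|) -> 0 <= N -> `|x| <= d^-1 * N /\ `|y| <= d^-1 * N.
  move=> yx hd N0; suff: `|x| <= d^-1 * N by move=> h; split => //; apply: le_trans yx h.
  have [->|x0] := eqVneq x 0; first by rewrite normr0 mulr_ge0// invr_ge0 ltW.
  by move: (hd x0); rewrite ler_pdivlMr ?normr_gt0// => h; rewrite mulrC ler_pdivlMr// mulrC.
move=> p; have np := n_ge0 p.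
have ia : 0 < a^-1 by rewrite invr_gt0.
have ib : 0 < b^-1 by rewrite invr_gt0.
have [le|/ltW le] := leP `|p.2| `|p.1|.
  have [|h1 h2] := @bnd p.1 p.2 (n p) a a0 le _ np; last by split; nra.
  move=> x0; have := ha (p.2 / p.1).
  rewrite normrM normfV ler_pdivrMr ?normr_gt0// mul1r => /(_ le) h.
  apply: le_trans h _; have e : p = p.1 *: ((1, 0) + p.2 / p.1 *: (0, 1)).
    by apply: vP; rewrite !vE /=; field.
  by rewrite [n p](congr1 n e) nZ mulrAC divff ?normr_eq0// mul1r.
have [|h1 h2] := @bnd p.2 p.1 (n p) b b0 le _ np; last by split; nra.
move=> x0; have := hb (p.1 / p.2).
rewrite normrM normfV ler_pdivrMr ?normr_gt0// mul1r => /(_ le) h.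
apply: le_trans h _; have e : p = p.2 *: ((0, 1) + p.1 / p.2 *: (1, 0)).
  by apply: vP; rewrite !vE /=; field.
by rewrite [n p](congr1 n e) nZ mulrAC divff ?normr_eq0// mul1r.
Qed.

Lemma ultra_vlim {T} (F : set_system T) (FU : UltraFilter F) (u : T -> V) (C : R) :
  (\forall t \near F, n (u t) <= C) -> exists p, vlim F u p.
Proof.
move=> h; have [D D0 hD] := comp_bound.
have [|a ha] := @ultra_cvg _ _ FU (fun t => (u t).1) (D * C).
  by apply: filterS h => t h; apply: le_trans (proj1 (hD _)) _; rewrite ler_pM2l.
have [|b hb] := @ultra_cvg _ _ FU (fun t => (u t).2) (D * C).
  by apply: filterS h => t h; apply: le_trans (proj2 (hD _)) _; rewrite ler_pM2l.
by exists (a, b).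
Qed.

Lemma vlim_dist {T} {F : set_system T} {FF : ProperFilter F} (u : T -> V) p :
  slim F (fun t => n (u t - p)) 0 -> vlim F u p.
Proof.
move=> h; have [D D0 hD] := comp_bound.
have k : slim F (fun t => D * n (u t - p)) 0.
  by rewrite -(mulr0 D); apply: slimM => //; exact: slim_cst.
by split; apply: slim_sub0; apply: slim_squeeze0 k; apply: nearW => t;
  case: (hD (u t - p)); rewrite !vE.
Qed.

End Norm.
End Plane.

(** * One-sided tangents *)

Section Tangent.
Variables (R : realType) (n : R * R -> R).
Hypothesis nn : plane_norm n.
Local Notation V := (R * R)%type.
Implicit Types p q w e : V.

Definition dquot p w (h : R) : R := (n (p + h *: w) - n p) / h.
(* the one-sided derivative of n at p in the direction w *)
Definition dn p w : R := inf [set dquot p w h | h in [set h | 0 < h]].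

(** Convexity: [p + h *: w] is a convex combination of [p] and [p + k *: w]. Hence the infimum
    defining [dn] is the limit of the quotients at 0 from the right. *)
Lemma dquot_mono p w h k : 0 < h -> h <= k -> dquot p w h <= dquot p w k.
Proof.
move=> h0 hk; have k0 : 0 < k by lra.
rewrite /dquot ler_pdivrMr// mulrAC ler_pdivlMr//.
have e : p + h *: w = (1 - h / k) *: p + (h / k) *: (p + k *: w).
  by apply: vP; rewrite !vE; field; lra.
have hk1 : 0 <= 1 - h / k by rewrite subr_ge0 ler_pdivrMr// mul1r.
have : n (p + h *: w) <= (1 - h / k) * n p + (h / k) * n (p + k *: w).
  rewrite e; apply: le_trans (nD nn _ _) _; rewrite !(nZ nn) !ger0_norm//.
  by rewrite divr_ge0 ?ltW.
rewrite -(ler_pM2r k0) => /le_trans H.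
have -> : (n (p + k *: w) - n p) * h =
  ((1 - h / k) * n p + h / k * n (p + k *: w)) * k - n p * k by field; lra.
by rewrite mulrBl lerB// H.
Qed.

Lemma dquot_norm p w h : 0 < h -> `|dquot p w h| <= n w.
Proof.
move=> h0; rewrite /dquot normrM normfV (gtr0_norm h0) ler_pdivrMr//.
apply: le_trans (n_dist nn _ _) _.
by rewrite addrAC subrr add0r (nZ nn) gtr0_norm// mulrC.
Qed.

Lemma dn_has_inf p w : has_inf [set dquot p w h | h in [set h | 0 < h]].
Proof.
split; first by exists (dquot p w 1), 1 => //=; lra.
by exists (- n w) => _ [h /= h0 <-]; have := dquot_norm p w h0; rewrite ler_norml => /andP[].
Qed.

Lemma dn_le p w h : 0 < h -> dn p w <= dquot p w h.
Proof. by move=> h0; apply: ge_inf; [case: (dn_has_inf p w)|exists h]. Qed.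

Lemma dn_ge p w c : (forall h, 0 < h -> c <= dquot p w h) -> c <= dn p w.
Proof.
move=> hc; apply: lb_le_inf; first by case: (dn_has_inf p w).
by move=> _ [h /= h0 <-]; exact: hc.
Qed.

Lemma dn_adh p w (d : R) : 0 < d ->
  exists2 k, 0 < k & forall h, 0 < h -> h <= k -> dquot p w h < dn p w + d.
Proof.
move=> d0; have [_ [k /= k0 <-] hk] := inf_adherent d0 (dn_has_inf p w).
by exists k => // h h0 le; apply: le_lt_trans hk; exact: dquot_mono.
Qed.

Lemma dn_norm p w : `|dn p w| <= n w.
Proof.
rewrite ler_norml; apply/andP; split.
  by apply: dn_ge => h h0; have := dquot_norm p w h0; rewrite ler_norml => /andP[].
apply: le_trans (dn_le _ _ (@ltr01 R)) _.
by have := dquot_norm p w (@ltr01 R); rewrite ler_norml => /andP[].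
Qed.

Lemma dn_lim {T} {F : set_system T} {FF : ProperFilter F} p w (h : T -> R) :
  slim F h 0 -> (\forall t \near F, 0 < h t) -> slim F (fun t => dquot p w (h t)) (dn p w).
Proof.
move=> h0 hp; apply/slimP => d d0; have [k k0 hk] := dn_adh p w d0.
apply: filterS2 hp (slim_lt h0 k0) => t tp tk.
have := hk _ tp (ltW tk); have := dn_le p w tp; rewrite ltr_norml => *; lra.
Qed.

(** With [h = k / (d - k * c)] the point [p + h *: (c *: p + d *: w)] is a positive multiple of
    [p + k *: w], so homogeneity turns one difference quotient into the other. *)
Lemma dn_comb_le p w (c d : R) : 0 < d -> dn p (c *: p + d *: w) <= c * n p + d * dn p w.
Proof.
move=> d0; apply/ler_addgt0Pr => eps e0.
have ed : 0 < eps / d by exact: divr_gt0.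
have [k k0 hk] := dn_adh p w ed.
(* The second bound keeps [d - k' * c] positive. *)
pose k' := Num.min k (d / (2 * (`|c| + 1))).
have c1 : 0 < 2 * (`|c| + 1) by rewrite mulr_gt0// addr_gt0 ?ltr01//; apply: ltr_wpDl.
have k'0 : 0 < k' by rewrite lt_min k0 divr_gt0.
have kc : k' * c < d.
  have [c0|c0] := leP c 0; first by nra.
  have : k' <= d / (2 * (`|c| + 1)) by rewrite ge_min lexx orbT.
  rewrite ler_pdivlMr// (gtr0_norm c0) => ?; nra.
have dk : 0 < d - k' * c by lra.
have h0 : 0 < k' / (d - k' * c) by exact: divr_gt0.
apply: le_trans (dn_le _ _ h0) _.
have -> : dquot p (c *: p + d *: w) (k' / (d - k' * c)) = c * n p + d * dquot p w k'.
  rewrite /dquot.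
  have -> : p + (k' / (d - k' * c)) *: (c *: p + d *: w) =
            (d / (d - k' * c)) *: (p + k' *: w).
    by apply: vP; rewrite !vE; field; lra.
  rewrite (nZ nn) gtr0_norm ?divr_gt0//; field; lra.
have k'k : k' <= k by rewrite ge_min lexx.
have := hk _ k'0 k'k.
by rewrite -(ltr_pM2l d0) mulrDr [d * (eps / d)]mulrC divfK; lra.
Qed.

(** The reverse inequality is [dn_comb_le] again, with [w] written as a combination of [p] and
    [c *: p + d *: w]. *)
Lemma dn_comb p w (c d : R) : 0 < d -> dn p (c *: p + d *: w) = c * n p + d * dn p w.
Proof.
move=> d0; apply/eqP; rewrite eq_le dn_comb_le//=.
have e : w = (- c / d) *: p + d^-1 *: (c *: p + d *: w).
  by apply: vP; rewrite !vE; field; lra.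
have id : 0 < d^-1 by rewrite invr_gt0.
have := @dn_comb_le p (c *: p + d *: w) (- c / d) d^-1 id.
rewrite -e -(ler_pM2l d0) mulrDr !mulrA divff ?gt_eqF// mul1r.
have -> : d * - c / d = - c by field; lra.
lra.
Qed.

Lemma dn_self p c : dn p (c *: p) = c * n p.
Proof.
apply/eqP; rewrite eq_le; apply/andP; split.
  have -> : c *: p = (c - 1) *: p + 1 *: p by apply: vP; rewrite !vE; ring.
  apply: le_trans (dn_comb_le _ _ _ (@ltr01 R)) _.
  have := dn_le p p (@ltr01 R); rewrite /dquot divr1.
  have -> : p + 1 *: p = 2 *: p by apply: vP; rewrite !vE; ring.
  by rewrite (nZ nn) ger0_norm//; lra.
apply: dn_ge => h h0; rewrite /dquot ler_pdivlMr//.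
have -> : p + h *: (c *: p) = (1 + h * c) *: p by apply: vP; rewrite !vE; ring.
by rewrite (nZ nn); have := ler_norm (1 + h * c); have := n_ge0 nn p; nra.
Qed.

(* the right tangent of the sphere at p *)
Definition tg0 p : V := n p *: rot p - dn p (rot p) *: p.
Definition tg p : V := (n (tg0 p))^-1 *: tg0 p.

Lemma det_tg0 p : det p (tg0 p) = n p * (p.1 ^+ 2 + p.2 ^+ 2).
Proof. by rewrite /det /tg0 !vE; ring. Qed.

Lemma tg0_neq0 p : p != 0 -> tg0 p != 0.
Proof.
move=> p0; apply/eqP => h; have := det_tg0 p.
rewrite h /det !vE !mulr0 subrr => /esym/eqP.
by rewrite mulf_eq0 !gt_eqF ?(n_gt0 nn)// sqr_sum_gt0.
Qed.

Lemma n_tg p : p != 0 -> n (tg p) = 1.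
Proof.
move=> p0; have h := n_gt0 nn (tg0_neq0 p0).
by rewrite /tg (nZ nn) gtr0_norm ?invr_gt0// mulVf// gt_eqF.
Qed.

Lemma rot_decomp p w : p != 0 -> exists c : R,
  w = c *: p + (det p w / (p.1 ^+ 2 + p.2 ^+ 2)) *: rot p.
Proof.
move=> /sqr_sum_gt0 h; exists ((p.1 * w.1 + p.2 * w.2) / (p.1 ^+ 2 + p.2 ^+ 2)).
by apply: vP; rewrite /det !vE; field; lra.
Qed.

(** On the half plane counterclockwise of [p] the one-sided derivative is linear; it equals [n p] at
    [p] and 0 at [tg p]. *)
Lemma dn_tg p w : p != 0 -> 0 <= det p w -> dn p w * det p (tg p) = n p * det w (tg p).
Proof.
move=> p0 pw; have [c e] := rot_decomp w p0.
have s0 := sqr_sum_gt0 p0; set s := p.1 ^+ 2 + p.2 ^+ 2 in e s0.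
have : dn p w * det p (tg0 p) = n p * det w (tg0 p).
  have -> : dn p w = c * n p + det p w / s * dn p (rot p).
    rewrite {1}e; move: pw; rewrite le_eqVlt => /orP[/eqP <-|pw].
      by rewrite !mul0r addr0 scale0r addr0 dn_self.
    by rewrite dn_comb// divr_gt0.
  have -> : det w (tg0 p) = c * det p (tg0 p) + det p w / s * det (rot p) (tg0 p).
    by rewrite {1}e /det !vE; ring.
  have -> : det (rot p) (tg0 p) = dn p (rot p) * s by rewrite /det /tg0 !vE /s; ring.
  by rewrite det_tg0 -/s; ring.
have hh (q : V) : det q (tg p) = (n (tg0 p))^-1 * det q (tg0 p).
  by rewrite /tg /det !vE; ring.
by rewrite !hh mulrCA => ->; rewrite mulrCA.
Qed.

(* the line p + R e supports the ball of radius n p, and e points counterclockwise *)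
Definition supp p e := n e = 1 /\ forall w, `|det w e| * n p <= det p e * n w.

Lemma supp_neq0 p e : supp p e -> e != 0.
Proof. by case=> h _; apply/eqP => e0; move: h; rewrite e0 (n0 nn) => /eqP; rewrite eq_sym oner_eq0. Qed.

(** The support inequality is tested on [- rot e], whose determinant with [e] is the squared
    Euclidean length of [e]. *)
Lemma supp_gt0 p e : p != 0 -> supp p e -> 0 < det p e.
Proof.
move=> p0 se; have [e1 h] := se; have e0 := supp_neq0 se.
have np := n_gt0 nn p0; have hr := h (- rot e).
have d : det (- rot e) e = e.1 ^+ 2 + e.2 ^+ 2 by rewrite /det !vE; ring.
have s0 := sqr_sum_gt0 e0; rewrite d (gtr0_norm s0) in hr.
have nr := n_ge0 nn (- rot e).
by rewrite ltNge; apply/negP => h0; have := mulr_gt0 s0 np; nra.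
Qed.

(** Supporting directions turn counterclockwise with the point: multiply the two support
    inequalities and compare with the Pluecker identity for [p], [q], [e], [e']. *)
Lemma supp_turn p q e e' : p != 0 -> q != 0 -> supp p e -> supp q e' ->
  0 < det p q -> 0 <= det e e'.
Proof.
move=> p0 q0 se se' pq.
have np := n_gt0 nn p0; have nq := n_gt0 nn q0.
have A := supp_gt0 p0 se; have B := supp_gt0 q0 se'.
have h1 := proj2 se q; have h2 := proj2 se' p.
have : `|det q e| * `|det p e'| <= det p e * det q e'.
  rewrite -(ler_pM2r (mulr_gt0 np nq)).
  have := ler_pM (mulr_ge0 (normr_ge0 _) (ltW np)) (mulr_ge0 (normr_ge0 _) (ltW nq)) h1 h2.
  by move=> H; rewrite mulrACA [X in _ <= _ * _ * X]mulrC [X in _ <= X]mulrACA.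
rewrite -normrM => /(le_trans (ler_norm _)).
have -> : det p e * det q e' = det q e * det p e' + det p q * det e e' by rewrite /det; ring.
by rewrite lerDl pmulr_rge0.
Qed.

Lemma supp_lim {T} {F : set_system T} {FF : ProperFilter F} (u v : T -> V) p e :
  vlim F u p -> vlim F v e -> (\forall t \near F, supp (u t) (v t)) -> supp p e.
Proof.
move=> up ve h; split.
  apply: (slim_unique (F := F) (vlim_n nn ve)).
  apply: (@slim_eq _ _ F _ (fun=> 1)); last exact: slim_cst.
  by apply: filterS h => t [].
move=> w; rewrite -subr_ge0.
apply: (@slim_ge _ _ F _ (fun t => det (u t) (v t) * n w - `|det w (v t)| * n (u t))).
  apply: slimB; first by apply: slimM; [exact: vlim_det|exact: slim_cst].
  by apply: slimM; [exact: slim_norm (vlim_det (vlim_cst w) ve)|exact: vlim_n].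
by apply: filterS h => t [_ h]; rewrite subr_ge0.
Qed.

(** By [dn_tg] the support inequality on one half plane is the bound [|dn p w| <= n w]; the other
    half plane follows by changing the sign of [w]. *)
Lemma tg_supp p : p != 0 -> supp p (tg p).
Proof.
move=> p0; split; first exact: n_tg.
have np := n_gt0 nn p0.
have dp : 0 < det p (tg p).
  have -> : det p (tg p) = (n (tg0 p))^-1 * det p (tg0 p) by rewrite /tg /det !vE; ring.
  by rewrite det_tg0 !mulr_gt0 ?invr_gt0 ?(n_gt0 nn) ?tg0_neq0// sqr_sum_gt0.
have aux w : 0 <= det p w -> `|det w (tg p)| * n p <= det p (tg p) * n w.
  move=> pw; have := congr1 (fun x => `|x|) (dn_tg p0 pw).
  rewrite !normrM (gtr0_norm dp) (gtr0_norm np) [n p * _]mulrC => <-.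
  by rewrite mulrC ler_pM2l// dn_norm.
move=> w; have [|/ltW pw] := leP 0 (det p w); first exact: aux.
have := aux (- w); have -> : det p (- w) = - det p w by rewrite /det !vE; ring.
have -> : det (- w) (tg p) = - det w (tg p) by rewrite /det !vE; ring.
by rewrite normrN (nN nn) oppr_ge0; apply.
Qed.

(** Among the supporting directions at a corner the right tangent is the most counterclockwise: the
    norm does not decrease along [e], so [dn p e] is nonnegative. *)
Lemma tg_ext p e : p != 0 -> supp p e -> 0 <= det e (tg p).
Proof.
move=> p0 se; have [e1 h] := se; have pe := supp_gt0 p0 se.
have np := n_gt0 nn p0; have pt := supp_gt0 p0 (tg_supp p0).
rewrite -(pmulr_rge0 _ np) -dn_tg//; last exact: ltW.
rewrite pmulr_lge0//; apply: dn_ge => k k0; rewrite /dquot pmulr_lge0 ?invr_gt0// subr_ge0.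
have := h (p + k *: e); have -> : det (p + k *: e) e = det p e by rewrite /det !vE; ring.
by rewrite gtr0_norm// ler_pM2l.
Qed.

Lemma supp_eq p e e' : p != 0 -> supp p e -> supp p e' -> det e e' = 0 -> e = e'.
Proof.
move=> p0 se se' h; have A := supp_gt0 p0 se; have B := supp_gt0 p0 se'.
have e0 : e' = (det p e' / det p e) *: e.
  have hp : det p e != 0 by rewrite gt_eqF.
  have h' : det e' e = 0 by move: h; rewrite /det; lra.
  by rewrite {1}(vdecomp e' hp) h' mul0r scale0r add0r.
have := proj1 se'; rewrite e0 (nZ nn) (proj1 se) mulr1 gtr0_norm ?divr_gt0// => k.
by rewrite k scale1r.
Qed.

(** Right continuity, for any choice of supporting directions. A limit [e] supports at [p]; [tg_ext]
    puts it clockwise of [tg p], and [supp_turn] puts it counterclockwise. *)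
Lemma tg_right {T} {F : set_system T} (FU : UltraFilter F) (u v : T -> V) p :
  p != 0 -> vlim F u p -> (\forall t \near F, 0 < det p (u t)) ->
  (\forall t \near F, supp (u t) (v t)) -> vlim F v (tg p).
Proof.
move=> p0 up pu sv; have FF : ProperFilter F by exact: ultra_proper.
have [|e ve] := @ultra_vlim _ _ nn _ _ FU v 1; first by apply: filterS sv => t [->].
have se : supp p e by exact: (supp_lim up ve sv).
suff -> : tg p = e by [].
apply: (supp_eq p0 (tg_supp p0) se); apply/eqP; rewrite eq_le; apply/andP; split.
  rewrite -oppr_ge0 [X in 0 <= X](_ : _ = det e (tg p)); first exact: tg_ext.
  by rewrite /det; ring.
apply: (@slim_ge _ _ F _ (fun t => det (tg p) (v t))).
  by apply: vlim_det => //; exact: vlim_cst.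
apply: filterS2 pu sv => t h k; apply: (supp_turn p0 _ (tg_supp p0) k h).
by apply: contraTN h => /eqP ->; rewrite /det !vE !mulr0 subrr ltxx.
Qed.

(** A limit [e] of chord directions is squeezed between two supports: that of [p] gives
    [det e (tg p) <= 0], and those of the moving points, which tend to [tg p], give the converse.
    The orientation of the chord fixes the sign. *)
Lemma tg_chord {T} {F : set_system T} (FU : UltraFilter F) (u : T -> V) p :
  n p = 1 -> vlim F u p -> (\forall t \near F, 0 < det p (u t)) ->
  (\forall t \near F, n (u t) = 1) ->
  vlim F (fun t => (n (u t - p))^-1 *: (u t - p)) (tg p).
Proof.
move=> p1 up pu u1.
have p0 : p != 0 by apply: (n_neq0 nn); rewrite p1.
pose d t := (n (u t - p))^-1 *: (u t - p).
have up0 : \forall t \near F, 0 < n (u t - p).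
  apply: filterS pu => t h; apply: (n_gt0 nn); apply: contraTN h.
  by rewrite subr_eq0 => /eqP ->; rewrite /det mulrC subrr ltxx.
have u0 : \forall t \near F, u t != 0.
  by apply: filterS u1 => t h; apply: (n_neq0 nn); rewrite h.
have [|e de] := @ultra_vlim _ _ nn _ _ FU d 1.
  by apply: filterS up0 => t h; rewrite /d (nZ nn) gtr0_norm ?invr_gt0// mulVf// gt_eqF.
have e1 : n e = 1.
  apply: (slim_unique (F := F) (vlim_n nn de)).
  apply: (@slim_eq _ _ F _ (fun=> 1)); last exact: slim_cst.
  by apply: filterS up0 => t h; rewrite /d (nZ nn) gtr0_norm ?invr_gt0// mulVf// gt_eqF.
have st := tg_supp p0; have pt := supp_gt0 p0 st.
have h1 : det e (tg p) <= 0.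
  apply: (@slim_le _ _ F _ (fun t => det (d t) (tg p))).
    by apply: vlim_det => //; exact: vlim_cst.
  apply: filterS2 up0 u1 => t h k; rewrite /d.
  have -> : det ((n (u t - p))^-1 *: (u t - p)) (tg p) =
     (n (u t - p))^-1 * (det (u t) (tg p) - det p (tg p)) by rewrite /det !vE; ring.
  rewrite pmulr_rle0 ?invr_gt0// subr_le0.
  by have := proj2 st (u t); rewrite p1 k !mulr1; apply: le_trans (ler_norm _).
have h2 : 0 <= det e (tg p).
  have sv : \forall t \near F, supp (u t) (tg (u t)) by apply: filterS u0 => t; exact: tg_supp.
  have vt := tg_right FU p0 up pu sv.
  apply: (@slim_ge _ _ F _ (fun t => det (d t) (tg (u t)))); first exact: vlim_det.
  apply: filterS3 up0 u1 sv => t h k [_ s]; rewrite /d.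
  have -> : det ((n (u t - p))^-1 *: (u t - p)) (tg (u t)) =
     (n (u t - p))^-1 * (det (u t) (tg (u t)) - det p (tg (u t))) by rewrite /det !vE; ring.
  rewrite pmulr_rge0 ?invr_gt0// subr_ge0.
  by have := s p; rewrite p1 k !mulr1; apply: le_trans (ler_norm _).
have h3 : 0 <= det p e.
  apply: (@slim_ge _ _ F _ (fun t => det p (d t))).
    by apply: vlim_det => //; exact: vlim_cst.
  apply: filterS2 up0 pu => t h k; rewrite /d.
  have -> : det p ((n (u t - p))^-1 *: (u t - p)) = (n (u t - p))^-1 * det p (u t).
    by rewrite /det !vE; ring.
  by rewrite mulr_ge0 ?invr_ge0 ?ltW.
have h0 : det e (tg p) = 0 by apply/eqP; rewrite eq_le h1 h2.
suff -> : tg p = e by [].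
have e0 : e = (det p e / det p (tg p)) *: tg p.
  by rewrite {1}(vdecomp e (lt0r_neq0 pt)) h0 mul0r scale0r add0r.
have := e1; rewrite e0 (nZ nn) n_tg// mulr1 ger0_norm ?divr_ge0// ?ltW// => k.
by rewrite k scale1r.
Qed.

End Tangent.

(** * Parametrized spheres and inscribed hexagons *)

(* Equivalently, the sphere contains no segment of length at least 1. *)
Definition nolong (R : realType) (n : R * R -> R) :=
  forall p q, n p = 1 -> n q = 1 -> n (p - q) = 1 -> n (p + q) < 2.

(** A counterclockwise parametrization with antipodes at parameter distance [pi]. Only order and
    continuity are prescribed, not the speed, so that the image of such a curve under an isometry of
    spheres can again be one. *)
Definition unit_curve (R : realType) (n : R * R -> R) (r : R -> R * R) :=
  [/\ forall t, n (r t) = 1, forall t, r (t + pi) = - r t,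
      forall s t, s < t -> t < s + pi -> 0 < det (r s) (r t)
    & forall t, vlim (nbhs t) r (r t)].

Section Curve.
Variables (R : realType) (n : R * R -> R) (r : R -> R * R).
Hypothesis nn : plane_norm n.
Local Notation V := (R * R)%type.
Implicit Types p q w e : V.
Implicit Types s t : R.

Lemma unit_neq0 p : n p = 1 -> p != 0.
Proof. by move=> h; apply: (n_neq0 nn); rewrite h. Qed.

Lemma unit_det0 p q : n p = 1 -> n q = 1 -> det p q = 0 -> q = p \/ q = - p.
Proof.
move=> p1 q1 h; have [c e] := rot_decomp q (unit_neq0 p1).
rewrite h mul0r scale0r addr0 in e.
move: q1; rewrite e (nZ nn) p1 mulr1 => /eqP.
rewrite eqr_norml => /andP[/orP[]/eqP -> _]; first by left; rewrite scale1r.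
by right; rewrite scaleN1r.
Qed.

(** The distance from [x] grows along the sphere. Add the triangle inequalities for
    [(a + b) *: y' = y + a *: (y' - x)] and [(a + b) *: (y - x) = (a + b - 1) *: y + b *: (y' -
    x)]. *)
Lemma dist_mono x y y' (a b : R) : n x = 1 -> n y = 1 -> n y' = 1 -> 0 <= a -> 0 <= b ->
  y = a *: x + b *: y' -> n (y - x) <= n (y' - x).
Proof.
move=> x1 y1 y'1 a0 b0 e; set d := n (y - x); set d' := n (y' - x).
have c1 : 1 <= a + b.
  by rewrite -y1 e; apply: le_trans (nD nn _ _) _; rewrite !(nZ nn) !ger0_norm// x1 y'1; lra.
have h1 : a + b - 1 <= a * d'.
  have := nD nn y (a *: (y' - x)); rewrite (nZ nn) ger0_norm// y1 -/d'.
  have -> : y + a *: (y' - x) = (a + b) *: y' by rewrite e; apply: vP; rewrite !vE; ring.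
  by rewrite (nZ nn) ger0_norm ?addr_ge0// y'1; lra.
have h2 : (a + b) * d <= a + b - 1 + b * d'.
  have := nD nn ((a + b - 1) *: y) (b *: (y' - x)).
  have -> : (a + b - 1) *: y + b *: (y' - x) = (a + b) *: (y - x).
    by rewrite e; apply: vP; rewrite !vE; ring.
  have p1 : 0 <= a + b - 1 by lra.
  have p2 : 0 <= a + b by lra.
  by rewrite !(nZ nn) (ger0_norm p1) (ger0_norm p2) (ger0_norm b0) y1 -/d -/d'; lra.
have : (a + b) * d <= (a + b) * d' by lra.
by rewrite ler_pM2l//; lra.
Qed.

(** Equality in both inequalities of [dist_mono] forces [b = 1]. Then [y] and [y - x], two unit
    vectors at distance 1, have a sum of norm at least 2, which [nolong] forbids. *)
Lemma dist1_unique x y y' (a b : R) : nolong n -> n x = 1 -> n y = 1 -> n y' = 1 ->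
  0 < a -> 0 <= b -> y = a *: x + b *: y' -> n (y - x) = 1 -> n (y' - x) = 1 -> False.
Proof.
move=> nl x1 y1 y'1 a0 b0 e d1 d1'.
have h1 : a + b - 1 <= a.
  have := nD nn y (a *: (y' - x)); rewrite (nZ nn) gtr0_norm// y1 d1'.
  have -> : y + a *: (y' - x) = (a + b) *: y' by rewrite e; apply: vP; rewrite !vE; ring.
  have p2 : 0 <= a + b by lra.
  by rewrite (nZ nn) (ger0_norm p2) y'1; lra.
have c1 : 1 <= a + b.
  by rewrite -y1 e; apply: le_trans (nD nn _ _) _; rewrite !(nZ nn) (gtr0_norm a0) (ger0_norm b0) x1 y'1; lra.
have h2 : a + b <= a + b - 1 + b.
  have := nD nn ((a + b - 1) *: y) (b *: (y' - x)).
  have -> : (a + b - 1) *: y + b *: (y' - x) = (a + b) *: (y - x).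
    by rewrite e; apply: vP; rewrite !vE; ring.
  have p1 : 0 <= a + b - 1 by lra.
  have p2 : 0 <= a + b by lra.
  by rewrite !(nZ nn) (ger0_norm p1) (ger0_norm p2) (ger0_norm b0) y1 d1 d1'; lra.
have b1 : b = 1 by lra.
have d2 : n (y - (y - x)) = 1 by rewrite opprB addrCA subrr addr0.
have := nl _ _ y1 d1 d2; apply/negP; rewrite -leNgt.
have ab : 0 < a + 1 / 2 by lra.
have := nD nn (a *: (y + (y - x))) (1 *: (y' - x)).
have -> : a *: (y + (y - x)) + 1 *: (y' - x) = (2 * a + 1) *: (y - x).
  by rewrite e b1; apply: vP; rewrite !vE; ring.
rewrite !(nZ nn) (gtr0_norm a0) normr1 d1 d1' ger0_norm; last lra.
by move=> h; rewrite -(ler_pM2l a0); lra.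
Qed.

Hypothesis rc : unit_curve n r.

Lemma r1 t : n (r t) = 1. Proof. by case: rc. Qed.
Lemma rpi t : r (t + pi) = - r t. Proof. by case: rc. Qed.
Lemma rdet s t : s < t -> t < s + pi -> 0 < det (r s) (r t). Proof. by case: rc => _ _ h _; exact: h. Qed.
Lemma rlim t : vlim (nbhs t) r (r t). Proof. by case: rc. Qed.
Lemma r_neq0 t : r t != 0. Proof. exact/unit_neq0/r1. Qed.

Lemma rNpi t : r (t - pi) = - r t.
Proof. by rewrite -[in RHS](subrK pi t) rpi opprK. Qed.

Lemma r_comb s t u : s < t -> t < u -> u < s + pi ->
  exists a b : R, [/\ 0 < a, 0 < b & r t = a *: r s + b *: r u].
Proof.
move=> st tu us; have su : 0 < det (r s) (r u) by apply: rdet; lra.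
exists (det (r t) (r u) / det (r s) (r u)), (det (r s) (r t) / det (r s) (r u)).
split; [apply: divr_gt0 => //; apply: rdet; lra|apply: divr_gt0 => //; apply: rdet; lra|].
exact/vdecomp/lt0r_neq0.
Qed.

Lemma cont_det p : continuous (fun t => det p (r t)).
Proof. by move=> t; have [] := vlim_det (vlim_cst p) (rlim t). Qed.

(** The determinant of [q] with the curve changes sign over a half turn; at a zero the curve passes
    through [q] or [- q], and the orientation excludes [- q]. *)
Lemma r_surj s q : n q = 1 -> 0 < det (r s) q ->
  exists t, [/\ s < t, t < s + pi & r t = q].
Proof.
move=> q1 sq; have pi0 := @pi_gt0 R.
have d1 : det q (r s) < 0 by move: sq; rewrite /det; lra.
have d2 : det q (r (s + pi)) = - det q (r s) by rewrite rpi /det !vE; ring.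
have [|||t] := @IVT R (fun t => det q (r t)) s (s + pi) 0.
- lra.
- exact/continuous_subspaceT/cont_det.
- by rewrite d2 ge_min le_max; apply/andP; split; apply/orP; [left|right]; lra.
rewrite in_itv/= => /andP[st ts] ht.
have ns : t != s by apply/eqP => e; rewrite -e ht ltxx in d1.
have nsp : t != s + pi by apply/eqP => e; rewrite -e ht in d2; lra.
have st' : s < t by rewrite lt_neqAle eq_sym ns.
have ts' : t < s + pi by rewrite lt_neqAle nsp.
exists t; split=> //.
have [//|e] := unit_det0 q1 (r1 t) ht.
have := rdet st' ts'; rewrite e.
have -> : det (r s) (- q) = - det (r s) q by rewrite /det !vE; ring.
by move=> k; exfalso; clear e; lra.
Qed.

Lemma r_onto q : n q = 1 -> exists t, r t = q.
Proof.
move=> q1; have [h|h|h] := ltgtP 0 (det (r 0) q).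
- by have [t [_ _ <-]] := r_surj q1 h; exists t.
- have h' : 0 < det (r 0) (- q).
    by move: h; rewrite /det !vE; lra.
  have [|t [_ _ e]] := r_surj _ h'; first by rewrite (nN nn).
  by exists (t + pi); rewrite rpi e opprK.
- have [e|e] := unit_det0 (r1 0) q1 (esym h); first by exists 0.
  by exists pi; rewrite -(add0r pi) rpi.
Qed.

Lemma r_inj s t : s < t -> t < s + 2 * pi -> r s <> r t.
Proof.
move=> st ts e; have [h|h|h] := ltgtP t (s + pi).
- by have := rdet st h; rewrite e /det mulrC subrr ltxx.
- have := @rdet s (t - pi); rewrite rNpi -e.
  have -> : det (r s) (- r s) = 0 by rewrite /det !vE; ring.
  by rewrite ltxx => H; suff: false by []; apply: H; lra.
- have := r_neq0 t; rewrite h rpi in e *.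
  rewrite oppr_eq0 => /eqP; apply; apply: vP; have := congr1 fst e; have := congr1 snd e.
    by rewrite !vE; lra.
  by rewrite !vE; lra.
Qed.

Definition tgc t : V := tg n (r t).

Lemma tgc_supp t : supp n (r t) (tgc t). Proof. exact/tg_supp/r_neq0. Qed.

Lemma r_right_det {F : set_system R} s : F `=>` at_right s ->
  \forall t \near F, 0 < det (r s) (r t).
Proof.
move=> h; have pi0 := @pi_gt0 R; apply: h.
have k : nbhs s (fun t => t < s + pi) by apply: lt_nbhsl; rewrite ltrDl.
by rewrite /at_right /within /=; apply: filterS k => t k st; apply: rdet.
Qed.

Lemma vlim_sub {F G : set_system R} (u : R -> V) p : F `=>` G -> vlim G u p -> vlim F u p.
Proof. by move=> h [[a] [b]]; split; split => A /= HA; apply: h; [exact: a|exact: b]. Qed.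

Lemma r_right_lim {F : set_system R} s : F `=>` at_right s -> vlim F r (r s).
Proof.
move=> h; apply: (vlim_sub h); apply: vlim_sub (rlim s).
exact: cvg_within.
Qed.

Lemma chord_lim {F : set_system R} (FU : UltraFilter F) s : F `=>` at_right s ->
  vlim F (fun t => (n (r t - r s))^-1 *: (r t - r s)) (tgc s).
Proof.
move=> h; apply: (tg_chord nn FU (r1 s)); [exact: r_right_lim|exact: r_right_det|].
have FF : ProperFilter F by exact: ultra_proper.
by apply: nearW => t; exact: r1.
Qed.

(** A chain rule: the norm is 1-Lipschitz, so replacing the chord by its length times the tangent
    costs [o(length)]. The quotients on the left involve norms only, which is what lets an isometry
    compare them. *)
Lemma dn_chord {F : set_system R} (FU : UltraFilter F) s w : F `=>` at_right s ->
  slim F (fun t => (n (r t + w) - n (r s + w)) / n (r t - r s)) (dn n (r s + w) (tgc s)).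
Proof.
move=> h; have FF : ProperFilter F by exact: ultra_proper.
have lpos : \forall t \near F, 0 < n (r t - r s).
  apply: filterS (r_right_det h) => t k; apply: (n_gt0 nn); apply: contraTN k.
  by rewrite subr_eq0 => /eqP ->; rewrite /det mulrC subrr ltxx.
have l0 : slim F (fun t => n (r t - r s)) 0.
  rewrite -(n0 nn) -(subrr (r s)); apply: (vlim_n nn).
  by apply: vlimB; [exact: r_right_lim|exact: vlim_cst].
have A : slim F (fun t => dquot n (r s + w) (tgc s) (n (r t - r s))) (dn n (r s + w) (tgc s)).
    exact: dn_lim.
pose d t := (n (r t - r s))^-1 *: (r t - r s).
have B : slim F (fun t => n (d t - tgc s)) 0.
  rewrite -(n0 nn) -(subrr (tgc s)); apply: (vlim_n nn).
  by apply: vlimB; [exact: chord_lim|exact: vlim_cst].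
have C : slim F (fun t => (n (r t + w) - n (r s + w)) / n (r t - r s)
    - dquot n (r s + w) (tgc s) (n (r t - r s))) 0.
  apply: slim_squeeze0 B; apply: filterS lpos => t lt.
  rewrite /dquot -mulrBl normrM normfV (gtr0_norm lt) ler_pdivrMr//.
  rewrite opprB addrA subrK; apply: le_trans (n_dist nn _ _) _.
  rewrite -{2}(gtr0_norm lt) mulrC -(nZ nn) le_eqVlt; apply/orP; left; apply/eqP; congr n.
  rewrite /d; set l := n _ in lt *.
  have ln : l != 0 by rewrite gt_eqF.
  by move: (tgc s) => e; apply: vP; rewrite !vE; field.
have H := slimD (FF := FF) C A; rewrite add0r in H; apply: (slim_eq _ H).
by apply: nearW => t; rewrite subrK.
Qed.

Lemma chord_dn s t : r s + r t != 0 ->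
  dn n (r s + r t) (tgc s) * det (r s + r t) (tg n (r s + r t)) =
  n (r s + r t) * det (tgc s) (tg n (r s + r t)).
Proof.
move=> v0; apply: (dn_tg nn v0).
have := proj2 (tgc_supp s) (r t); rewrite !r1 !mulr1 => h.
have -> : det (r s + r t) (tgc s) = det (r s) (tgc s) + det (r t) (tgc s).
  by rewrite /det !vE; ring.
by move: h; rewrite ler_norml => /andP[]; lra.
Qed.

End Curve.

Section Approach.
Context {R : realType} {T : Type} {F : set_system T} {FF : ProperFilter F}.

Definition from_right (u : T -> R) (s : R) := (\forall t \near F, s < u t) /\ slim F u s.
Definition from_left (u : T -> R) (s : R) := (\forall t \near F, u t < s) /\ slim F u s.

Lemma slim_comp (u : T -> R) s (g : R -> R) a : slim F u s -> slim (nbhs s) g a ->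
  slim F (fun t => g (u t)) a.
Proof. by move=> [h] [k]; split; apply: cvg_comp h k. Qed.

Lemma vlim_comp (u : T -> R) s (g : R -> R * R) a : slim F u s -> vlim (nbhs s) g a ->
  vlim F (fun t => g (u t)) a.
Proof.
by move=> h [k1 k2]; split;
  [apply: (slim_comp (g := fun t => (g t).1)) h k1|apply: (slim_comp (g := fun t => (g t).2)) h k2].
Qed.

Variables (n : R * R -> R) (r : R -> R * R).
Hypotheses (nn : plane_norm n) (rc : unit_curve n r).

Lemma from_right_det (u : T -> R) s : from_right u s ->
  \forall t \near F, 0 < det (r s) (r (u t)).
Proof.
move=> [h k]; have pi0 := @pi_gt0 R.
have lt : s < s + pi by lra.
by apply: filterS2 h (slim_lt k lt) => t *; apply: (rdet rc).
Qed.

Lemma from_left_det (u : T -> R) s : from_left u s ->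
  \forall t \near F, 0 < det (r (u t)) (r s).
Proof.
move=> [h k]; have pi0 := @pi_gt0 R.
have lt : s - pi < s by lra.
by apply: filterS2 h (slim_gt k lt) => t *; apply: (rdet rc) => //; lra.
Qed.

Lemma curve_lim (u : T -> R) s : slim F u s -> vlim F (fun t => r (u t)) (r s).
Proof. by move=> h; apply: vlim_comp h (rlim rc s). Qed.

Lemma chord_limu (FU : UltraFilter F) (u : T -> R) s : from_right u s ->
  vlim F (fun t => (n (r (u t) - r s))^-1 *: (r (u t) - r s)) (tgc n r s).
Proof.
move=> h; apply: (tg_chord nn FU (r1 rc s)); [exact: curve_lim (proj2 h)|exact: from_right_det|].
by apply: nearW => t; exact: (r1 rc).
Qed.

Lemma chord_gt0 (u : T -> R) s : from_right u s -> \forall t \near F, 0 < n (r (u t) - r s).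
Proof.
move=> h; apply: filterS (from_right_det h) => t k; apply: (n_gt0 nn); apply: contraTN k.
by rewrite subr_eq0 => /eqP ->; rewrite /det mulrC subrr ltxx.
Qed.

End Approach.

Lemma at_right_from (R : realType) (F : set_system R) s : F `=>` at_right s -> from_right (F := F) id s.
Proof.
move=> h; split; first by apply: h; exact: nbhs_right_gt.
by split; apply: cvg_trans h _; exact: cvg_within.
Qed.

Lemma at_left_from (R : realType) (F : set_system R) s : F `=>` at_left s -> from_left (F := F) id s.
Proof.
move=> h; split; first by apply: h; exact: nbhs_left_lt.
by split; apply: cvg_trans h _; exact: cvg_within.
Qed.

(** * Tangents at the vertices of an inscribed hexagon *)

Section HexTangents.
Variables (R : realType) (n : R * R -> R).
Hypotheses (nn : plane_norm n) (nl : nolong n).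
Local Notation V := (R * R)%type.

(** The support inequalities at [y] and [z] give both signs weakly. Equality would put [x] and
    [- z], or [x] and [y], on one supporting line; these points are at distance 1, so the sphere
    would contain a segment of length 1. *)
Lemma supp_hex (x y z e : V) : n x = 1 -> n y = 1 -> n z = 1 -> y = x + z ->
  supp n x e -> 0 < det y e /\ 0 < det e z.
Proof.
move=> x1 y1 z1 e0 se.
have x0 : x != 0 by apply: (n_neq0 nn); rewrite x1.
have D0 := supp_gt0 nn x0 se; have N := proj2 se.
have Ny := N y; have Nz := N z; rewrite x1 y1 z1 !mulr1 in Ny Nz.
have yE : det y e = det x e + det z e by rewrite e0 /det !vE; ring.
have ez : det e z = - det z e by rewrite /det; ring.
move: Ny Nz; rewrite !ler_norml => /andP[Ny1 Ny2] /andP[Nz1 Nz2].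
rewrite ez; split; rewrite lt_neqAle; apply/andP; split; try lra.
  apply/eqP => h; have nzl : n (x - - z) = 1 by rewrite opprK -e0.
  have := nl x1 _ nzl; rewrite (nN nn) => /(_ z1).
  have := N (x + - z); have -> : det (x + - z) e = 2 * det x e by rewrite /det !vE in yE h *; lra.
  by rewrite x1 mulr1 => /(le_trans (ler_norm _)); nra.
apply/eqP => h; have nzl : n (y - x) = 1 by rewrite e0 addrAC subrr add0r.
have := nl y1 x1 nzl.
have := N (y + x); have -> : det (y + x) e = 2 * det x e by rewrite /det !vE in yE h *; lra.
by rewrite x1 mulr1 => /(le_trans (ler_norm _)); nra.
Qed.

(** [supp_hex] is applied to three consecutive triples of the hexagon x, y, z, -x, -y. After
    multiplication by [det y z], each determinant expands into products of the positive quantities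
    so obtained. *)
Lemma hex_dets (x y z e1 e2 e3 : V) : n x = 1 -> n y = 1 -> n z = 1 -> y = x + z ->
  0 < det x y -> supp n x e1 -> supp n y e2 -> supp n z e3 ->
  [/\ 0 < det e1 e2, 0 < det e2 e3 & 0 < det e1 e3].
Proof.
move=> x1 y1 z1 e0 xy s1 s2 s3.
have nx : n (- x) = 1 by rewrite (nN nn).
have ny : n (- y) = 1 by rewrite (nN nn).
have ez : z = y + - x by rewrite e0 addrAC subrr add0r.
have ex : - x = z + - y by rewrite ez addrAC subrr add0r.
have [A1 B1] := supp_hex x1 y1 z1 e0 s1.
have [A2 B2] := supp_hex y1 z1 nx ez s2.
have [A3 B3] := supp_hex z1 nx ny ex s3.
have q0 : 0 < det y z by rewrite e0 /det !vE in xy *; lra.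
have A3' : 0 < det e3 x by rewrite /det !vE in A3 *; lra.
have B3' : 0 < det y e3 by rewrite /det !vE in B3 *; lra.
have B2' : 0 < det x e2 by rewrite /det !vE in B2 *; lra.
split; rewrite -(pmulr_lgt0 _ q0).
- have -> : det e1 e2 * det y z = det y e1 * det z e2 + det e1 z * (det z e2 + det x e2).
    by rewrite e0 /det !vE; ring.
  by rewrite addr_gt0// mulr_gt0// addr_gt0.
- have -> : det e2 e3 * det y z = det z e2 * det e3 x + det x e2 * (det e3 x + det y e3).
    by rewrite e0 /det !vE; ring.
  by rewrite addr_gt0// mulr_gt0// addr_gt0.
have -> : det e1 e3 * det y z = det y e1 * (det e3 x + det y e3) + det e1 z * det y e3.
  by rewrite e0 /det !vE; ring.
by rewrite addr_gt0// mulr_gt0// addr_gt0.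
Qed.
End HexTangents.

(** * The next point at distance 1 *)

Section Next.
Variables (R : realType) (n : R * R -> R) (r : R -> R * R).
Hypotheses (nn : plane_norm n) (rc : unit_curve n r) (nl : nolong n).
Local Notation V := (R * R)%type.

Lemma next_exists t : exists u, [/\ t < u, u < t + pi & n (r u - r t) = 1].
Proof.
have pi0 := @pi_gt0 R.
have d0 : n (r t - r t) = 0 by rewrite subrr (n0 nn).
have d2 : n (r (t + pi) - r t) = 2.
  have -> : r (t + pi) - r t = (-2) *: r t by rewrite (rpi rc); apply: vP; rewrite !vE; ring.
  by rewrite (nZ nn) (r1 rc) normrN ger0_norm// mulr1.
have [||| u] := @IVT R (fun u => n (r u - r t)) t (t + pi) 1.
- lra.
- apply: continuous_subspaceT => u.
  by have [] := vlim_n nn (vlimB (rlim rc u) (vlim_cst (r t))).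
- by rewrite d0 d2 ge_min le_max; apply/andP; split; apply/orP; [left|right]; lra.
rewrite in_itv/= => /andP[tu ut] h; exists u; split=> //.
- by rewrite lt_neqAle tu andbT; apply/eqP => e; rewrite -e d0 in h; lra.
- by rewrite lt_neqAle ut andbT; apply/eqP => e; rewrite e d2 in h; lra.
Qed.

Lemma next_unique t u u' : t < u -> u < t + pi -> t < u' -> u' < t + pi ->
  n (r u - r t) = 1 -> n (r u' - r t) = 1 -> u = u'.
Proof.
have aux v v' : t < v -> v < v' -> v' < t + pi -> n (r v - r t) = 1 -> n (r v' - r t) = 1 -> False.
  move=> tv vv v't h h'; have [a [b [a0 b0 e]]] := r_comb rc tv vv v't.
  exact: (dist1_unique nn nl (r1 rc t) (r1 rc v) (r1 rc v') a0 (ltW b0) e).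
move=> tu ut tu' ut' h h'; have [k|k|//] := ltgtP u u'.
  by case: (aux u u').
by case: (aux u' u).
Qed.

Variable h : R -> R.
Hypotheses (h_gt : forall t, t < h t) (h_lt : forall t, h t < t + pi)
  (h_dist : forall t, n (r (h t) - r t) = 1).

(** The unit vector [r (h t) - r t] lies counterclockwise of [r (h t)] and at distance [n (r t) = 1]
    from it, so uniqueness identifies it with the next point. *)
Lemma h_hex t : r (h t) = r t + r (h (h t)).
Proof.
have q1 := h_dist t.
have d : 0 < det (r (h t)) (r (h t) - r t).
  have -> : det (r (h t)) (r (h t) - r t) = det (r t) (r (h t)) by rewrite /det !vE; ring.
  exact: (rdet rc).
have [u [hu uh e]] := r_surj nn rc q1 d.
suff -> : h (h t) = u by rewrite e addrC subrK.
apply: (@next_unique (h t)) => //.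
by rewrite e addrAC subrr add0r (nN nn) (r1 rc).
Qed.

Lemma h3 t : h (h (h t)) = t + pi.
Proof.
have pi0 := @pi_gt0 R.
have e : r (h (h (h t))) = r (t + pi).
  have a := h_hex t; have b := h_hex (h t); rewrite (rpi rc).
  by rewrite a in b; apply: vP; [move: (congr1 fst b)|move: (congr1 snd b)]; rewrite !vE; lra.
have := (h_gt t, h_gt (h t), h_gt (h (h t)), h_lt t, h_lt (h t), h_lt (h (h t))).
move=> [[[[[a1 a2] a3] b1] b2] b3].
have [k|k|//] := ltgtP (h (h (h t))) (t + pi).
  by have [] := @r_inj _ _ _ nn rc _ _ k _ e; lra.
by have [] := @r_inj _ _ _ nn rc _ _ k _ (esym e); lra.
Qed.

Lemma h_pi t : h (t + pi) = h t + pi.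
Proof. by rewrite -h3 h3. Qed.

(** If [t < h s], then [dist_mono] bounds the distance from [r t] to [r (h s)] by 1. Were
    [h t < h s], it would also be at least 1, against uniqueness. Equality is excluded by [h3],
    which makes [h] injective. *)
Lemma h_mono s t : s < t -> h s < h t.
Proof.
move=> st; have [a|ht] := leP (h s) t; first exact: le_lt_trans (h_gt t).
have hs := h_lt s; have tst := h_gt t; have ht' := h_lt t.
have d : n (r (h s) - r t) <= 1.
  have sth : h s < t + pi by lra.
  have [a [b [a0 b0 e]]] := r_comb rc st ht hs.
  have := dist_mono nn (r1 rc (h s)) (r1 rc t) (r1 rc s) (ltW b0) (ltW a0).
  by rewrite addrC => /(_ e); rewrite n_subC// [X in _ <= X]n_subC// h_dist.
rewrite lt_neqAle; apply/andP; split.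
  apply/eqP => e; have := h3 s; rewrite e h3; lra.
rewrite leNgt; apply/negP => k.
have hst : h s < t + pi by lra.
have [a [b [a0 b0 e]]] := r_comb rc tst k hst.
have d' := dist_mono nn (r1 rc t) (r1 rc (h t)) (r1 rc (h s)) (ltW a0) (ltW b0) e.
have d1 : n (r (h s) - r t) = 1 by apply/eqP; rewrite eq_le d -{1}(h_dist t) d'.
by have := @next_unique t (h s) (h t) ht hst tst ht' d1 (h_dist t); lra.
Qed.

(** An increasing surjection is continuous, and [h] is onto because its third iterate is a
    translation. *)
Lemma h_cont t : slim (nbhs t) h (h t).
Proof.
have surj u : exists w, h w = u by exists (h (h (u - pi))); rewrite h3 subrK.
apply/slimP => d d0.
have [a ea] := surj (h t - d); have [b eb] := surj (h t + d).
have at_ : a < t.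
  by rewrite ltNge; apply/negP; rewrite le_eqVlt => /orP[/eqP e|/h_mono]; [rewrite e in ea|]; lra.
have tb : t < b.
  by rewrite ltNge; apply/negP; rewrite le_eqVlt => /orP[/eqP e|/h_mono]; [rewrite e in eb|]; lra.
have N : nbhs t (fun u => a < u /\ u < b).
  by apply: filterI; [exact: lt_nbhsr|exact: lt_nbhsl].
apply: filterS N => u [/h_mono au /h_mono ub].
by rewrite ltr_norml; apply/andP; split; lra.
Qed.

Lemma h_right {T} {F : set_system T} {FF : ProperFilter F} (u : T -> R) s :
  from_right (F := F) u s -> from_right (F := F) (fun t => h (u t)) (h s).
Proof.
by move=> [a b]; split; [apply: filterS a => t; exact: h_mono|apply: slim_comp b (h_cont s)].
Qed.

Lemma h_left {T} {F : set_system T} {FF : ProperFilter F} (u : T -> R) s :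
  from_left (F := F) u s -> from_left (F := F) (fun t => h (u t)) (h s).
Proof.
by move=> [a b]; split; [apply: filterS a => t; exact: h_mono|apply: slim_comp b (h_cont s)].
Qed.

End Next.

(** * What an isometry of spheres preserves *)

Section LeftTangent.
Variables (R : realType) (n : R * R -> R).
Hypothesis nn : plane_norm n.
Local Notation V := (R * R)%type.
Implicit Types p q w e : V.

Lemma suppZ (c : R) p e : 0 < c -> supp n p e -> supp n (c *: p) e.
Proof.
move=> c0 [e1 h]; split=> // w; rewrite (nZ nn) (gtr0_norm c0).
have -> : det (c *: p) e = c * det p e by rewrite /det !vE; ring.
by rewrite mulrCA -mulrA ler_pM2l.
Qed.

(* e is the left tangent of the sphere at p *)
Definition ltan p e := supp n p e /\ forall e', supp n p e' -> 0 <= det e e'.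

Lemma ltan_unique p e e' : p != 0 -> ltan p e -> ltan p e' -> e = e'.
Proof.
move=> p0 [s h] [s' h']; apply: (supp_eq nn p0 s s').
by have := h _ s'; have := h' _ s; rewrite /det; lra.
Qed.

(** Mirror image of [tg_right]. The left tangent has no defining formula here; its existence comes
    from this limit. *)
Lemma tg_left {T} {F : set_system T} (FU : UltraFilter F) (u v : T -> V) p :
  p != 0 -> vlim F u p -> (\forall t \near F, 0 < det (u t) p) ->
  (\forall t \near F, supp n (u t) (v t)) -> exists2 e, ltan p e & vlim F v e.
Proof.
move=> p0 up pu sv; have FF : ProperFilter F by exact: ultra_proper.
have [|e ve] := @ultra_vlim _ _ nn _ _ FU v 1; first by apply: filterS sv => t [->].
have se : supp n p e by exact: (supp_lim nn up ve sv).
exists e => //; split=> // e' se'.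
apply: (@slim_ge _ _ F _ (fun t => det (v t) e')).
  by apply: vlim_det => //; exact: vlim_cst.
apply: filterS2 pu sv => t h k; apply: (supp_turn nn _ p0 k se' h).
by apply: contraTN h => /eqP ->; rewrite /det !vE !mul0r subrr ltxx.
Qed.

Variable r : R -> V.
Hypothesis rc : unit_curve n r.

Lemma mid_neq0 s t : s < t -> t < s + pi -> r s + r t != 0.
Proof.
move=> st ts; apply/eqP => h; have := rdet rc st ts.
have -> : r t = - r s by apply/eqP; rewrite -addr_eq0 addrC h.
by rewrite detrN detrr oppr0 ltxx.
Qed.

Section Filter.
Context {T : Type} {F : set_system T} {FF : ProperFilter F} (FU : UltraFilter F).
Implicit Types u : T -> R.

(** The midpoint tends to [r s] itself and has the same supporting directions as the sum, so
    [tg_right] and [tg_left] apply to the tangents at the sums. *)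
Lemma half_lim u s : slim F u s -> vlim F (fun t => (1 / 2) *: (r s + r (u t))) (r s).
Proof.
move=> h; have {2}-> : r s = (1 / 2) *: (r s + r s) by apply: vP; rewrite !vE; field.
by apply: vlimZ; [exact: slim_cst|apply: vlimD; [exact: vlim_cst|exact: (curve_lim rc h)]].
Qed.

Lemma tg_mid_right u s : from_right (F := F) u s ->
  vlim F (fun t => tg n (r s + r (u t))) (tgc n r s).
Proof.
move=> h; have D := from_right_det (FF := FF) rc h.
apply: (tg_right nn FU (r_neq0 nn rc s) (half_lim (proj2 h))).
  apply: filterS D => t k.
  have -> : det (r s) (1 / 2 *: (r s + r (u t))) = det (r s) (r (u t)) / 2.
    by rewrite /det !vE; field.
  by rewrite divr_gt0.
apply: filterS D => t k; apply: suppZ; first lra.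
apply: (tg_supp nn); apply/eqP => v0; move: k.
have -> : r (u t) = - r s by apply/eqP; rewrite -addr_eq0 addrC v0.
by rewrite detrN detrr oppr0 ltxx.
Qed.

Lemma tgc_right u s : from_right (F := F) u s -> vlim F (fun t => tgc n r (u t)) (tgc n r s).
Proof.
move=> h; apply: (tg_right nn FU (r_neq0 nn rc s) (curve_lim rc (proj2 h))).
  exact: (from_right_det rc h).
by apply: nearW => t; exact: tgc_supp.
Qed.

Lemma tgc_left u s : from_left (F := F) u s ->
  exists2 e, ltan (r s) e & vlim F (fun t => tgc n r (u t)) e.
Proof.
move=> h; apply: (tg_left FU (r_neq0 nn rc s) (curve_lim rc (proj2 h))).
  exact: (from_left_det rc h).
by apply: nearW => t; exact: tgc_supp.
Qed.

Lemma tg_mid_left u s e : from_left (F := F) u s -> ltan (r s) e ->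
  vlim F (fun t => tg n (r s + r (u t))) e.
Proof.
move=> h le; have D := from_left_det (FF := FF) rc h.
have [||e' le' ve'] := tg_left FU (v := fun t => tg n (r s + r (u t)))
    (r_neq0 nn rc s) (half_lim (proj2 h)).
- apply: filterS D => t k.
  have -> : det (1 / 2 *: (r s + r (u t))) (r s) = det (r (u t)) (r s) / 2.
    by rewrite /det !vE; field.
  by rewrite divr_gt0.
- apply: filterS D => t k; apply: suppZ; first lra.
  apply: (tg_supp nn); apply/eqP => v0; move: k.
  have -> : r (u t) = - r s by apply/eqP; rewrite -addr_eq0 addrC v0.
  by rewrite detNr detrr oppr0 ltxx.
by rewrite (ltan_unique (r_neq0 nn rc s) le le').
Qed.

End Filter.
End LeftTangent.

Section Pair.
Variables (R : realType) (n m : R * R -> R) (r rho : R -> R * R).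
Hypotheses (nn : plane_norm n) (mm : plane_norm m).
Hypotheses (rc : unit_curve n r) (rhoc : unit_curve m rho).
Hypothesis iso : forall s t, n (r s - r t) = m (rho s - rho t).
Local Notation V := (R * R)%type.
Local Notation e := (tgc n r).
Local Notation E := (tgc m rho).

Lemma iso_plus s t : n (r s + r t) = m (rho s + rho t).
Proof. by rewrite -[r t]opprK -[rho t]opprK -(rpi rc) -(rpi rhoc). Qed.

Lemma nolong_pair : nolong n -> nolong m.
Proof.
move=> nl p q p1 q1; have [s <-] := r_onto mm rhoc p1; have [t <-] := r_onto mm rhoc q1.
by rewrite -iso -iso_plus; apply: nl; exact: (r1 rc).
Qed.

Lemma mid_pair s t : r s + r t != 0 -> rho s + rho t != 0.
Proof. by move=> h; apply: (n_neq0 mm); rewrite -iso_plus; exact: (n_gt0 nn). Qed.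

(** Both sides are the logarithmic derivative of [n (r u + r t) = m (rho u + rho t)] as [u]
    decreases to [s], per unit of the common chord length. *)
Lemma slope_common s t : r s + r t != 0 ->
  det (e s) (tg n (r s + r t)) / det (r s + r t) (tg n (r s + r t)) =
  det (E s) (tg m (rho s + rho t)) / det (rho s + rho t) (tg m (rho s + rho t)).
Proof.
move=> v0; have w0 := mid_pair v0.
have [F [FU sF]] := ultraFilterLemma (at_right_proper_filter s).
have FF : ProperFilter F by exact: ultra_proper.
have A := dn_chord nn rc FU (r t) sF; have B := dn_chord mm rhoc FU (rho t) sF.
have AB : dn n (r s + r t) (e s) = dn m (rho s + rho t) (E s).
  apply: (slim_unique A); apply: (slim_eq _ B); apply: nearW => u.
  by rewrite !iso_plus iso.
have nv := n_gt0 nn v0; have mv := n_gt0 mm w0.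
have dv := supp_gt0 nn v0 (tg_supp nn v0); have dw := supp_gt0 mm w0 (tg_supp mm w0).
have C := chord_dn nn rc v0; have D := chord_dn mm rhoc w0.
have C' : det (e s) (tg n (r s + r t)) / det (r s + r t) (tg n (r s + r t)) =
   dn n (r s + r t) (e s) / n (r s + r t).
  apply: (mulIf (lt0r_neq0 dv)).
  by rewrite divfK ?gt_eqF// mulrAC C [_ * det _ _]mulrC mulfK ?gt_eqF.
have D' : det (E s) (tg m (rho s + rho t)) / det (rho s + rho t) (tg m (rho s + rho t)) =
   dn m (rho s + rho t) (E s) / m (rho s + rho t).
  apply: (mulIf (lt0r_neq0 dw)).
  by rewrite divfK ?gt_eqF// mulrAC D [_ * det _ _]mulrC mulfK ?gt_eqF.
by rewrite C' D' AB iso_plus.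
Qed.

Section Kappa.
Context {T : Type} {F : set_system T} {FF : ProperFilter F} (FU : UltraFilter F).
Variables (u : T -> R) (s : R) (D : T -> R).

Lemma right_mid_neq0 : from_right (F := F) u s -> \forall t \near F, r s + r (u t) != 0.
Proof.
move=> [h k]; have pi0 := @pi_gt0 R.
have lt : s < s + pi by lra.
by apply: filterS2 h (slim_lt k lt) => t *; apply: (mid_neq0 rc).
Qed.

(** The quotient is the radial rate at which the tangent turns. [slope_common] for the pairs
    [(s, u t)] and [(u t, s)] involves the same tangent at the sum; subtract the two, divide by
    [D t], and let [u t] decrease to [s]. *)
Lemma kappa_common de dE : from_right (F := F) u s ->
  vlim F (fun t => (D t)^-1 *: (e (u t) - e s)) de ->
  vlim F (fun t => (D t)^-1 *: (E (u t) - E s)) dE ->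
  det de (e s) / det (r s) (e s) = det dE (E s) / det (rho s) (E s).
Proof.
move=> us hde hdE.
pose f (k : V -> R) (c : R -> V) t :=
  det ((D t)^-1 *: (tgc k c (u t) - tgc k c s)) (tg k (c s + c (u t))) /
  det (c s + c (u t)) (tg k (c s + c (u t))).
have lim (k : V -> R) (c : R -> V) d : plane_norm k -> unit_curve k c ->
    vlim F (fun t => (D t)^-1 *: (tgc k c (u t) - tgc k c s)) d ->
    slim F (f k c) (det d (tgc k c s) / det (c s + c s) (tgc k c s)).
  move=> kk cc hd; have M := tg_mid_right (FF := FF) kk cc FU us.
  have p0 := supp_gt0 kk (r_neq0 kk cc s) (tgc_supp kk cc s).
  apply: slim_div; last 2 first.
  - exact: vlim_det.
  - apply: vlim_det => //; apply: vlimD; first exact: vlim_cst.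
    exact: (curve_lim cc (proj2 us)).
  have -> : det (c s + c s) (tgc k c s) = 2 * det (c s) (tgc k c s).
    by rewrite /det !vE; ring.
  by rewrite mulf_neq0 ?gt_eqF.
have A := lim _ _ _ nn rc hde; have B := lim _ _ _ mm rhoc hdE.
have AB : \forall t \near F, f n r t = f m rho t.
  apply: filterS (right_mid_neq0 us) => t v0.
  have K1 := slope_common v0; rewrite addrC in v0; have K2 := slope_common v0.
  rewrite [r (u t) + _]addrC [rho (u t) + _]addrC in K2.
  have aux (a b w : V) (x : R) : det (x *: (a - b)) w = x * (det a w - det b w).
    by rewrite /det !vE; ring.
  have X (a b d x : R) : x * (a - b) / d = x * (a / d - b / d) by rewrite -mulrA mulrBl.
  by rewrite /f (aux (e _)) (aux (E _)) X [in RHS]X K1 K2.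
have := slim_unique (FF := FF) B (slim_eq (FF := FF) AB A).
have aux (a b : V) : det (a + a) b = 2 * det a b by rewrite /det !vE; ring.
have p0 := supp_gt0 nn (r_neq0 nn rc s) (tgc_supp nn rc s).
have q0 := supp_gt0 mm (r_neq0 mm rhoc s) (tgc_supp mm rhoc s).
rewrite !aux => /eq_divP H; apply/eq_divP => //.
by have := H (mulr_gt0 (@ltr0Sn R 1) q0) (mulr_gt0 (@ltr0Sn R 1) p0); lra.
Qed.

End Kappa.

(** * Jumps of the tangent at a corner *)

Section Jump.
Variables (s : R) (f g : V).
Hypotheses (lf : ltan n (r s) f) (lg : ltan m (rho s) g).

Let p0 : 0 < det (r s) (e s).
Proof. exact: supp_gt0 (r_neq0 nn rc s) (tgc_supp nn rc s). Qed.
Let q0 : 0 < det (rho s) (E s).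
Proof. exact: supp_gt0 (r_neq0 mm rhoc s) (tgc_supp mm rhoc s). Qed.
Let pf : 0 < det (r s) f.
Proof. exact: supp_gt0 (r_neq0 nn rc s) (proj1 lf). Qed.
Let qg : 0 < det (rho s) g.
Proof. exact: supp_gt0 (r_neq0 mm rhoc s) (proj1 lg). Qed.

(** [slope_common] for [(s, t)] with [t] increasing to [s]: the tangent at the sum tends to the left
    tangent. *)
Lemma jump1 : det (e s) f / det (r s) f = det (E s) g / det (rho s) g.
Proof.
have [F [FU sF]] := ultraFilterLemma (at_left_proper_filter s).
have FF : ProperFilter F by exact: ultra_proper.
have us := at_left_from sF; have pi0 := @pi_gt0 R.
pose c (k : V -> R) (c : R -> V) t :=
  det (tgc k c s) (tg k (c s + c t)) / det (c s + c t) (tg k (c s + c t)).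
have lim (k : V -> R) (z : R -> V) d : plane_norm k -> unit_curve k z -> ltan k (z s) d ->
    slim F (c k z) (det (tgc k z s) d / det (z s + z s) d).
  move=> kk cc ld; have M := tg_mid_left (FF := FF) kk cc FU us ld.
  have p1 := supp_gt0 kk (r_neq0 kk cc s) (proj1 ld).
  apply: slim_div; last 2 first.
  - exact: (vlim_det (vlim_cst _) M).
  - apply: vlim_det => //; apply: vlimD; first exact: vlim_cst.
    exact: (curve_lim cc (proj2 us)).
  have -> : det (z s + z s) d = 2 * det (z s) d by rewrite /det !vE; ring.
  by rewrite mulf_neq0 ?gt_eqF.
have A := lim _ _ _ nn rc lf; have B := lim _ _ _ mm rhoc lg.
have AB : \forall t \near F, c n r t = c m rho t.
  have lt : s - pi < s by lra.
  apply: filterS2 (proj1 us) (slim_gt (proj2 us) lt) => t ts st.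
  by apply: slope_common; rewrite addrC; apply: (mid_neq0 rc) => //; lra.
have := slim_unique (FF := FF) B (slim_eq (FF := FF) AB A).
have aux (a b : V) : det (a + a) b = 2 * det a b by rewrite /det !vE; ring.
rewrite !aux => /eq_divP H; apply/eq_divP => //.
by have := H (mulr_gt0 (@ltr0Sn R 1) qg) (mulr_gt0 (@ltr0Sn R 1) pf); lra.
Qed.

(** [slope_common] for [(u, t)] with [t] fixed and [u] increasing to [s]. The tangents at the sums
    converge along the ultrafilter to some supporting directions, not necessarily to the right
    tangents, hence the existential. *)
Lemma jump2_aux t : s < t -> t < s + pi -> exists x y : V,
  [/\ supp n (r s + r t) x, supp m (rho s + rho t) y &
      det f x / det (r s + r t) x = det g y / det (rho s + rho t) y].
Proof.
move=> st ts; have v0 := mid_neq0 rc st ts; have w0 := mid_pair v0.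
have [F [FU sF]] := ultraFilterLemma (at_left_proper_filter s).
have FF : ProperFilter F by exact: ultra_proper.
have us := at_left_from sF; have pi0 := @pi_gt0 R.
have lt : t - pi < s by lra.
have N : \forall u \near F, r u + r t != 0.
  by apply: filterS2 (proj1 us) (slim_gt (proj2 us) lt) => u us' uu; apply: (mid_neq0 rc); lra.
have lim (k : V -> R) (z : R -> V) d : plane_norm k -> unit_curve k z -> ltan k (z s) d ->
    z s + z t != 0 -> (\forall u \near F, z u + z t != 0) ->
    exists2 x, supp k (z s + z t) x &
    slim F (fun u => det (tgc k z u) (tg k (z u + z t)) / det (z u + z t) (tg k (z u + z t)))
           (det d x / det (z s + z t) x).
  move=> kk cc ld z0 zN.
  have [|x hx] := @ultra_vlim _ _ kk _ _ FU (fun u => tg k (z u + z t)) 1.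
    by apply: filterS zN => u; move=> /(n_tg kk) ->.
  have [d' ld' hd'] := tgc_left (FF := FF) kk cc FU us.
  have e0 := ltan_unique kk (r_neq0 kk cc s) ld ld'; rewrite -e0 in hd'.
  have zl : vlim F (fun u => z u + z t) (z s + z t).
    by apply: vlimD; [exact: (curve_lim cc (proj2 us))|exact: vlim_cst].
  have sx : supp k (z s + z t) x.
    by apply: (supp_lim kk zl hx); apply: filterS zN => u; exact: tg_supp.
  exists x => //; apply: slim_div; last 2 first.
  - exact: vlim_det.
  - exact: vlim_det.
  by rewrite gt_eqF// (supp_gt0 kk).
have [x sx hx] := lim _ _ _ nn rc lf v0 N.
have [|y sy hy] := lim _ _ _ mm rhoc lg w0.
  by apply: filterS N => u; exact: mid_pair.
exists x, y; split=> //; apply: (slim_unique (FF := FF) hx); apply: (slim_eq _ hy).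
by apply: filterS N => u v; rewrite slope_common.
Qed.

(** Let [t] decrease to [s] in [jump2_aux]; whichever supporting directions were found there,
    [tg_right] sends them to the right tangent. *)
Lemma jump2 : det f (e s) / det (r s) (e s) = det g (E s) / det (rho s) (E s).
Proof.
have pi0 := @pi_gt0 R.
have : forall t, exists xy : V * V, s < t -> t < s + pi ->
  [/\ supp n (r s + r t) xy.1, supp m (rho s + rho t) xy.2 &
      det f xy.1 / det (r s + r t) xy.1 = det g xy.2 / det (rho s + rho t) xy.2].
  move=> t; have [st|st] := ltP s t; last by exists (0, 0) => h; lra.
  have [ts|ts] := ltP t (s + pi); last by exists (0, 0) => _ h; lra.
  by have [x [y h]] := jump2_aux st ts; exists (x, y).
move=> /choice[xy hxy].
have [F [FU sF]] := ultraFilterLemma (at_right_proper_filter s).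
have FF : ProperFilter F by exact: ultra_proper.
have us := at_right_from sF.
have lt : s < s + pi by lra.
have N : \forall t \near F, s < t /\ t < s + pi.
  by apply: filterS2 (proj1 us) (slim_lt (proj2 us) lt).
have lim (k : V -> R) (z : R -> V) (x : R -> V) (d : V) : plane_norm k -> unit_curve k z ->
    (\forall t \near F, supp k (z s + z t) (x t)) ->
    slim F (fun t => det d (x t) / det (z s + z t) (x t))
      (det d (tgc k z s) / det (z s + z s) (tgc k z s)).
  move=> kk cc sx; have D := from_right_det (FF := FF) cc us.
  have xl : vlim F x (tgc k z s).
    apply: (tg_right kk FU (r_neq0 kk cc s) (half_lim cc (proj2 us))).
      apply: filterS D => t h.
      have -> : det (z s) (1 / 2 *: (z s + z t)) = det (z s) (z t) / 2.
        by rewrite /det !vE; field.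
      by rewrite divr_gt0.
    by apply: filterS sx => t; apply: suppZ => //; lra.
  have p1 := supp_gt0 kk (r_neq0 kk cc s) (tgc_supp kk cc s).
  apply: slim_div; last 2 first.
  - exact: (vlim_det (vlim_cst _) xl).
  - apply: vlim_det => //; apply: vlimD; first exact: vlim_cst.
    exact: (curve_lim cc (proj2 us)).
  have -> : det (z s + z s) (tgc k z s) = 2 * det (z s) (tgc k z s) by rewrite /det !vE; ring.
  by rewrite mulf_neq0 ?gt_eqF.
have [A B] : slim F (fun t => det f (xy t).1 / det (r s + r t) (xy t).1)
      (det f (e s) / det (r s + r s) (e s)) /\
    slim F (fun t => det g (xy t).2 / det (rho s + rho t) (xy t).2)
      (det g (E s) / det (rho s + rho s) (E s)).
  by split; apply: lim => //; apply: filterS N => t [a b]; case: (hxy t a b).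
have AB : \forall t \near F, det f (xy t).1 / det (r s + r t) (xy t).1 =
    det g (xy t).2 / det (rho s + rho t) (xy t).2.
  by apply: filterS N => t [a b]; case: (hxy t a b).
have := slim_unique (FF := FF) B (slim_eq (FF := FF) AB A).
have aux (a b : V) : det (a + a) b = 2 * det a b by rewrite /det !vE; ring.
rewrite !aux => /eq_divP H; apply/eq_divP => //.
by have := H (mulr_gt0 (@ltr0Sn R 1) q0) (mulr_gt0 (@ltr0Sn R 1) p0); lra.
Qed.

(** [jump2] gives the coefficient of the position vector. Dividing [jump1] by [jump2] gives that of
    the tangent, unless the numerators vanish, in which case the left and right tangents coincide on
    both curves. *)
Lemma jump_common : exists al be : R,
  [/\ 0 <= al, 0 < be, f = al *: r s + be *: e s & g = al *: rho s + be *: E s].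
Proof.
have al0 : 0 <= det f (e s) / det (r s) (e s).
  by rewrite divr_ge0 ?(ltW p0)//; apply: (proj2 lf); exact: tgc_supp.
have fE := vdecomp f (lt0r_neq0 p0); have gE := vdecomp g (lt0r_neq0 q0).
exists (det f (e s) / det (r s) (e s)), (det (r s) f / det (r s) (e s)).
split=> //; first exact: divr_gt0.
rewrite {1}gE -jump2; congr (_ + _ *: _).
have [h|h] := eqVneq (det f (e s)) 0.
  have ef : f = e s by apply: (supp_eq nn (r_neq0 nn rc s) (proj1 lf) (tgc_supp nn rc s)).
  have h' : det g (E s) = 0.
    by have := jump2; rewrite h mul0r => /esym/eqP; rewrite mulf_eq0 invr_eq0 (gt_eqF q0) orbF => /eqP.
  have eg : g = E s by apply: (supp_eq mm (r_neq0 mm rhoc s) (proj1 lg) (tgc_supp mm rhoc s)).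
  by rewrite ef eg !divff ?gt_eqF.
have J1 := jump1; have J2 := jump2.
have sw (a b : V) : det a b = - det b a by rewrite /det; ring.
rewrite (sw (e s)) (sw (E s)) in J1.
move/(eq_divP _ _ pf qg): J1 => J1; move/(eq_divP _ _ p0 q0): J2 => J2.
apply/eq_divP => //.
have J3 : det f (e s) * (det (rho s) g * det (r s) (e s)) =
          det f (e s) * (det (r s) f * det (rho s) (E s)).
  have -> : det f (e s) * (det (rho s) g * det (r s) (e s)) =
    (det f (e s) * det (rho s) g) * det (r s) (e s) by ring.
  have -> : det f (e s) * det (rho s) g = det g (E s) * det (r s) f by lra.
  by rewrite mulrAC -J2; ring.
exact: (mulfI h).
Qed.

End Jump.
End Pair.

(** * Derivatives along a filter, and the algebra of moving frames *)

Section Derivation.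
Context {R : realType} {T : Type} {F : set_system T} {FF : ProperFilter F}.
Variable D : T -> R.
Local Notation V := (R * R)%type.
Implicit Types (f g : T -> R) (u v : T -> V).

(** [d] is the derivative of [f] along [F] at a point where [f] has the value [a0], with [D t] as
    increment of the variable. Convergence of [f] is included because the product and quotient rules
    use it. *)
Definition isd f (a0 d : R) := slim F (fun t => (D t)^-1 * (f t - a0)) d /\ slim F f a0.
Definition visd u (p dp : V) := vlim F (fun t => (D t)^-1 *: (u t - p)) dp /\ vlim F u p.

Lemma isd_unique f a0 d d' : isd f a0 d -> isd f a0 d' -> d = d'.
Proof. by move=> [h _] [k _]; exact: slim_unique h k. Qed.

Lemma isd_eq f g a0 b0 d : (\forall t \near F, f t = g t) -> a0 = b0 -> isd f a0 d -> isd g b0 d.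
Proof.
move=> fg <- [h k]; split; last exact: slim_eq fg k.
by apply: slim_eq h; apply: filterS fg => t ->.
Qed.

Lemma isd_cst c : isd (fun=> c) c 0.
Proof.
split; last exact: slim_cst.
by apply: slim_eq (slim_cst 0); apply: nearW => t; rewrite subrr mulr0.
Qed.

Lemma isdD f g a0 b0 d d' : isd f a0 d -> isd g b0 d' -> isd (fun t => f t + g t) (a0 + b0) (d + d').
Proof.
move=> [h k] [h' k']; split; last exact: slimD.
by apply: slim_eq (slimD h h'); apply: nearW => t; ring.
Qed.

Lemma isdM f g a0 b0 d d' : isd f a0 d -> isd g b0 d' ->
  isd (fun t => f t * g t) (a0 * b0) (d * b0 + a0 * d').
Proof.
move=> [h k] [h' k']; split; last exact: slimM.
apply: slim_eq (slimD (slimM h k') (slimM (slim_cst a0) h')).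
by apply: nearW => t; ring.
Qed.

Lemma isdN f a0 d : isd f a0 d -> isd (fun t => - f t) (- a0) (- d).
Proof.
move=> [h k]; split; last exact: slimN.
by apply: slim_eq (slimN h); apply: nearW => t; ring.
Qed.

Lemma isdB f g a0 b0 d d' : isd f a0 d -> isd g b0 d' -> isd (fun t => f t - g t) (a0 - b0) (d - d').
Proof. by move=> h k; apply: isdD => //; exact: isdN. Qed.

Lemma isdV f a0 d : a0 != 0 -> isd f a0 d -> isd (fun t => (f t)^-1) a0^-1 (- d / a0 ^+ 2).
Proof.
move=> a00 [h k]; have iv := slimV (FF := FF) a00 k; split => //.
have fn : \forall t \near F, f t != 0.
  have [a0p|a0n] := ltP 0 a0.
    by apply: filterS (slim_gt k a0p) => t; apply: lt0r_neq0.
  have a0n' : a0 < 0 by rewrite lt_neqAle a00.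
  by apply: filterS (slim_lt k a0n') => t /ltr0_neq0.
have -> : - d / a0 ^+ 2 = d * (- a0^-1 * a0^-1) by field.
apply: slim_eq (slimM h (slimM (slim_cst (- a0^-1)) iv)).
apply: filterS fn => t ft; rewrite -!mulrA; congr (_ * _); field.
by rewrite ft a00.
Qed.

Lemma visd_det u v p q dp dq : visd u p dp -> visd v q dq ->
  isd (fun t => det (u t) (v t)) (det p q) (det dp q + det p dq).
Proof.
move=> [h k] [h' k']; split; last exact: vlim_det.
apply: slim_eq (slimD (vlim_det h k') (vlim_det (vlim_cst p) h')).
by apply: nearW => t; rewrite /det !vE; ring.
Qed.

Lemma visd_unique u p dp dp' : visd u p dp -> visd u p dp' -> dp = dp'.
Proof. by move=> [h _] [k _]; exact: vlim_unique h k. Qed.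

Lemma visd_eq u v p q d : (\forall t \near F, u t = v t) -> p = q -> visd u p d -> visd v q d.
Proof.
move=> uv <- [h k]; split; last exact: vlim_eq uv k.
by apply: vlim_eq h; apply: filterS uv => t ->.
Qed.

Lemma visdD u v p q dp dq : visd u p dp -> visd v q dq ->
  visd (fun t => u t + v t) (p + q) (dp + dq).
Proof.
move=> [h k] [h' k']; split; last exact: vlimD.
by apply: vlim_eq (vlimD h h'); apply: nearW => t; apply: vP; rewrite !vE; ring.
Qed.

Lemma visdZ f u a0 p d dp : isd f a0 d -> visd u p dp ->
  visd (fun t => f t *: u t) (a0 *: p) (d *: p + a0 *: dp).
Proof.
move=> [h k] [h' k']; split; last exact: vlimZ.
apply: vlim_eq (vlimD (vlimZ h k') (vlimZ (slim_cst a0) h')).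
by apply: nearW => t; apply: vP; rewrite !vE; ring.
Qed.

End Derivation.

Section Frames.
Variable R : realType.
Local Notation V := (R * R)%type.
Implicit Types x z e f v X Z E G : V.

Definition co1 v e f : R := det v f / det e f.
Definition co2 v e f : R := det e v / det e f.

Lemma coE v e f : det e f != 0 -> v = co1 v e f *: e + co2 v e f *: f.
Proof. exact: vdecomp. Qed.

Lemma frame_coef e f (a b c d : R) : det e f != 0 ->
  a *: e + b *: f = c *: e + d *: f -> a = c /\ b = d.
Proof.
move=> h k; split; apply: (mulIf h).
  by move: (congr1 (fun w => det w f) k); rewrite /det !vE; lra.
by move: (congr1 (fun w => det e w) k); rewrite /det !vE; lra.
Qed.

(* e1, e2, e3 are tangents at x, x + z, z, and E1, E2, E3 tangents at the images X, X + Z, Z;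
   the equations list what an isometry of spheres is seen to preserve. *)
Definition frames x z e1 e2 e3 X Z E1 E2 E3 :=
  [/\ [/\ 0 < det e1 e3, 0 < det e1 e2, 0 < det e2 e3, 0 < det x e1 & 0 < det z e3],
      [/\ 0 < det E1 E3, 0 < det E1 E2, 0 < det E2 E3, 0 < det X E1 & 0 < det Z E3],
      co2 x e1 e3 = co2 X E1 E3 /\ co1 z e1 e3 = co1 Z E1 E3,
      co1 e2 e1 e3 = co1 E2 E1 E3 /\ co2 e2 e1 e3 = co2 E2 E1 E3 &
      det (x + z) e2 / det e1 e3 = det (X + Z) E2 / det E1 E3].

(** The freedom left by the preserved quantities; by [frames_gap] the other unmatched coordinate,
    that of [z] along the third tangent, differs by a proportional amount. *)
Definition gap x e1 e3 X E1 E3 := co1 X E1 E3 - co1 x e1 e3.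

(** The preserved quantity at [x + z] is affine in the two unmatched coordinates, with coefficients
    [co2 e2 e1 e3] and [- co1 e2 e1 e3] common to both curves. *)
Lemma frames_gap x z e1 e2 e3 X Z E1 E2 E3 : frames x z e1 e2 e3 X Z E1 E2 E3 ->
  exists k, co1 X E1 E3 = co1 x e1 e3 + co1 e2 e1 e3 * k /\
            co2 Z E1 E3 = co2 z e1 e3 + co2 e2 e1 e3 * k.
Proof.
move=> [[p1 p2 p3 _ _] [q1 q2 q3 _ _] [mu nu] [ea eb] H].
have a0 : 0 < co1 e2 e1 e3 by exact: divr_gt0.
have b0 : 0 < co2 e2 e1 e3 by exact: divr_gt0.
have key (u w f1 f2 f3 : V) : det f1 f3 != 0 -> det (u + w) f2 / det f1 f3 =
   (co1 u f1 f3 + co1 w f1 f3) * co2 f2 f1 f3 - (co2 u f1 f3 + co2 w f1 f3) * co1 f2 f1 f3.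
  by rewrite /co1 /co2 => h; rewrite /det !vE in h *; field.
move: H; rewrite !key ?gt_eqF// -mu -nu -ea -eb => H.
exists (gap x e1 e3 X E1 E3 / co1 e2 e1 e3).
have an : co1 e2 e1 e3 != 0 by rewrite gt_eqF.
split; first by rewrite mulrC divfK// /gap addrC subrK.
have gk (A B g : R) : A != 0 -> A * (B * (g / A)) = B * g by move=> ?; field.
apply: (mulfI an); rewrite [in RHS]mulrDr gk//.
by rewrite /gap; lra.
Qed.

(** Structure equations of the frame. By Cramer's rule each derivative of a tangent is [- k] times
    the position plus [t] times the tangent; the differentiated expansions of x, z and e2 are then
    compared in the basis [e1], [e3]. *)
Lemma frame_deriv x z e1 e2 e3 de1 de2 de3
    (la mu nu xi a b dla dmu dnu dxi da db k1 k2 k3 l1 l3 : R) :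
  det e1 e3 != 0 -> det x e1 != 0 -> det z e3 != 0 -> det (x + z) e2 != 0 ->
  x = la *: e1 + mu *: e3 -> z = nu *: e1 + xi *: e3 -> e2 = a *: e1 + b *: e3 ->
  l1 *: e1 = (dla *: e1 + la *: de1) + (dmu *: e3 + mu *: de3) ->
  l3 *: e3 = (dnu *: e1 + nu *: de1) + (dxi *: e3 + xi *: de3) ->
  de2 = (da *: e1 + a *: de1) + (db *: e3 + b *: de3) ->
  det de1 e1 = - k1 * det x e1 -> det de2 e2 = - k2 * det (x + z) e2 ->
  det de3 e3 = - k3 * det z e3 ->
  exists t1 t2 t3, [/\ det x de1 = t1 * det x e1,
    l1 = dla + la * (t1 - k1 * la) - mu * k3 * nu /\ 0 = dmu - la * k1 * mu + mu * (t3 - k3 * xi),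
    0 = dnu + nu * (t1 - k1 * la) - xi * k3 * nu,
    - k2 * (la + nu) + t2 * a = da + a * (t1 - k1 * la) - b * k3 * nu &
    - k2 * (mu + xi) + t2 * b = - a * k1 * mu + db + b * (t3 - k3 * xi)].
Proof.
move=> p0 h1 h3 h2 ex ez e2E d1 d3 d2 k1E k2E k3E.
exists (det x de1 / det x e1), (det (x + z) de2 / det (x + z) e2), (det z de3 / det z e3).
set t1 := det x de1 / _; set t2 := det _ de2 / _; set t3 := det _ de3 / _.
have D1 : de1 = (t1 - k1 * la) *: e1 + (- k1 * mu) *: e3.
  rewrite {1}(vdecomp de1 h1) k1E mulfK// -/t1 [in LHS]ex; apply: vP; rewrite !vE; ring.
have D3 : de3 = (- k3 * nu) *: e1 + (t3 - k3 * xi) *: e3.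
  rewrite {1}(vdecomp de3 h3) k3E mulfK// -/t3 [in LHS]ez; apply: vP; rewrite !vE; ring.
have D2 : de2 = (- k2 * (la + nu) + t2 * a) *: e1 + (- k2 * (mu + xi) + t2 * b) *: e3.
  rewrite {1}(vdecomp de2 h2) k2E mulfK// -/t2 [in LHS]e2E [in LHS]ex [in LHS]ez.
  by apply: vP; rewrite !vE; ring.
have [E1 E2] : l1 = dla + la * (t1 - k1 * la) - mu * k3 * nu /\
    0 = dmu - la * k1 * mu + mu * (t3 - k3 * xi).
  apply: (frame_coef p0); move: d1; rewrite {1}D1 {1}D3 scale0r addr0 => ->.
  by apply: vP; rewrite !vE; ring.
have [E3 E4] : 0 = dnu + nu * (t1 - k1 * la) - xi * k3 * nu /\
    l3 = - nu * k1 * mu + dxi + xi * (t3 - k3 * xi).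
  apply: (frame_coef p0); move: d3; rewrite {1}D1 {1}D3 scale0r add0r => ->.
  by apply: vP; rewrite !vE; ring.
have [E5 E6] : - k2 * (la + nu) + t2 * a = da + a * (t1 - k1 * la) - b * k3 * nu /\
    - k2 * (mu + xi) + t2 * b = - a * k1 * mu + db + b * (t3 - k3 * xi).
  apply: (frame_coef p0); rewrite -D2 d2 {1}D1 {1}D3.
  by apply: vP; rewrite !vE; ring.
by split=> //; rewrite /t1 divfK.
Qed.

(* With lambda' = lambda + a m and xi' = xi + b m, subtracting the structure
   equations of the two curves eliminates every unknown except t1. *)
Lemma gap_deriv (la mu nu xi a b m dla dla' dmu dnu da db k1 k2 k3 l1 t1 t2 t3 t1' t2' t3' : R) :
  mu != 0 -> nu != 0 -> a != 0 -> b != 0 ->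
  l1 = dla + la * (t1 - k1 * la) - mu * k3 * nu ->
  0 = dmu - la * k1 * mu + mu * (t3 - k3 * xi) ->
  0 = dnu + nu * (t1 - k1 * la) - xi * k3 * nu ->
  - k2 * (la + nu) + t2 * a = da + a * (t1 - k1 * la) - b * k3 * nu ->
  - k2 * (mu + xi) + t2 * b = - a * k1 * mu + db + b * (t3 - k3 * xi) ->
  l1 = dla' + (la + a * m) * (t1' - k1 * (la + a * m)) - mu * k3 * nu ->
  0 = dmu - (la + a * m) * k1 * mu + mu * (t3' - k3 * (xi + b * m)) ->
  0 = dnu + nu * (t1' - k1 * (la + a * m)) - (xi + b * m) * k3 * nu ->
  - k2 * ((la + a * m) + nu) + t2' * a = da + a * (t1' - k1 * (la + a * m)) - b * k3 * nu ->
  - k2 * (mu + (xi + b * m)) + t2' * b = - a * k1 * mu + db + b * (t3' - k3 * (xi + b * m)) ->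
  dla' - dla = - k1 * (a * m) ^+ 2 - a * m * t1.
Proof.
move=> mu0 nu0 a0 b0 A1 A2 A3 A4 A5 B1 B2 B3 B4 B5.
have T3 : t3' - t3 = m * (a * k1 + b * k3) by apply: (mulfI mu0); lra.
have T1 : t1' - t1 = m * (a * k1 + b * k3) by apply: (mulfI nu0); lra.
have U : a * (- k2 * m + (t2' - t2)) = a * (b * k3 * m).
  have : a * (t1' - t1) = a * (m * (a * k1 + b * k3)) by rewrite T1.
  by lra.
have W : b * (- k2 * m + (t2' - t2)) = b * (a * k1 * m).
  have : b * (t3' - t3) = b * (m * (a * k1 + b * k3)) by rewrite T3.
  by lra.
(* [U] and [W] evaluate the same quantity through the two coordinates of the middle tangent, which
   equates the weighted curvatures at x and z whenever [m] is not 0. *)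
have bk : b * k3 * m = a * k1 * m by rewrite -(mulfI a0 U) (mulfI b0 W).
have T1' : t1' = t1 + 2 * (a * k1 * m) by lra.
by move: B1; rewrite T1'; lra.
Qed.

Lemma cancel_common (c p q a b : R) : c != 0 -> p != 0 -> q != 0 ->
  c * p * (a * q) = c * q * (b * p) -> a = b.
Proof.
move=> c0 p0 q0 h; apply: (mulfI (mulf_neq0 (mulf_neq0 c0 p0) q0)).
by move: h; lra.
Qed.

(* Used with e the right and f the left tangents (sg = 1), and conversely (sg = -1). *)
Lemma jump_gap (sg : R) x z e1 e2 e3 X Z E1 E2 E3 f1 f2 f3 G1 G2 G3
    (al1 al2 al3 be1 be2 be3 : R) :
  frames x z e1 e2 e3 X Z E1 E2 E3 -> frames x z f1 f2 f3 X Z G1 G2 G3 ->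
  0 <= det f1 e3 -> 0 <= det e1 f3 ->
  sg = 1 \/ sg = - 1 -> 0 <= sg * al1 -> 0 <= sg * al2 -> 0 <= sg * al3 -> 0 < be1 ->
  f1 = al1 *: x + be1 *: e1 -> f2 = al2 *: (x + z) + be2 *: e2 -> f3 = al3 *: z + be3 *: e3 ->
  G1 = al1 *: X + be1 *: E1 -> G2 = al2 *: (X + Z) + be2 *: E2 -> G3 = al3 *: Z + be3 *: E3 ->
  sg * gap x e1 e3 X E1 E3 <= 0 \/ [/\ al1 = 0, al2 = 0 & al3 = 0].
Proof.
move=> FR FR' fe ef sgE s1 s2 s3 b1 f1E f2E f3E G1E G2E G3E.
have [k [laE xiE]] := frames_gap FR.
case: FR => [[p1 p2 p3 p4 p5] [q1 q2 q3 q4 q5] [muE nuE] [aE bE] _].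
case: FR' => [[p1' p2' p3' p4' p5'] [q1' q2' q3' q4' q5'] [muE' nuE'] [aE' bE'] _].
have a0 : 0 < co1 e2 e1 e3 by exact: divr_gt0.
have b0 : 0 < co2 e2 e1 e3 by exact: divr_gt0.
have a0' : 0 < co1 f2 f1 f3 by exact: divr_gt0.
have b0' : 0 < co2 f2 f1 f3 by exact: divr_gt0.
have pn := lt0r_neq0 p1; have qn := lt0r_neq0 q1.
have pn' := lt0r_neq0 p1'; have qn' := lt0r_neq0 q1'.
have xE := coE x pn; have zE := coE z pn; have eE := coE e2 pn; have fE := coE f2 pn'.
have XE := coE X qn; have ZE := coE Z qn; have EE := coE E2 qn; have GE := coE G2 qn'.
rewrite -muE laE in XE; rewrite -nuE xiE in ZE; rewrite -aE -bE in EE.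
rewrite -aE' -bE' in GE.
rewrite /gap laE addrAC subrr add0r.
set la := co1 x e1 e3 in laE xE XE *; set mu := co2 x e1 e3 in xE XE.
set nu := co1 z e1 e3 in zE ZE; set xi := co2 z e1 e3 in xiE zE ZE.
set a := co1 e2 e1 e3 in laE a0 eE XE EE *; set b := co2 e2 e1 e3 in xiE b0 eE ZE EE.
set a' := co1 f2 f1 f3 in a0' fE GE; set b' := co2 f2 f1 f3 in b0' fE GE.
have mun : mu != 0.
  have pe : det e1 x = - det x e1 by rewrite /det; ring.
  by rewrite /mu /co2 mulf_neq0 ?invr_neq0// pe oppr_eq0 lt0r_neq0.
clearbody la mu nu xi a b a' b'.
have [k0|kn] := eqVneq k 0; first by left; rewrite k0 !mulr0.
have [A1 A2] : al2 * (la + nu) + be2 * a = a' * (al1 * la + be1) + b' * al3 * nu /\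
    al2 * (mu + xi) + be2 * b = a' * al1 * mu + b' * (al3 * xi + be3).
  apply: (frame_coef pn).
  transitivity f2.
    by rewrite f2E xE zE eE; apply: vP; rewrite !vE; ring.
  by rewrite fE f1E f3E xE zE; apply: vP; rewrite !vE; ring.
have [B1 B2] : al2 * (la + a * k + nu) + be2 * a =
      a' * (al1 * (la + a * k) + be1) + b' * al3 * nu /\
    al2 * (mu + (xi + b * k)) + be2 * b = a' * al1 * mu + b' * (al3 * (xi + b * k) + be3).
  apply: (frame_coef qn).
  transitivity G2.
    by rewrite G2E XE ZE EE; apply: vP; rewrite !vE; ring.
  by rewrite GE G1E G3E XE ZE; apply: vP; rewrite !vE; ring.
have ak : a * k != 0 by rewrite mulf_neq0// gt_eqF.
have bk : b * k != 0 by rewrite mulf_neq0// gt_eqF.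
(* The relations on the two curves differ only in the terms containing [k]. *)
have C1 : al2 = a' * al1 by apply: (mulIf ak); clear -A1 B1; lra.
have C2 : al2 = b' * al3 by apply: (mulIf bk); clear -A2 B2; lra.
have th : det f1 f3 = ((al1 * la + be1) * (al3 * xi + be3) - al1 * mu * (al3 * nu)) * det e1 e3.
  by rewrite f1E f3E xE zE /det !vE; ring.
have th' : det G1 G3 = ((al1 * (la + a * k) + be1) * (al3 * (xi + b * k) + be3) -
    al1 * mu * (al3 * nu)) * det E1 E3.
  by rewrite G1E G3E XE ZE /det !vE; ring.
have fe' : det f1 e3 = (al1 * la + be1) * det e1 e3 by rewrite f1E xE /det !vE; ring.
have ef' : det e1 f3 = (al3 * xi + be3) * det e1 e3 by rewrite f3E zE /det !vE; ring.
rewrite fe' pmulr_lge0// in fe; rewrite ef' pmulr_lge0// in ef.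
(* The second coordinate of x in the [f] frame is common as well; its numerators share the factor
   [be1 * mu], so the frame determinants agree up to the factors [det e1 e3] and [det E1 E3]. *)
have TH : (al1 * (la + a * k) + be1) * (al3 * (xi + b * k) + be3) =
    (al1 * la + be1) * (al3 * xi + be3).
  have e1x : det f1 x = be1 * mu * det e1 e3 by rewrite f1E xE /det !vE; ring.
  have E1X : det G1 X = be1 * mu * det E1 E3 by rewrite G1E XE /det !vE; ring.
  move: muE'; rewrite /co2 e1x E1X => /(eq_divP _ _ p1' q1').
  rewrite th th' => /(cancel_common (mulf_neq0 (lt0r_neq0 b1) mun) pn qn).
  exact: addIr.
(* Expansion of [TH], divided by [k]. *)
have EQ : al1 * a * (al3 * xi + be3) + al3 * b * (al1 * la + be1) + al1 * al3 * a * b * k = 0.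
  by apply: (mulfI kn); clear -TH; lra.
have [al0|aln] := eqVneq al2 0.
  right; split=> //.
    by apply/eqP; have /esym/eqP := C1; rewrite al0 mulf_eq0 (gt_eqF a0').
  by apply/eqP; have /esym/eqP := C2; rewrite al0 mulf_eq0 (gt_eqF b0').
(* If [sg] times the gap were positive, [sg] times [EQ] would be a sum of two nonnegative terms and
   a positive one. *)
left; rewrite leNgt; apply/negP => kp.
have ab : 0 < a * b by exact: mulr_gt0.
have n1 : al1 != 0 by apply: contraNneq aln => h; rewrite C1 h mulr0.
have n3 : al3 != 0 by apply: contraNneq aln => h; rewrite C2 h mulr0.
have sn : sg != 0 by case: sgE => ->; rewrite ?oppr_eq0 oner_eq0.
have s1' : 0 < sg * al1 by rewrite lt_neqAle s1 eq_sym mulf_neq0.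
have s3' : 0 < sg * al3 by rewrite lt_neqAle s3 eq_sym mulf_neq0.
have ss : sg * sg = 1 by case: sgE => ->; ring.
have T1 : 0 <= (sg * al1) * a * (al3 * xi + be3).
  exact: (mulr_ge0 (mulr_ge0 s1 (ltW a0)) ef).
have T2 : 0 <= (sg * al3) * b * (al1 * la + be1).
  exact: (mulr_ge0 (mulr_ge0 s3 (ltW b0)) fe).
have T3 : 0 < (sg * al1) * (sg * al3) * b * (sg * (a * k)).
  exact: (mulr_gt0 (mulr_gt0 (mulr_gt0 s1' s3') b0) kp).
have : sg * (al1 * a * (al3 * xi + be3) + al3 * b * (al1 * la + be1)) +
   (sg * sg) * sg * (al1 * al3 * a * b * k) = 0 by rewrite ss mul1r -mulrDr EQ mulr0.
by clear -T1 T2 T3; lra.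
Qed.

End Frames.

(** * Monotonicity with respect to a gauge *)

Section Monotone.
Variable R : realType.
Implicit Types (P : R -> Prop) (a b c s t : R).

(** If the property failed for [G], its complement could be added to [G], and an ultrafilter finer
    than the result would contradict the hypothesis. *)
Lemma ultra_near (G : set_system R) (FG : Filter G) (P : set R) :
  (forall F, UltraFilter F -> F `=>` G -> F P) -> G P.
Proof.
move=> H; apply: contrapT => nP.
have PF : ProperFilter (within (~` P) G).
  split; last exact: within_filter.
  by rewrite /within /= => h; apply: nP; apply: filterS h => t h; apply: contrapT => /h.
have [F [FU sF]] := ultraFilterLemma PF.
have FF : ProperFilter F by exact: ultra_proper.
have h1 : F P by apply: H => // A GA; apply: sF; rewrite /within /=; apply: filterS GA.
have h2 : F (~` P) by apply: sF; rewrite /within /=; apply: filterE.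
have h3 : F set0 by rewrite -(setICr P); exact: filterI.
exact: (@filter_not_empty _ F FF h3).
Qed.

(** Induction along an interval: the supremum of the parameters up to which [P] holds throughout
    cannot lie before [b]. *)
Lemma real_ind P a b : a <= b -> P a ->
  (forall c, a <= c -> c < b -> P c -> exists2 d, c < d & forall t, c < t -> t < d -> P t) ->
  (forall c, a < c -> c <= b -> (forall t, a <= t -> t < c -> P t) -> P c) -> P b.
Proof.
move=> ab Pa step lim.
pose A := [set t | a <= t /\ t <= b /\ forall u, a <= u -> u <= t -> P u].
have Aa : A a.
  by split=> //; split=> // u h1 h2; have -> : u = a by apply/eqP; rewrite eq_le h1 h2.
have hA : has_sup A by split; [exists a|exists b => t [_ []]].
set c := sup A.
have ac : a <= c by apply: ub_le_sup => //; case: hA.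
have cb : c <= b by apply: ge_sup; [exists a|move=> t [_ []]].
have Pc' t : a <= t -> t < c -> P t.
  move=> at_ tc; have e0 : 0 < c - t by rewrite subr_gt0.
  have [u [_ [_ hu]] tu] := sup_adherent e0 hA.
  by apply: hu => //; rewrite -/c in tu; lra.
have Pc : P c.
  move: ac; rewrite le_eqVlt => /orP[/eqP <- //|ac]; exact: lim.
have [cb'|bc] := ltP c b; last by have -> : b = c by apply/eqP; rewrite eq_le bc cb.
have [d cd hd] := step c ac cb' Pc.
pose d' := Num.min ((c + d) / 2) b.
have cd' : c < d' by rewrite lt_min cb' andbT; lra.
have d'd : d' < d by rewrite gt_min; apply/orP; left; lra.
suff : d' <= c by lra.
apply: ub_le_sup; first by case: hA.
split; first lra; split; first by rewrite ge_min lexx orbT.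
move=> u au ud; have [uc|cu|->//] := ltgtP u c; first exact: Pc'.
by apply: hd => //; lra.
Qed.

Variable f : R -> R.

(** On the right every limit of difference quotients with respect to [D] is nonpositive; on the left
    [f] may jump, but only downwards when the parameter passes [s]. *)
Definition gauged (D : R -> R) (s : R) :=
  (forall F, UltraFilter F -> F `=>` at_right s ->
     exists2 d, d <= 0 & slim F (fun t => (D t - D s)^-1 * (f t - f s)) d) /\
  (forall F, UltraFilter F -> F `=>` at_left s -> exists2 l, f s <= l & slim F f l).

Lemma gauged_right D s (eps : R) : gauged D s -> 0 < eps ->
  (\forall t \near at_right s, D s < D t) ->
  \forall t \near at_right s, f t - f s <= eps * (D t - D s).
Proof.
move=> [h _] e0 hD; apply: ultra_near => F FU sF.
have FF : ProperFilter F by exact: ultra_proper.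
have [d d0 hd] := h F FU sF; have de : d < eps by lra.
apply: filterS2 (sF _ hD) (slim_lt hd de) => t Dt.
have Dp : 0 < D t - D s by rewrite subr_gt0.
by rewrite mulrC ltr_pdivrMr// => /ltW.
Qed.

Lemma gauged_left D s (eps : R) : gauged D s -> 0 < eps ->
  \forall t \near at_left s, f s <= f t + eps.
Proof.
move=> [_ h] e0; apply: ultra_near => F FU sF.
have FF : ProperFilter F by exact: ultra_proper.
have [l l0 hl] := h F FU sF; have le : l - eps < l by lra.
by apply: filterS (slim_gt hl le) => t; lra.
Qed.

(** Real induction on [f t <= f a + ep * (D t - D a)]: right derivatives carry it past a point, the
    one-sided jump condition carries it to a limit from the left. *)
Lemma gauged_decr D (p q : R) :
  (forall s t, p < s -> s < t -> t < q -> D s < D t) ->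
  (forall s, p < s -> s < q -> gauged D s) ->
  forall a b, p < a -> a <= b -> b < q -> f b <= f a.
Proof.
move=> Dm hg a b pa ab bq; apply/ler_addgt0Pr => eps e0.
(* The summand 1 keeps the denominator positive also when [a = b]. *)
pose ep := eps / (D b - D a + 1).
have Dle s t : p < s -> s <= t -> t < q -> D s <= D t.
  by move=> h1; rewrite le_eqVlt => /orP[/eqP -> //|h2] h3; apply/ltW/Dm.
have Dab : 0 < D b - D a + 1 by have := Dle a b pa ab bq; lra.
have ep0 : 0 < ep by exact: divr_gt0.
suff : f b <= f a + ep * (D b - D a).
  move/le_trans; apply; rewrite lerD2l /ep mulrAC ler_pdivrMr// ler_pM2l//; lra.
apply: (@real_ind (fun t => f t <= f a + ep * (D t - D a)) a b ab).
- by rewrite subrr mulr0 addr0.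
- move=> c ac cb Pc.
  have c1 : p < c by lra.
  have c2 : c < q by lra.
  have ND : \forall t \near at_right c, D c < D t.
    by apply: filterS2 (nbhs_right_gt c) (nbhs_right_lt c2) => t; exact: Dm.
  have [d /= d0 hd] := gauged_right (hg c c1 c2) ep0 ND.
  exists (c + d) => [|t ct tc]; first by lra.
  have : f t - f c <= ep * (D t - D c).
    by apply: hd => //=; rewrite ltr0_norm; lra.
  by lra.
- move=> c ac cb Pc; apply/ler_addgt0Pr => eta eta0.
  have c1 : p < c by lra.
  have c2 : c < q by lra.
  have [d /= d0 hd] := gauged_left (hg c c1 c2) eta0.
  pose t := Num.max ((a + c) / 2) (c - d / 2).
  have ta : a < t by rewrite lt_max; apply/orP; left; lra.
  have tc : t < c by rewrite gt_max; apply/andP; split; lra.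
  have td : c - d / 2 <= t by rewrite le_max lexx orbT.
  have h1 : f c <= f t + eta by apply: hd => //=; rewrite gtr0_norm; lra.
  have h2 := Pc t (ltW ta) tc.
  have h3 : ep * (D t - D a) <= ep * (D c - D a).
    by rewrite ler_pM2l// lerB// Dle//; lra.
  by lra.
Qed.

(** Gauges are constructed only near each point, and a locally decreasing function is decreasing. *)
Lemma locally_gauged_decr :
  (forall t0, exists2 d, 0 < d & exists D : R -> R,
     (forall s t, t0 - d < s -> s < t -> t < t0 + d -> D s < D t) /\
     (forall s, t0 - d < s -> s < t0 + d -> gauged D s)) ->
  forall a b, a <= b -> f b <= f a.
Proof.
move=> H a b ab.
have loc t0 : exists2 d, 0 < d & forall s t, t0 - d < s -> s <= t -> t < t0 + d -> f t <= f s.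
  by have [d d0 [D [h1 h2]]] := H t0; exists d => // s t *; exact: (gauged_decr h1 h2).
apply: (@real_ind (fun t => f t <= f a) a b ab) => //.
- move=> c ac cb Pc; have [d d0 hd] := loc c; exists (c + d) => [|t ct tc]; first by lra.
  by apply: le_trans Pc; apply: hd; lra.
- move=> c ac cb Pc; have [d d0 hd] := loc c.
  pose t := Num.max a (c - d / 2).
  have ta : a <= t by rewrite le_max lexx.
  have tc : t < c by rewrite gt_max; apply/andP; split; lra.
  have td : c - d / 2 <= t by rewrite le_max lexx orbT.
  by apply: le_trans (Pc t ta tc); apply: hd; lra.
Qed.

End Monotone.

(** * Gauges that dominate the increments of a convex curve and of its tangents *)

Section Gauge.
Variables (R : realType) (n : R * R -> R).
Hypothesis nn : plane_norm n.
Local Notation V := (R * R)%type.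

(** Up to the factor [K], the gauge is minus the cotangent of the Euclidean angle from [p0] to
    [w t]. With [be] proportional to [det (w s) (w t)], one has
    [w t - w s = (al - 1) *: w s - be *: p0], and [|al - 1| <= be * n p0] because both vectors are
    unit. *)
Lemma unit_gauge (w : R -> V) (p0 : V) (c0 a b : R) : 0 < c0 ->
  (forall t, n (w t) = 1) ->
  (forall s t, a < s -> s < t -> t < b -> 0 <= det (w s) (w t)) ->
  (forall s, a < s -> s < b -> c0 <= det p0 (w s)) ->
  exists g : R -> R, forall s t, a < s -> s < t -> t < b -> n (w t - w s) <= g t - g s.
Proof.
move=> c00 w1 wd wp.
have [C C0 hC] := comp_bound nn.
pose B := (`|p0.1| + `|p0.2|) * C + 1.
have B0 : 0 < B by rewrite ltr_wpDl// mulr_ge0 ?addr_ge0// ltW.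
have Bp t : det p0 (w t) <= B.
  have [h1 h2] := hC (w t); rewrite w1 mulr1 in h1 h2.
  apply: le_trans (ler_norm _) _; apply: le_trans (ler_normB _ _) _; rewrite !normrM /B.
  have := normr_ge0 p0.1; have := normr_ge0 p0.2; nra.
have [ab|ba] := ltP a b; last by exists (fun=> 0) => s t *; lra.
have p00 : p0 != 0.
  have h1 : a < (a + b) / 2 by lra.
  have h2 : (a + b) / 2 < b by lra.
  by apply/eqP => e; have := wp _ h1 h2; rewrite e /det !vE !mul0r subrr; lra.
have s0 := sqr_sum_gt0 p00; set S := p0.1 ^+ 2 + p0.2 ^+ 2 in s0.
have n0 := n_gt0 nn p00.
(* The factor [2 * n p0] comes from the bound on the chord, [B] absorbs [det p0 (w t)], and [S]
   comes from the identity expressing [det (w s) (w t)] through [p0] and [rot p0]. *)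
pose K := 2 * n p0 * B / S.
exists (fun t => K * (det (rot p0) (w t) / det p0 (w t))) => s t as_ st tb.
have ps := wp s as_ (lt_trans st tb); have pt := wp t (lt_trans as_ st) tb.
have ps0 : 0 < det p0 (w s) by lra.
have pt0 : 0 < det p0 (w t) by lra.
have d0 := wd s t as_ st tb.
have e : K * (det (rot p0) (w t) / det p0 (w t)) - K * (det (rot p0) (w s) / det p0 (w s)) =
   2 * n p0 * (det (w s) (w t) / det p0 (w s)) * (B / det p0 (w t)).
  have -> : det (w s) (w t) = (det (rot p0) (w t) * det p0 (w s) -
      det (rot p0) (w s) * det p0 (w t)) / S.
    by apply: (mulIf (lt0r_neq0 s0)); rewrite divfK ?gt_eqF// /det /S !vE; ring.
  by rewrite /K; field; rewrite !gt_eqF.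
rewrite e; set be := det (w s) (w t) / det p0 (w s).
have be0 : 0 <= be by apply: divr_ge0 => //; exact: ltW.
have wt : w t = (det p0 (w t) / det p0 (w s)) *: w s + (- be) *: p0.
  by rewrite /be; apply: vP; rewrite !vE /det in ps0 *; field; rewrite gt_eqF.
set al := det p0 (w t) / det p0 (w s) in wt.
have al0 : 0 < al by exact: divr_gt0.
have al1 : `|al - 1| <= be * n p0.
  have H := n_dist nn (w t) (al *: w s).
  rewrite w1 (nZ nn) w1 mulr1 (gtr0_norm al0) distrC in H; apply: le_trans H _.
  by rewrite wt addrAC subrr add0r (nZ nn) normrN (ger0_norm be0).
have : n (w t - w s) <= 2 * n p0 * be.
  have -> : w t - w s = (al - 1) *: w s + (- be) *: p0.
    by rewrite {1}wt; apply: vP; rewrite !vE; ring.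
  apply: le_trans (nD nn _ _) _; rewrite !(nZ nn) w1 mulr1 normrN (ger0_norm be0).
  by move: al1; lra.
move/le_trans; apply; rewrite ler_peMr//.
  by rewrite mulr_ge0// mulr_ge0// ltW.
by rewrite ler_pdivlMr// mul1r.
Qed.

(** Uniform transversality. With [S] the sum of the absolute coordinates of [e], testing the support
    on [- rot e] gives [S <= 2 * K * det p e], while [n e = 1] gives [1 <= K * S]. *)
Lemma supp_lower : exists2 c : R, 0 < c & forall p e, n p = 1 -> supp n p e -> c <= det p e.
Proof.
pose K := n (1, 0) + n (0, 1).
have K0 : 0 < K.
  apply: addr_gt0; apply: (n_gt0 nn); apply/eqP; [move/(congr1 fst)|move/(congr1 snd)];
  by rewrite !vE /= => /eqP; rewrite oner_eq0.
exists (1 / (2 * K ^+ 2)) => [|p e p1 [e1 h]].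
  by rewrite divr_gt0// mulr_gt0// exprn_gt0.
pose S := `|e.1| + `|e.2|.
have KS : 1 <= K * S by rewrite -e1; exact: n_le.
have S0 : 0 < S by rewrite -(pmulr_rgt0 _ K0); lra.
have nr : n (- rot e) <= K * S.
  by rewrite (nN nn); apply: le_trans (n_le nn _) _; rewrite !vE normrN [`|e.2| + _]addrC.
have := h (- rot e); have -> : det (- rot e) e = e.1 ^+ 2 + e.2 ^+ 2 by rewrite /det !vE; ring.
rewrite p1 mulr1 ger0_norm ?addr_ge0 ?sqr_ge0// => h1.
have SS : S ^+ 2 <= 2 * (e.1 ^+ 2 + e.2 ^+ 2).
  rewrite /S -(real_normK (num_real e.1)) -(real_normK (num_real e.2)).
  by have := sqr_ge0 (`|e.1| - `|e.2|); lra.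
have dp : 0 <= det p e.
  apply: le_trans (_ : `|det p e| <= _); first exact: normr_ge0.
  by have := h p; rewrite p1 !mulr1.
have h2 : S ^+ 2 <= 2 * (det p e * (K * S)).
  apply: le_trans SS _; rewrite ler_pM2l//; apply: le_trans h1 _.
  by rewrite ler_wpM2l.
have h3 : S <= 2 * (det p e * K).
  rewrite -(ler_pM2r S0); apply: le_trans h2 _; lra.
rewrite ler_pdivrMr ?mulr_gt0 ?exprn_gt0//.
apply: le_trans KS _; rewrite mulrC; apply: le_trans (ler_wpM2r (ltW K0) h3) _; lra.
Qed.

Variable r : R -> V.
Hypothesis rc : unit_curve n r.

(** [unit_gauge] serves twice: for the curve, seen from the point a quarter period earlier, and for
    its tangents, seen from [r t0]. *)
Lemma curve_gauge t0 : exists2 d, 0 < d & exists g : R -> R,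
  forall s t, t0 - d < s -> s < t -> t < t0 + d ->
    n (r t - r s) <= g t - g s /\ n (tgc n r t - tgc n r s) <= g t - g s.
Proof.
have pi0 := @pi_gt0 R.
have [c c0 hc] := supp_lower.
have q0 : 0 < det (r (t0 - pi / 2)) (r t0) by apply: (rdet rc); lra.
have N1 : \forall t \near nbhs t0, det (r (t0 - pi / 2)) (r t0) / 2 < det (r (t0 - pi / 2)) (r t).
  by apply: slim_gt (vlim_det (vlim_cst _) (rlim rc t0)) _; lra.
have N2 : \forall t \near nbhs t0, n (r t0 - r t) < 1 / 2.
  apply: slim_lt (vlim_n nn (vlimB (vlim_cst (r t0)) (rlim rc t0))) _.
  by rewrite subrr (n0 nn); lra.
have [d1 /= d10 h1] := filterI N1 N2.
pose d := Num.min d1 (pi / 2).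
have d0 : 0 < d by rewrite lt_min d10; lra.
have dd1 : d <= d1 by rewrite ge_min lexx.
have dpi : d <= pi / 2 by rewrite ge_min lexx orbT.
have I t : t0 - d < t -> t < t0 + d -> ball t0 d1 t.
  by move=> *; rewrite /ball /= ltr_distlC; apply/andP; split; lra.
have [||||g hg] := @unit_gauge r (r (t0 - pi / 2)) (det (r (t0 - pi / 2)) (r t0) / 2)
    (t0 - d) (t0 + d).
- by lra.
- exact: (r1 rc).
- by move=> s t *; apply/ltW/(rdet rc) => //; lra.
- by move=> s a b; have [/ltW] := h1 s (I s a b).
have [||||g' hg'] := @unit_gauge (tgc n r) (r t0) (c / 2) (t0 - d) (t0 + d).
- by lra.
- by move=> t; exact: (n_tg nn (r_neq0 nn rc t)).
- move=> s t *; apply: (supp_turn nn (r_neq0 nn rc s) (r_neq0 nn rc t)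
    (tgc_supp nn rc s) (tgc_supp nn rc t)); apply: (rdet rc) => //; lra.
(* Since [r s] is within 1/2 of [r t0], replacing it by [r t0] loses at most half of
   [det (r s) (tgc n r s)]. *)
- move=> s a b; have [_ k] := h1 s (I s a b).
  have L := hc _ _ (r1 rc s) (tgc_supp nn rc s).
  have := proj2 (tgc_supp nn rc s) (r t0 - r s); rewrite (r1 rc) mulr1.
  have -> : det (r t0 - r s) (tgc n r s) = det (r t0) (tgc n r s) - det (r s) (tgc n r s).
    by rewrite /det !vE; ring.
  rewrite ler_norml => /andP[h _]; nra.
have mono (f : R -> R) (w : R -> V) : (forall s t, t0 - d < s -> s < t -> t < t0 + d ->
    n (w t - w s) <= f t - f s) -> forall s t, t0 - d < s -> s < t -> t < t0 + d -> 0 <= f t - f s.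
  by move=> h s t *; apply: le_trans (n_ge0 nn _) _; apply: h.
exists d => //; exists (fun t => g t + g' t) => s t a b e.
have := mono _ _ hg s t a b e; have := mono _ _ hg' s t a b e.
by have := hg s t a b e; have := hg' s t a b e; split; lra.
Qed.

End Gauge.

(** * The weighted gap between the two curves *)

Lemma incr_l (R : realDomainType) (a b c d w : R) : w <= a - b -> 0 <= c - d -> w <= a + c - (b + d).
Proof. by lra. Qed.

Lemma incr_r (R : realDomainType) (a b c d w : R) : 0 <= a - b -> w <= c - d -> w <= a + c - (b + d).
Proof. by lra. Qed.

Lemma pos_of_close (R : realFieldType) (c L k x : R) : 0 < c -> c <= L -> k < 1 / 2 ->
  - (L * k) <= x - L -> 0 < x.
Proof. by nra. Qed.

(** The derivative of [det w v / det p v] when [v] moves with velocity [d]: it vanishes as soon as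
    [d] is parallel to [v]. *)
Lemma quotient_rule (R : realType) (p w v d : R * R) : det p v != 0 ->
  det w d * (det p v)^-1 + det w v * (- det p d / det p v ^+ 2) =
  det w p * det d v / det p v ^+ 2.
Proof. by rewrite /det => h; field. Qed.

Lemma rot_slope (R : realType) (p v w : R * R) :
  det (rot p) w * det p v = det (rot p) v * det p w ->
  (p.1 ^+ 2 + p.2 ^+ 2) * det v w = 0.
Proof. by rewrite /det !vE => h; lra. Qed.

Lemma shrink_ball (R : realDomainType) (a d d' s t : R) : d <= d' -> a - d < s -> t < a + d ->
  a - d' < s /\ t < a + d'.
Proof. by split; lra. Qed.

Lemma gauge_sum (R : realDomainType) (g1 g2 g3 : R -> R) (s t : R) : s < t ->
  0 <= g1 t - g1 s -> 0 <= g2 t - g2 s -> 0 <= g3 t - g3 s ->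
  [/\ g1 s + g2 s + g3 s + s < g1 t + g2 t + g3 t + t,
      forall w, w <= g1 t - g1 s -> w <= g1 t + g2 t + g3 t + t - (g1 s + g2 s + g3 s + s),
      forall w, w <= g2 t - g2 s -> w <= g1 t + g2 t + g3 t + t - (g1 s + g2 s + g3 s + s) &
      forall w, w <= g3 t - g3 s -> w <= g1 t + g2 t + g3 t + t - (g1 s + g2 s + g3 s + s)].
Proof. by move=> *; split=> *; lra. Qed.

Section FrameLimits.
Context {R : realType}.
Local Notation V := (R * R)%type.

(** After substituting [e2 = a *: e1 + b *: e3], each of the three slopes is one of the required
    ratios multiplied or divided by the common nonzero [a] or [b]. *)
Lemma frames_of_slopes (x z e1 e2 e3 X Z E1 E2 E3 : V) (a b : R) :
  [/\ 0 < det e1 e3, 0 < det e1 e2, 0 < det e2 e3, 0 < det x e1 & 0 < det z e3] ->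
  [/\ 0 < det E1 E3, 0 < det E1 E2, 0 < det E2 E3, 0 < det X E1 & 0 < det Z E3] ->
  0 < det (x + z) e2 -> 0 < det (X + Z) E2 ->
  e2 = a *: e1 + b *: e3 -> E2 = a *: E1 + b *: E3 ->
  det e2 e3 / det z e3 = det E2 E3 / det Z E3 ->
  det e2 e1 / det x e1 = det E2 E1 / det X E1 ->
  det e1 e2 / det (x + z) e2 = det E1 E2 / det (X + Z) E2 ->
  frames x z e1 e2 e3 X Z E1 E2 E3.
Proof.
move=> P Q y2 Y2 eE EE; have [p1 p2 p3 p4 p5] := P; have [q1 q2 q3 q4 q5] := Q.
have a23 : det e2 e3 = a * det e1 e3 by rewrite eE /det !vE; ring.
have A23 : det E2 E3 = a * det E1 E3 by rewrite EE /det !vE; ring.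
have b12 : det e1 e2 = b * det e1 e3 by rewrite eE /det !vE; ring.
have B12 : det E1 E2 = b * det E1 E3 by rewrite EE /det !vE; ring.
have b21 : det e2 e1 = - b * det e1 e3 by rewrite mulNr -b12 /det; ring.
have B21 : det E2 E1 = - b * det E1 E3 by rewrite mulNr -B12 /det; ring.
have a0 : a != 0 by apply/lt0r_neq0; rewrite -(pmulr_lgt0 _ p1) -a23.
have b0 : b != 0 by apply/lt0r_neq0; rewrite -(pmulr_lgt0 _ p1) -b12.
move=> /(eq_divP _ _ p5 q5) I1 /(eq_divP _ _ p4 q4) I2 /(eq_divP _ _ y2 Y2) I3.
rewrite a23 A23 in I1; rewrite b21 B21 in I2; rewrite b12 B12 in I3.
have sw (v w : V) : det v w = - det w v by rewrite /det; ring.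
split=> //.
- split; apply/eq_divP => //.
    by apply: (mulfI b0); rewrite (sw e1 x) (sw E1 X); lra.
  by apply: (mulfI a0); lra.
- split; apply/eq_divP => //; first by rewrite a23 A23; ring.
  by rewrite b12 B12; ring.
- by apply/eq_divP => //; apply: (mulfI b0); lra.
Qed.

(** The equations of [frames] are closed and pass to the limit where the limiting determinants stay
    positive; this transfers them from right to left tangents. *)
Lemma frames_lim {T} {F : set_system T} {FF : ProperFilter F}
    (x z e1 e2 e3 X Z E1 E2 E3 : T -> V) (x0 z0 f1 f2 f3 X0 Z0 G1 G2 G3 : V) :
  vlim F x x0 -> vlim F z z0 -> vlim F e1 f1 -> vlim F e2 f2 -> vlim F e3 f3 ->
  vlim F X X0 -> vlim F Z Z0 -> vlim F E1 G1 -> vlim F E2 G2 -> vlim F E3 G3 ->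
  [/\ 0 < det f1 f3, 0 < det f1 f2, 0 < det f2 f3, 0 < det x0 f1 & 0 < det z0 f3] ->
  [/\ 0 < det G1 G3, 0 < det G1 G2, 0 < det G2 G3, 0 < det X0 G1 & 0 < det Z0 G3] ->
  (forall t, frames (x t) (z t) (e1 t) (e2 t) (e3 t) (X t) (Z t) (E1 t) (E2 t) (E3 t)) ->
  frames x0 z0 f1 f2 f3 X0 Z0 G1 G2 G3.
Proof.
move=> hx hz h1 h2 h3 hX hZ H1 H2 H3 P Q fr.
have [p1 p2 p3 p4 p5] := P; have [q1 q2 q3 q4 q5] := Q.
have aux (u v w s U W S Y : T -> V) u0 v0 w0 s0 U0 W0 S0 Y0 :
    vlim F u u0 -> vlim F v v0 -> vlim F w w0 -> vlim F s s0 ->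
    vlim F U U0 -> vlim F W W0 -> vlim F S S0 -> vlim F Y Y0 ->
    0 < det w0 s0 -> 0 < det S0 Y0 ->
    (forall t, det (u t) (v t) / det (w t) (s t) = det (U t) (W t) / det (S t) (Y t)) ->
    det u0 v0 / det w0 s0 = det U0 W0 / det S0 Y0.
  move=> hu hv hw hs hU hW hS hY ws SY H.
  have a : slim F (fun t => det (u t) (v t) / det (w t) (s t)) (det u0 v0 / det w0 s0).
    by apply: slim_div; [exact: lt0r_neq0|exact: vlim_det|exact: vlim_det].
  have b : slim F (fun t => det (U t) (W t) / det (S t) (Y t)) (det U0 W0 / det S0 Y0).
    by apply: slim_div; [exact: lt0r_neq0|exact: vlim_det|exact: vlim_det].
  by apply: (slim_unique a); apply: slim_eq b; exact: nearW.
split=> //; try split; rewrite /co1 /co2.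
- by apply: (aux e1 x e1 e3 E1 X E1 E3) => // t; case: (fr t) => _ _ [].
- by apply: (aux z e3 e1 e3 Z E3 E1 E3) => // t; case: (fr t) => _ _ [].
- by apply: (aux e2 e3 e1 e3 E2 E3 E1 E3) => // t; case: (fr t) => _ _ _ [].
- by apply: (aux e1 e2 e1 e3 E1 E2 E1 E3) => // t; case: (fr t) => _ _ _ [].
- apply: (aux (fun t => x t + z t) e2 e1 e3 (fun t => X t + Z t) E2 E1 E3) => //;
    try exact: vlimD.
  by move=> t; case: (fr t).
Qed.

Lemma isd_co1 {T} {F : set_system T} {FF : ProperFilter F} (D : T -> R)
    (v e f : T -> V) v0 e0 f0 dv de df : det e0 f0 != 0 ->
  visd (F := F) D v v0 dv -> visd (F := F) D e e0 de -> visd (F := F) D f f0 df ->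
  exists d, isd (F := F) D (fun t => co1 (v t) (e t) (f t)) (co1 v0 e0 f0) d.
Proof.
move=> h hv he hf; eexists.
exact: (isdM (visd_det hv hf) (isdV h (visd_det he hf))).
Qed.

Lemma isd_co2 {T} {F : set_system T} {FF : ProperFilter F} (D : T -> R)
    (v e f : T -> V) v0 e0 f0 dv de df : det e0 f0 != 0 ->
  visd (F := F) D v v0 dv -> visd (F := F) D e e0 de -> visd (F := F) D f f0 df ->
  exists d, isd (F := F) D (fun t => co2 (v t) (e t) (f t)) (co2 v0 e0 f0) d.
Proof.
move=> h hv he hf; eexists.
exact: (isdM (visd_det he hv) (isdV h (visd_det he hf))).
Qed.

Lemma visd_lip {k : V -> R} (kk : plane_norm k) {T} {F : set_system T} (FU : UltraFilter F)
    (D : T -> R) (u : T -> V) p : vlim F u p ->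
  (\forall t \near F, 0 < D t) -> (\forall t \near F, k (u t - p) <= D t) ->
  exists dp, visd (F := F) D u p dp.
Proof.
move=> hu D0 h; have FF : ProperFilter F by exact: ultra_proper.
have [|dp hdp] := @ultra_vlim _ _ kk _ _ FU (fun t => (D t)^-1 *: (u t - p)) 1; last by exists dp.
apply: filterS2 D0 h => t t0 ht.
by rewrite (nZ kk) gtr0_norm ?invr_gt0// mulrC ler_pdivrMr// mul1r.
Qed.

End FrameLimits.

(** * Spheres without long segments: the gap vanishes *)

Section Core.
Variables (R : realType) (n m : R * R -> R) (r rho : R -> R * R).
Hypotheses (nn : plane_norm n) (mm : plane_norm m).
Hypotheses (rc : unit_curve n r) (rhoc : unit_curve m rho).
Hypothesis iso : forall s t, n (r s - r t) = m (rho s - rho t).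
Hypothesis nl : nolong n.
Variable h : R -> R.
Hypotheses (h_gt : forall t, t < h t) (h_lt : forall t, h t < t + pi)
  (h_dist : forall t, n (r (h t) - r t) = 1).
Local Notation V := (R * R)%type.
Local Notation e := (tgc n r).
Local Notation E := (tgc m rho).

Let nlm : nolong m := nolong_pair mm rc rhoc iso nl.

Let H_dist t : m (rho (h t) - rho t) = 1.
Proof. by rewrite -iso. Qed.

Let hex t : r (h t) = r t + r (h (h t)).
Proof. exact: (h_hex nn rc nl). Qed.

Let Hex t : rho (h t) = rho t + rho (h (h t)).
Proof. exact: (h_hex mm rhoc nlm). Qed.

Let hhh t : h (h (h t)) = t + pi.
Proof. exact: (h3 nn rc nl). Qed.

Lemma dets_pos (k : V -> R) (c : R -> V) (kk : plane_norm k) (cc : unit_curve k c) :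
  nolong k -> (forall t, c (h t) = c t + c (h (h t))) ->
  forall t f1 f2 f3, supp k (c t) f1 -> supp k (c (h t)) f2 -> supp k (c (h (h t))) f3 ->
  [/\ 0 < det f1 f3, 0 < det f1 f2, 0 < det f2 f3, 0 < det (c t) f1 & 0 < det (c (h (h t))) f3].
Proof.
move=> kl ch t f1 f2 f3 s1 s2 s3.
have d0 : 0 < det (c t) (c (h t)) by exact: (rdet cc).
have [a1 a2 a3] := hex_dets kk kl (r1 cc t) (r1 cc (h t)) (r1 cc (h (h t))) (ch t) d0 s1 s2 s3.
by split=> //; apply: (supp_gt0 kk) => //; exact: (r_neq0 kk cc).
Qed.

(* Dividing the chords of y = x + z by their total length yields the same linear
   relation between the three tangents on both curves. *)
Lemma tangent_relation t : exists a b : R,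
  e (h t) = a *: e t + b *: e (h (h t)) /\ E (h t) = a *: E t + b *: E (h (h t)).
Proof.
have [F [FU sF]] := ultraFilterLemma (at_right_proper_filter t).
have FF : ProperFilter F by exact: ultra_proper.
have u1 := at_right_from sF.
have u2 := h_right (FF := FF) nn rc nl h_gt h_lt h_dist u1.
have u3 := h_right (FF := FF) nn rc nl h_gt h_lt h_dist u2.
pose l1 u := n (r u - r t); pose l2 u := n (r (h u) - r (h t)).
pose l3 u := n (r (h (h u)) - r (h (h t))).
pose S u := l1 u + l2 u + l3 u.
have P1 : \forall u \near F, 0 < l1 u by exact: (chord_gt0 nn rc u1).
have P2 : \forall u \near F, 0 < l2 u by exact: (chord_gt0 nn rc u2).
have P3 : \forall u \near F, 0 < l3 u by exact: (chord_gt0 nn rc u3).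
have S0 : \forall u \near F, 0 < S u by apply: filterS3 P1 P2 P3 => u *; rewrite /S; lra.
have bnd (l : R -> R) : (\forall u \near F, 0 < l u) -> (forall u, l u <= S u) ->
    exists a, slim F (fun u => l u / S u) a.
  move=> l0 lS; apply: (ultra_cvg FU (C := 1)).
  apply: filterS2 l0 S0 => u lu Su.
  by rewrite gtr0_norm ?divr_gt0// ler_pdivrMr// mul1r.
have g0 k := n_ge0 nn k.
have [|p1 h1] := bnd _ P1; first by move=> u; rewrite /S /l2 /l3; have := g0 (r (h u) - r (h t));
  have := g0 (r (h (h u)) - r (h (h t))); lra.
have [|p2 h2] := bnd _ P2; first by move=> u; rewrite /S /l1 /l3; have := g0 (r u - r t);
  have := g0 (r (h (h u)) - r (h (h t))); lra.
have [|p3 h3'] := bnd _ P3; first by move=> u; rewrite /S /l1 /l2; have := g0 (r u - r t);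
  have := g0 (r (h u) - r (h t)); lra.
have psum : p1 + p2 + p3 = 1.
  apply: (slim_unique (F := F) (slimD (slimD h1 h2) h3')).
  apply: slim_eq (slim_cst 1); apply: filterS S0 => u Su.
  by rewrite -!mulrDl -/(S u) divff// gt_eqF.
have rel (k : V -> R) (c : R -> V) : plane_norm k -> unit_curve k c ->
    (forall u v, k (c u - c v) = n (r u - r v)) -> (forall u, c (h u) = c u + c (h (h u))) ->
    p2 *: tgc k c (h t) = p1 *: tgc k c t + p3 *: tgc k c (h (h t)).
  move=> kk cc ck ch.
  have L1 := chord_limu (FF := FF) kk cc FU u1.
  have L2 := chord_limu (FF := FF) kk cc FU u2.
  have L3 := chord_limu (FF := FF) kk cc FU u3.
  apply: (vlim_unique (F := F) (vlimZ h2 L2)); apply: vlim_eq (vlimD (vlimZ h1 L1) (vlimZ h3' L3)).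
  apply: filterS2 S0 (filterI P1 (filterI P2 P3)) => u Su [Pu1 [Pu2 Pu3]].
  rewrite /= !ck -/(l1 u) -/(l2 u) -/(l3 u) !scalerA.
  have canc (a b : R) : 0 < a -> a / b / a = b^-1 by move=> a0; rewrite mulrAC divff ?gt_eqF// mul1r.
  by rewrite !canc// -scalerDr (ch u) (ch t); congr (_ *: _); rewrite opprD addrACA.
have A := rel n r nn rc (fun _ _ => erefl) hex.
have B := rel m rho mm rhoc (fun u v => esym (iso u v)) Hex.
have [p2z|p20] := eqVneq p2 0.
  exfalso; rewrite p2z scale0r in A.
  have [q _ _ _ _] := dets_pos nn rc nl hex (tgc_supp nn rc t)
    (tgc_supp nn rc (h t)) (tgc_supp nn rc (h (h t))).
  have [z1 z3] : 0 = p1 /\ 0 = p3.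
    by apply: (frame_coef (lt0r_neq0 q)); rewrite -A !scale0r addr0.
  by move: psum; rewrite p2z -z1 -z3; lra.
exists (p1 / p2), (p3 / p2); split; apply: (scalerI p20); rewrite ?A ?B scalerDr !scalerA;
  by rewrite ![p2 * _]mulrC !divfK.
Qed.

Definition fr t := frames (r t) (r (h (h t))) (e t) (e (h t)) (e (h (h t)))
  (rho t) (rho (h (h t))) (E t) (E (h t)) (E (h (h t))).

(** Besides [tangent_relation], three instances of [slope_common] enter, one for each of the sums y
    - x = z, y - z = x and x + z = y. *)
Lemma frP t : fr t.
Proof.
have S u := tgc_supp nn rc u; have S' u := tgc_supp mm rhoc u.
have P := dets_pos nn rc nl hex (S t) (S _) (S _).
have Q := dets_pos mm rhoc nlm Hex (S' t) (S' _) (S' _).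
have [a [b [A B]]] := tangent_relation t.
have r0 u := r_neq0 nn rc u.
have g0 u := supp_gt0 nn (r0 u) (S u); have g0' u := supp_gt0 mm (r_neq0 mm rhoc u) (S' u).
(* Antipodes turn the differences y - x and y - z into sums, the form required by [slope_common]. *)
have z1 : r (h t) + r (t - pi) = r (h (h t)) by rewrite (rNpi rc) hex addrAC subrr add0r.
have z2 : rho (h t) + rho (t - pi) = rho (h (h t)) by rewrite (rNpi rhoc) Hex addrAC subrr add0r.
have x1 : r (h t) + r (h (h t) - pi) = r t by rewrite (rNpi rc) hex addrK.
have x2 : rho (h t) + rho (h (h t) - pi) = rho t by rewrite (rNpi rhoc) Hex addrK.
apply: (frames_of_slopes P Q _ _ A B); rewrite -?hex -?Hex //.
- by have := slope_common nn mm rc rhoc iso (s := h t) (t := t - pi); rewrite z1 z2; apply.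
- by have := slope_common nn mm rc rhoc iso (s := h t) (t := h (h t) - pi); rewrite x1 x2; apply.
- have := slope_common nn mm rc rhoc iso (s := t) (t := h (h t)); rewrite -hex -Hex; apply.
  exact: r0.
Qed.

Definition gap_at t := gap (r t) (e t) (e (h (h t))) (rho t) (E t) (E (h (h t))).
(* At a point where everything is differentiable, the derivative of this periodic function is
   [- k1 * det (r t) (e t) * gap_at t ^+ 2 <= 0], with k1 the curvature. *)
Definition wgap t := det (r t) (e t) * gap_at t.

Lemma e_pi (k : V -> R) (c : R -> V) : plane_norm k -> unit_curve k c ->
  forall t, tgc k c (t + pi) = - tgc k c t.
Proof.
move=> kk cc t; rewrite /tgc (rpi cc) /tg /tg0.
have -> : rot (- c t) = - rot (c t) by apply: vP; rewrite !vE.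
have dnN p w : dn k (- p) (- w) = dn k p w.
  rewrite /dn; congr inf; apply/seteqP; split=> _ [d /= d0 <-]; exists d => //;
  by rewrite /dquot scalerN -opprD !(nN kk).
rewrite dnN (nN kk) !scalerN -opprD (nN kk) scalerN; congr (- (_ *: _)).
Qed.

Lemma wgap_pi t : wgap (t + pi) = wgap t.
Proof.
have hp := h_pi nn rc nl h_gt h_lt h_dist.
rewrite /wgap /gap_at /gap /co1 !hp !(e_pi nn rc) !(e_pi mm rhoc) !(rpi rc) !(rpi rhoc).
by rewrite !detNr !detrN !opprK.
Qed.

Lemma wgap_eq0 t : wgap t = 0 -> gap_at t = 0.
Proof.
move=> /eqP; rewrite mulf_eq0 => /orP[|/eqP//].
by have [[_ _ _ p _] _ _ _ _] := frP t; rewrite gt_eqF.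
Qed.

(* Difference quotients with respect to a gauge are bounded, hence converge along every ultrafilter. *)
Definition gauge_on (D : R -> R) (p q : R) := forall s t, p < s -> s < t -> t < q ->
  [/\ D s < D t,
      n (r t - r s) <= D t - D s, n (r (h (h t)) - r (h (h s))) <= D t - D s &
      [/\ n (e t - e s) <= D t - D s, n (e (h t) - e (h s)) <= D t - D s &
          n (e (h (h t)) - e (h (h s))) <= D t - D s] /\
      [/\ m (E t - E s) <= D t - D s, m (E (h t) - E (h s)) <= D t - D s &
          m (E (h (h t)) - E (h (h s))) <= D t - D s]].

(** Sum of local gauges of both curves at [t0], [h t0] and [h (h t0)], pulled back along the
    increasing continuous maps [h] and [h \o h]. *)
Lemma gauge_exists t0 : exists2 d, 0 < d & exists D : R -> R, gauge_on D (t0 - d) (t0 + d).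
Proof.
have hm := h_mono nn rc nl h_gt h_lt h_dist.
have hc := h_cont nn rc nl h_gt h_lt h_dist.
pose ok (g : R -> R) (w : R -> R) t0 d := forall s t, t0 - d < s -> s < t -> t < t0 + d ->
   [/\ n (r (w t) - r (w s)) <= g t - g s,
    n (e (w t) - e (w s)) <= g t - g s & m (E (w t) - E (w s)) <= g t - g s].
have base (w : R -> R) : (forall s t, s < t -> w s < w t) -> slim (nbhs t0) w (w t0) ->
    exists2 d, 0 < d & exists g, ok g w t0 d.
  move=> wm wc.
  have [d1 d10 [g1 h1]] := curve_gauge nn rc (w t0).
  have [d2 d20 [g2 h2]] := curve_gauge mm rhoc (w t0).
  have [d /= d0 hd] : \forall t \near nbhs t0,
      (w t0 - d1 < w t /\ w t < w t0 + d1) /\ (w t0 - d2 < w t /\ w t < w t0 + d2).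
    apply: filterI; apply: filterI;
      [apply: slim_gt wc _|apply: slim_lt wc _|apply: slim_gt wc _|apply: slim_lt wc _]; lra.
  exists d => //; exists (fun t => g1 (w t) + g2 (w t)) => s t a b c.
  have [|[s1 s2] [s3 s4]] := hd s; first by rewrite /ball /= ltr_distlC; apply/andP; split; lra.
  have [|[t1 t2] [t3 t4]] := hd t; first by rewrite /ball /= ltr_distlC; apply/andP; split; lra.
  have [k1 k2] := h1 _ _ s1 (wm _ _ b) t2; have [k3 k4] := h2 _ _ s3 (wm _ _ b) t4.
  have z1 : 0 <= g1 (w t) - g1 (w s) by exact: le_trans (n_ge0 nn _) k1.
  have z2 : 0 <= g2 (w t) - g2 (w s) by exact: le_trans (n_ge0 mm _) k3.
  by split; [exact: incr_l|exact: incr_l|exact: incr_r].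
have [|d1 d10 [g1 h1]] := base id (fun _ _ => id); first by split; exact: cvg_id.
have [d2 d20 [g2 h2]] := base h hm (hc t0).
have [||d3 d30 [g3 h3']] := base (fun t => h (h t)).
- by move=> s t st; exact/hm/hm.
- exact: slim_comp (hc t0) (hc (h t0)).
exists (Num.min d1 (Num.min d2 d3)); first by rewrite !lt_min d10 d20.
have m1 : Num.min d1 (Num.min d2 d3) <= d1 by rewrite ge_min lexx.
have m2 : Num.min d1 (Num.min d2 d3) <= d2 by rewrite !ge_min lexx orbT.
have m3 : Num.min d1 (Num.min d2 d3) <= d3 by rewrite !ge_min lexx !orbT.
(* The last summand makes the gauge strictly increasing. *)
exists (fun t => g1 t + g2 t + g3 t + t) => s t a b c.
have [i1 j1] := shrink_ball m1 a c; have [i2 j2] := shrink_ball m2 a c.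
have [i3 j3] := shrink_ball m3 a c.
have [a1 a2 a3] := h1 s t i1 b j1; have [b1 b2 b3] := h2 s t i2 b j2.
have [c1 c2 c3] := h3' s t i3 b j3.
have [u0 u1 u2 u3] := gauge_sum b (le_trans (n_ge0 nn _) a1) (le_trans (n_ge0 nn _) b1)
  (le_trans (n_ge0 nn _) c1).
by split; [|apply: u1|apply: u3|split; split; [apply: u1|apply: u2|apply: u3|apply: u1|apply: u2|apply: u3]].
Qed.

Section RightDerivative.
Variables (D : R -> R) (p q s : R) (F : set_system R).
Hypotheses (gD : gauge_on D p q) (ps : p < s) (sq : s < q).
Hypotheses (FU : UltraFilter F) (sF : F `=>` at_right s).

Let FF : ProperFilter F.
Proof. exact: ultra_proper. Qed.

Let Dl t := D t - D s.

Let u1 : from_right (F := F) id s := at_right_from sF.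
Let u2 : from_right (F := F) (fun t => h t) (h s).
Proof. exact: (h_right nn rc nl h_gt h_lt h_dist u1). Qed.
Let u3 : from_right (F := F) (fun t => h (h t)) (h (h s)).
Proof. exact: (h_right nn rc nl h_gt h_lt h_dist u2). Qed.

Lemma near_gauge : \forall t \near F, s < t /\ t < q.
Proof. exact: filterS2 (proj1 u1) (slim_lt (proj2 u1) sq). Qed.

Lemma near_Dl : \forall t \near F, 0 < Dl t.
Proof. by apply: filterS near_gauge => t [st tq]; rewrite subr_gt0; have [] := gD ps st tq. Qed.

(** The speed [l] is the limit of chord length over increment of the gauge; chord lengths agree on
    the two curves, hence one [l] for both. *)
Lemma curve_deriv (u : R -> R) : from_right (F := F) u (u s) ->
  (\forall t \near F, n (r (u t) - r (u s)) <= Dl t) ->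
  exists l, visd (F := F) Dl (fun t => r (u t)) (r (u s)) (l *: e (u s)) /\
            visd (F := F) Dl (fun t => rho (u t)) (rho (u s)) (l *: E (u s)).
Proof.
move=> us hu; have P := chord_gt0 (FF := FF) nn rc us.
have [|l hl] := ultra_cvg FU (f := fun t => n (r (u t) - r (u s)) / Dl t) (C := 1).
  apply: filterS3 near_Dl hu P => t Dt ht l0.
  by rewrite gtr0_norm ?divr_gt0// ler_pdivrMr// mul1r.
exists l.
have aux (k : V -> R) (c : R -> V) : plane_norm k -> unit_curve k c ->
    (forall t, k (c (u t) - c (u s)) = n (r (u t) - r (u s))) ->
    visd (F := F) Dl (fun t => c (u t)) (c (u s)) (l *: tgc k c (u s)).
  move=> kk cc ck; split; last by exact: (curve_lim cc (proj2 us)).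
  have L := chord_limu (FF := FF) kk cc FU us.
  apply: vlim_eq (vlimZ hl L); apply: filterS P => t Pt.
  by rewrite ck scalerA; congr (_ *: _); rewrite mulrAC divff ?gt_eqF// mul1r.
by split; apply: aux.
Qed.

Lemma deriv_data : exists l1 l3 de1 de2 de3 dE1 dE2 dE3,
  [/\ visd (F := F) Dl r (r s) (l1 *: e s) /\ visd (F := F) Dl rho (rho s) (l1 *: E s),
      visd (F := F) Dl (fun t => r (h (h t))) (r (h (h s))) (l3 *: e (h (h s))) /\
      visd (F := F) Dl (fun t => rho (h (h t))) (rho (h (h s))) (l3 *: E (h (h s))),
      [/\ visd (F := F) Dl e (e s) de1, visd (F := F) Dl (fun t => e (h t)) (e (h s)) de2 &
          visd (F := F) Dl (fun t => e (h (h t))) (e (h (h s))) de3] &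
      [/\ visd (F := F) Dl E (E s) dE1, visd (F := F) Dl (fun t => E (h t)) (E (h s)) dE2 &
          visd (F := F) Dl (fun t => E (h (h t))) (E (h (h s))) dE3]].
Proof.
have G : \forall t \near F, [/\ n (r t - r s) <= Dl t, n (r (h (h t)) - r (h (h s))) <= Dl t &
      [/\ n (e t - e s) <= Dl t, n (e (h t) - e (h s)) <= Dl t &
          n (e (h (h t)) - e (h (h s))) <= Dl t] /\
      [/\ m (E t - E s) <= Dl t, m (E (h t) - E (h s)) <= Dl t &
          m (E (h (h t)) - E (h (h s))) <= Dl t]].
  by apply: filterS near_gauge => t [st tq]; have [] := gD ps st tq.
have [|l1 [A1 B1]] := curve_deriv (u := id) u1; first by apply: filterS G => t [].
have [|l3 [A3 B3]] := curve_deriv (u := fun t => h (h t)) u3; first by apply: filterS G => t [].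
have [|de1 C1] := visd_lip nn FU (tgc_right nn rc FU u1) near_Dl.
  by apply: filterS G => t [_ _ [[? ? ?] [? ? ?]]].
have [|de2 C2] := visd_lip nn FU (tgc_right nn rc FU u2) near_Dl.
  by apply: filterS G => t [_ _ [[? ? ?] [? ? ?]]].
have [|de3 C3] := visd_lip nn FU (tgc_right nn rc FU u3) near_Dl.
  by apply: filterS G => t [_ _ [[? ? ?] [? ? ?]]].
have [|dE1 D1] := visd_lip mm FU (tgc_right mm rhoc FU u1) near_Dl.
  by apply: filterS G => t [_ _ [[? ? ?] [? ? ?]]].
have [|dE2 D2] := visd_lip mm FU (tgc_right mm rhoc FU u2) near_Dl.
  by apply: filterS G => t [_ _ [[? ? ?] [? ? ?]]].
have [|dE3 D3] := visd_lip mm FU (tgc_right mm rhoc FU u3) near_Dl.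
  by apply: filterS G => t [_ _ [[? ? ?] [? ? ?]]].
by exists l1, l3, de1, de2, de3, dE1, dE2, dE3.
Qed.

(** The weight [det (r t) (e t)] has derivative [t1] times itself, which cancels the term with [t1]
    in [gap_deriv] and leaves only the curvature term. *)
Lemma wgap_deriv : exists k de1,
  [/\ 0 <= k, visd (F := F) Dl e (e s) de1, det de1 (e s) = - k * det (r s) (e s) &
      isd (F := F) Dl wgap (wgap s) (- k * det (r s) (e s) * gap_at s ^+ 2)].
Proof.
have [l1 [l3 [de1 [de2 [de3 [dE1 [dE2 [dE3 [[dx dX] [dz dZ] [C1 C2 C3] [D1 D2 D3]]]]]]]]]] :=
  deriv_data.
have FRs := frP s.
have [[p1 p2 p3 p4 p5] [q1 q2 q3 q4 q5] [muE nuE] [aE bE] _] := FRs.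
have [k0 [laE xiE]] := frames_gap FRs.
have pn := lt0r_neq0 p1; have qn := lt0r_neq0 q1.
have y2 : 0 < det (r s + r (h (h s))) (e (h s)).
  by rewrite -hex; exact: (supp_gt0 nn (r_neq0 nn rc _) (tgc_supp nn rc _)).
have Y2 : 0 < det (rho s + rho (h (h s))) (E (h s)).
  by rewrite -Hex; exact: (supp_gt0 mm (r_neq0 mm rhoc _) (tgc_supp mm rhoc _)).
pose k1 := - (det de1 (e s) / det (r s) (e s)).
pose k2 := - (det de2 (e (h s)) / det (r s + r (h (h s))) (e (h s))).
pose k3 := - (det de3 (e (h (h s))) / det (r (h (h s))) (e (h (h s)))).
have K1 : det dE1 (E s) = - k1 * det (rho s) (E s).
  have := kappa_common nn mm rc rhoc iso FU (D := Dl) u1 (proj1 C1) (proj1 D1).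
  by rewrite /k1 opprK => ->; rewrite divfK// gt_eqF.
have K2 : det dE2 (E (h s)) = - k2 * det (rho s + rho (h (h s))) (E (h s)).
  have := kappa_common nn mm rc rhoc iso FU (D := Dl) u2 (proj1 C2) (proj1 D2).
  by rewrite /k2 -hex -Hex opprK => ->; rewrite divfK// Hex gt_eqF.
have K3 : det dE3 (E (h (h s))) = - k3 * det (rho (h (h s))) (E (h (h s))).
  have := kappa_common nn mm rc rhoc iso FU (D := Dl) u3 (proj1 C3) (proj1 D3).
  by rewrite /k3 opprK => ->; rewrite divfK// gt_eqF.
have k1E : det de1 (e s) = - k1 * det (r s) (e s) by rewrite /k1 opprK divfK// gt_eqF.
have k2E : det de2 (e (h s)) = - k2 * det (r s + r (h (h s))) (e (h s)).
  by rewrite /k2 opprK divfK// gt_eqF.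
have k3E : det de3 (e (h (h s))) = - k3 * det (r (h (h s))) (e (h (h s))).
  by rewrite /k3 opprK divfK// gt_eqF.
(* Tangents turn counterclockwise, so the curvature is nonnegative. *)
have k1p : 0 <= k1.
  rewrite /k1 oppr_ge0 pmulr_lle0 ?invr_gt0//.
  apply: (slim_le (F := F) (vlim_det (proj1 C1) (vlim_cst (e s)))).
  apply: filterS2 near_Dl (from_right_det rc u1) => t Dt rt.
  have -> : det ((Dl t)^-1 *: (e t - e s)) (e s) = - ((Dl t)^-1 * det (e s) (e t)).
    by rewrite /det !vE; ring.
  rewrite oppr_le0 mulr_ge0 ?invr_ge0 ?(ltW Dt)//.
  exact: (supp_turn nn (r_neq0 nn rc s) (r_neq0 nn rc t) (tgc_supp nn rc s) (tgc_supp nn rc t)).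
have [dla hla] := isd_co1 pn dx C1 C3; have [dmu hmu] := isd_co2 pn dx C1 C3.
have [dnu hnu] := isd_co1 pn dz C1 C3; have [dxi hxi] := isd_co2 pn dz C1 C3.
have [da ha] := isd_co1 pn C2 C1 C3; have [db hb] := isd_co2 pn C2 C1 C3.
have [dla' hla'] := isd_co1 qn dX D1 D3; have [dmu' hmu'] := isd_co2 qn dX D1 D3.
have [dnu' hnu'] := isd_co1 qn dZ D1 D3; have [dxi' hxi'] := isd_co2 qn dZ D1 D3.
have [da' ha'] := isd_co1 qn D2 D1 D3; have [db' hb'] := isd_co2 qn D2 D1 D3.
(* Coordinates that agree on the two curves at every parameter have equal derivatives. *)
have same (f g : R -> R) a b : (forall t, f t = g t) -> isd (F := F) Dl f (f s) a ->
    isd (F := F) Dl g (g s) b -> b = a.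
  by move=> fg ha1 hb1; apply: (isd_unique (F := F) hb1); apply: isd_eq ha1 => //; exact: nearW.
have dmuE : dmu' = dmu by apply: same hmu hmu' => t; case: (frP t) => _ _ [].
have dnuE : dnu' = dnu by apply: same hnu hnu' => t; case: (frP t) => _ _ [].
have daE : da' = da by apply: same ha ha' => t; case: (frP t) => _ _ _ [].
have dbE : db' = db by apply: same hb hb' => t; case: (frP t) => _ _ _ [].
have vd (v w1 w2 : R -> V) (dv dw1 dw2 : V) (c d : R) : (forall t, det (w1 t) (w2 t) != 0) ->
    visd (F := F) Dl v (v s) dv -> visd (F := F) Dl w1 (w1 s) dw1 ->
    visd (F := F) Dl w2 (w2 s) dw2 ->
    isd (F := F) Dl (fun t => co1 (v t) (w1 t) (w2 t)) (co1 (v s) (w1 s) (w2 s)) c ->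
    isd (F := F) Dl (fun t => co2 (v t) (w1 t) (w2 t)) (co2 (v s) (w1 s) (w2 s)) d ->
    dv = (c *: w1 s + co1 (v s) (w1 s) (w2 s) *: dw1) + (d *: w2 s + co2 (v s) (w1 s) (w2 s) *: dw2).
  move=> hn hv h1 h2 hc hd; apply: (visd_unique (F := F) hv).
  apply: visd_eq (visdD (visdZ hc h1) (visdZ hd h2)); last by rewrite -coE.
  by apply: nearW => t; rewrite -coE.
have pA t : det (e t) (e (h (h t))) != 0 by case: (frP t) => [[/lt0r_neq0]].
have qA t : det (E t) (E (h (h t))) != 0 by case: (frP t) => [_ [/lt0r_neq0]].
have V1 := vd _ _ _ _ _ _ _ _ pA dx C1 C3 hla hmu.
have V3 := vd _ _ _ _ _ _ _ _ pA dz C1 C3 hnu hxi.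
have V2 := vd _ _ _ _ _ _ _ _ pA C2 C1 C3 ha hb.
have W1 := vd _ _ _ _ _ _ _ _ qA dX D1 D3 hla' hmu'.
have W3 := vd _ _ _ _ _ _ _ _ qA dZ D1 D3 hnu' hxi'.
have W2 := vd _ _ _ _ _ _ _ _ qA D2 D1 D3 ha' hb'.
have [t1 [t2 [t3 [S0 [S1 S2] S3 S4 S5]]]] := frame_deriv pn (lt0r_neq0 p4) (lt0r_neq0 p5)
  (lt0r_neq0 y2) (coE _ pn) (coE _ pn) (coE _ pn) V1 V3 V2 k1E k2E k3E.
have [t1' [t2' [t3' [S0' [S1' S2'] S3' S4' S5']]]] := frame_deriv qn (lt0r_neq0 q4) (lt0r_neq0 q5)
  (lt0r_neq0 Y2) (coE _ qn) (coE _ qn) (coE _ qn) W1 W3 W2 K1 K2 K3.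
rewrite dmuE dnuE daE dbE -muE -nuE -aE -bE laE xiE in S1' S2' S3' S4' S5'.
have an : co1 (e (h s)) (e s) (e (h (h s))) != 0 by apply/lt0r_neq0/divr_gt0.
have bn : co2 (e (h s)) (e s) (e (h (h s))) != 0 by apply/lt0r_neq0/divr_gt0.
have mun : co2 (r s) (e s) (e (h (h s))) != 0.
  have -> : co2 (r s) (e s) (e (h (h s))) = - (det (r s) (e s) / det (e s) (e (h (h s)))).
    by rewrite /co2 -mulNr; congr (_ / _); rewrite /det; ring.
  by rewrite oppr_eq0 lt0r_neq0// divr_gt0.
have nun : co1 (r (h (h s))) (e s) (e (h (h s))) != 0 by apply/lt0r_neq0/divr_gt0.
have key := gap_deriv mun nun an bn S1 S2 S3 S4 S5 S1' S2' S3' S4' S5'.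
exists k1, de1; split=> //.
have gE : gap_at s = co1 (e (h s)) (e s) (e (h (h s))) * k0.
  by rewrite /gap_at /gap laE addrAC subrr add0r.
rewrite -gE in key.
have dM := isdM (visd_det dx C1) (isdB hla' hla).
rewrite /wgap; have -> : - k1 * det (r s) (e s) * gap_at s ^+ 2 =
  (det (l1 *: e s) (e s) + det (r s) de1) *
  (co1 (rho s) (E s) (E (h (h s))) - co1 (r s) (e s) (e (h (h s)))) +
  det (r s) (e s) * (dla' - dla).
  have -> : det (l1 *: e s) (e s) = 0 by rewrite /det !vE; ring.
  by rewrite S0 key -/(gap _ _ _ _ _ _) -/(gap_at s); ring.
exact: dM.
Qed.

(* where the gap vanishes, the linear map carrying (x, z) to (X, Z) is stationary *)
Lemma stationary (w : V) : gap_at s = 0 ->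
  let A t := (det w (r (h (h t))) / det (r t) (r (h (h t)))) *: rho t +
             (det (r t) w / det (r t) (r (h (h t)))) *: rho (h (h t)) in
  visd (F := F) Dl A (A s) 0.
Proof.
move=> g0 A.
have [l1 [l3 [de1 [de2 [de3 [dE1 [dE2 [dE3 [[dx dX] [dz dZ] _ _]]]]]]]]] := deriv_data.
have FRs := frP s.
have [[p1 p2 p3 p4 p5] [q1 q2 q3 q4 q5] [muE nuE] [aE bE] _] := FRs.
have [k0 [laE xiE]] := frames_gap FRs.
have pn := lt0r_neq0 p1; have qn := lt0r_neq0 q1.
have a0 : co1 (e (h s)) (e s) (e (h (h s))) != 0 by apply/lt0r_neq0/divr_gt0.
have k00 : k0 = 0.
  apply: (mulfI a0); rewrite mulr0 -g0 /gap_at /gap laE addrAC subrr add0r//.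
rewrite k00 !mulr0 !addr0 in laE xiE.
have xz t : det (r t) (r (h (h t))) != 0.
  have -> : det (r t) (r (h (h t))) = det (r t) (r (h t)).
    by rewrite (hex t) /det !vE; ring.
  by apply/lt0r_neq0; exact: (rdet rc).
have wc : visd (F := F) Dl (fun=> w) w 0.
  split; last exact: vlim_cst.
  by apply: vlim_eq (vlim_cst 0); apply: nearW => t; rewrite subrr scaler0.
have [c hc] := isd_co1 (xz s) wc dx dz; have [d hd] := isd_co2 (xz s) wc dx dz.
have H1 := visdD (FF := FF) (visdZ (FF := FF) hc dx) (visdZ (FF := FF) hd dz).
have H2 : visd (F := F) Dl (fun=> w) w ((c *: r s + co1 w (r s) (r (h (h s))) *: (l1 *: e s)) +
    (d *: r (h (h s)) + co2 w (r s) (r (h (h s))) *: (l3 *: e (h (h s))))).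
  apply: visd_eq H1; last by rewrite -coE.
  by apply: nearW => t; rewrite -coE.
have H3 := visd_unique (FF := FF) wc H2.
have xE := coE (r s) pn; have zE := coE (r (h (h s))) pn.
have XE := coE (rho s) qn; have ZE := coE (rho (h (h s))) qn.
rewrite -muE laE in XE; rewrite -nuE xiE in ZE.
set la := co1 (r s) _ _ in laE xE XE; set mu := co2 (r s) _ _ in muE xE XE.
set nu := co1 (r (h (h s))) _ _ in nuE zE ZE; set xi := co2 (r (h (h s))) _ _ in xiE zE ZE.
set c0 := co1 w _ _ in H3 hc H1 H2; set d0 := co2 w _ _ in H3 hd H1 H2.
(* The vector [w] is fixed, so the derivative of its expansion in x and z vanishes; these are its
   coordinates in the frame. *)
have [E1 E2] : 0 = c * la + d * nu + c0 * l1 /\ 0 = c * mu + d * xi + d0 * l3.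
  apply: (frame_coef pn); rewrite !scale0r addr0 [LHS]H3 {1}xE {1}zE.
  by apply: vP; rewrite !vE; ring.
have H4 := visdD (FF := FF) (visdZ (FF := FF) hc dX) (visdZ (FF := FF) hd dZ).
(* As the gap vanishes, X and Z have in the image frame the coordinates of x and z, so the same two
   expressions reappear. *)
suff e0 : c *: rho s + c0 *: (l1 *: E s) + (d *: rho (h (h s)) + d0 *: (l3 *: E (h (h s)))) = 0.
  by rewrite e0 in H4; exact: H4.
rewrite XE ZE.
have -> : c *: (la *: E s + mu *: E (h (h s))) + c0 *: (l1 *: E s) +
  (d *: (nu *: E s + xi *: E (h (h s))) + d0 *: (l3 *: E (h (h s)))) =
  (c * la + d * nu + c0 * l1) *: E s + (c * mu + d * xi + d0 * l3) *: E (h (h s)).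
  by apply: vP; rewrite !vE; ring.
by rewrite -E1 -E2 !scale0r addr0.
Qed.

End RightDerivative.

Lemma unit_scale (k : V -> R) (kk : plane_norm k) (be : R) (p : V) : 0 < be ->
  k p = 1 -> k (be *: p) = 1 -> be = 1.
Proof. by move=> b0 p1; rewrite (nZ kk) p1 mulr1 gtr0_norm. Qed.

(** Either the tangents have no jump and [wgap] is continuous from the left, or [jump_gap], applied
    in both directions, separates the two values by 0. The alternative is recorded for the proof
    that the constant value of [wgap] is 0. *)
Lemma wgap_left (s : R) (F : set_system R) (FU : UltraFilter F) (sF : F `=>` at_left s) :
  exists l, [/\ slim F wgap l, wgap s <= l & vlim F e (e s) \/ wgap s <= 0 /\ 0 <= l].
Proof.
have FF : ProperFilter F by exact: ultra_proper.
have u1 := at_left_from sF.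
have u2 := h_left (FF := FF) nn rc nl h_gt h_lt h_dist u1.
have u3 := h_left (FF := FF) nn rc nl h_gt h_lt h_dist u2.
have [f1 lf1 v1] := tgc_left (FF := FF) nn rc FU u1.
have [f2 lf2 v2] := tgc_left (FF := FF) nn rc FU u2.
have [f3 lf3 v3] := tgc_left (FF := FF) nn rc FU u3.
have [G1 lG1 V1] := tgc_left (FF := FF) mm rhoc FU u1.
have [G2 lG2 V2] := tgc_left (FF := FF) mm rhoc FU u2.
have [G3 lG3 V3] := tgc_left (FF := FF) mm rhoc FU u3.
have S t := tgc_supp nn rc t.
have P := dets_pos nn rc nl hex (proj1 lf1) (proj1 lf2) (proj1 lf3).
have Q := dets_pos mm rhoc nlm Hex (proj1 lG1) (proj1 lG2) (proj1 lG3).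
have X1 := curve_lim rc (proj2 u1); have X3 := curve_lim rc (proj2 u3).
have Y1 := curve_lim rhoc (proj2 u1); have Y3 := curve_lim rhoc (proj2 u3).
have FR' : frames (r s) (r (h (h s))) f1 f2 f3 (rho s) (rho (h (h s))) G1 G2 G3.
  exact: (frames_lim X1 X3 v1 v2 v3 Y1 Y3 V1 V2 V3 P Q frP).
have [p1 _ _ p4 _] := P; have [q1 _ _ _ _] := Q.
have FRs := frP s; have [[P1 _ _ P4 _] _ _ _ _] := FRs.
pose l := det (r s) f1 * gap (r s) f1 f3 (rho s) G1 G3.
have Ml : slim F wgap l.
  apply: (slimM (F := F) (vlim_det X1 v1)); apply: slimB; apply: slim_div;
    by [exact: lt0r_neq0|exact: vlim_det].
have [al1 [be1 [a1 b1 E1 E1']]] := jump_common nn mm rc rhoc iso lf1 lG1.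
have [al2 [be2 [a2 b2 E2 E2']]] := jump_common nn mm rc rhoc iso lf2 lG2.
have [al3 [be3 [a3 b3 E3 E3']]] := jump_common nn mm rc rhoc iso lf3 lG3.
(* [dets_pos] accepts any supporting directions, in particular a mixture of left and right
   tangents. *)
have [_ _ fe _] : [/\ True, True, 0 < det f1 (e (h (h s))) & True].
  by have [? _ _ _ _] := dets_pos nn rc nl hex (proj1 lf1) (S (h s)) (S (h (h s))).
have [_ _ ef _] : [/\ True, True, 0 < det (e s) f3 & True].
  by have [? _ _ _ _] := dets_pos nn rc nl hex (S s) (S (h s)) (proj1 lf3).
have same : al1 = 0 -> al3 = 0 -> exists l, [/\ slim F wgap l, wgap s <= l &
    vlim F e (e s) \/ wgap s <= 0 /\ 0 <= l].
  move=> z1 z3; rewrite z1 scale0r add0r in E1; rewrite z1 scale0r add0r in E1'.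
  rewrite z3 scale0r add0r in E3; rewrite z3 scale0r add0r in E3'.
  have B1 : be1 = 1.
    by apply: (unit_scale nn b1 (proj1 (S s))); rewrite -E1; exact: (proj1 (proj1 lf1)).
  have B3 : be3 = 1.
    by apply: (unit_scale nn b3 (proj1 (S (h (h s))))); rewrite -E3; exact: (proj1 (proj1 lf3)).
  rewrite B1 scale1r in E1; rewrite B1 scale1r in E1'.
  rewrite B3 scale1r in E3; rewrite B3 scale1r in E3'.
  have lM : l = wgap s by rewrite /l E1 E3 E1' E3'.
  exists l; split; [exact: Ml|by rewrite lM|].
  by left; rewrite -E1.
have hex2 := hex s; have Hex2 := Hex s.
rewrite hex2 in E2; rewrite Hex2 in E2'.
have J1 : 1 * gap_at s <= 0 \/ [/\ al1 = 0, al2 = 0 & al3 = 0].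
  by apply: (jump_gap FRs FR' (ltW fe) (ltW ef) (or_introl erefl) _ _ _ b1 E1 E2 E3 E1' E2' E3');
    rewrite mul1r.
have inv (f x g : V) (al be : R) : 0 < be -> f = al *: x + be *: g ->
    g = (- al / be) *: x + be^-1 *: f.
  by move=> b0 ->; apply: vP; rewrite !vE; field; rewrite gt_eqF.
have J2 : - 1 * gap (r s) f1 f3 (rho s) G1 G3 <= 0 \/
    [/\ - al1 / be1 = 0, - al2 / be2 = 0 & - al3 / be3 = 0].
  apply: (jump_gap FR' FRs (ltW ef) (ltW fe) (or_intror erefl) _ _ _ _
    (inv _ _ _ _ _ b1 E1) (inv _ _ _ _ _ b2 E2) (inv _ _ _ _ _ b3 E3)
    (inv _ _ _ _ _ b1 E1') (inv _ _ _ _ _ b2 E2') (inv _ _ _ _ _ b3 E3')).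
  - by rewrite mulNr mul1r mulNr opprK divr_ge0// ltW.
  - by rewrite mulNr mul1r mulNr opprK divr_ge0// ltW.
  - by rewrite mulNr mul1r mulNr opprK divr_ge0// ltW.
  - by rewrite invr_gt0.
case: J1 => [g1|[z1 _ z3]]; last exact: same.
case: J2 => [g2|[z1 _ z3]]; last first.
  have z (al be : R) : 0 < be -> - al / be = 0 -> al = 0.
    by move=> b0 /eqP; rewrite mulf_eq0 invr_eq0 (gt_eqF b0) orbF oppr_eq0 => /eqP.
  by apply: same; [exact: z b1 z1|exact: z b3 z3].
rewrite mul1r in g1; rewrite mulN1r oppr_le0 in g2.
have m0 : wgap s <= 0 by rewrite /wgap pmulr_rle0.
have l0 : 0 <= l by rewrite /l pmulr_rge0.
by exists l; split=> //; [exact: le_trans l0|right].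
Qed.

Lemma wgap_decr a b : a <= b -> wgap b <= wgap a.
Proof.
apply: locally_gauged_decr => t0; have [d d0 [D gD]] := gauge_exists t0.
exists d => //; exists D; split=> [s t *|s ps sq]; first by have [] := gD s t.
split=> F FU sF.
  have [k [de1 [k0 _ _ [hM _]]]] := wgap_deriv gD ps sq FU sF.
  exists (- k * det (r s) (e s) * gap_at s ^+ 2) => //.
  have [[_ _ _ p _] _ _ _ _] := frP s.
  rewrite !mulNr oppr_le0; apply: mulr_ge0 (sqr_ge0 _).
  by apply: mulr_ge0 => //; exact: ltW.
by have [l [hl ml _]] := wgap_left FU sF; exists l.
Qed.

(** A decreasing function of period [pi] is constant: a multiple of the period beyond [|t|] yields
    both inequalities. *)
Lemma wgap_const t : wgap t = wgap 0.
Proof.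
have pi0 := @pi_gt0 R.
have per k : wgap (t + pi *+ k) = wgap t /\ wgap (pi *+ k) = wgap 0.
  elim: k => [|k [IH1 IH2]]; first by rewrite mulr0n addr0.
  by rewrite mulrSr addrA !wgap_pi -{2}(add0r (pi *+ k)) add0r.
have [k hk] : exists k : nat, `|t| <= pi *+ k.
  exists (Num.bound (`|t| / pi)); rewrite -mulr_natr mulrC -ler_pdivrMr//.
  by apply/ltW/archi_boundP; rewrite divr_ge0// ltW.
have [h1 h2] := per k.
have := ler_norm t; have := ler_norm (- t); rewrite normrN => a b.
have A : wgap (pi *+ k) <= wgap t by apply: wgap_decr; lra.
have B : wgap (t + pi *+ k) <= wgap 0 by apply: wgap_decr; lra.
by apply/eqP; rewrite eq_le -{1}h1 B -h2 A.
Qed.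

(** The monotonicity criterion with the identity as gauge, applied to [f] and [- f]. *)
Lemma cst_of_local (f : R -> R) :
  (forall t0, exists2 d, 0 < d & forall s t, t0 - d < s -> s < t -> t < t0 + d -> f t = f s) ->
  forall a b, f a = f b.
Proof.
move=> H.
have H' (sg : R) a b : a <= b -> sg * f b <= sg * f a.
  apply: (@locally_gauged_decr _ (fun t => sg * f t)) => t0.
  have [d d0 hd] := H t0; exists d => //; exists id; split=> // s ps sq; split=> F FU sF;
  have FF : ProperFilter F by [exact: ultra_proper|].
    exists 0 => //; have u := at_right_from sF.
    apply: slim_eq (slim_cst 0); apply: filterS2 (proj1 u) (slim_lt (proj2 u) sq) => t st tq.
    by rewrite (hd s t)// subrr mulr0.
  exists (sg * f s) => //; have u := at_left_from sF.
  apply: slim_eq (slim_cst _); apply: filterS2 (proj1 u) (slim_gt (proj2 u) ps) => t st tq.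
  by rewrite (hd t s).
move=> a b; have [ab|/ltW ab] := leP a b.
  by apply/eqP; rewrite eq_le; have := H' 1 a b ab; have := H' (-1) a b ab; rewrite !mul1r !mulN1r lerN2 => -> ->.
by apply/eqP; rewrite eq_le; have := H' 1 b a ab; have := H' (-1) b a ab; rewrite !mul1r !mulN1r lerN2 => -> ->.
Qed.

(* Otherwise the curvature would vanish everywhere and the tangents would be constant. *)
Lemma wgap_zero : wgap 0 = 0.
Proof.
apply/eqP/negPn/negP => M0.
(* In the other alternative of [wgap_left] the constant value would be both at most and at least
   0. *)
have left s F (FU : UltraFilter F) (sF : F `=>` at_left s) : vlim F e (e s).
  have FF : ProperFilter F by exact: ultra_proper.
  have [l [hl ml [//|[m0 l0]]]] := wgap_left FU sF.
  have lM : l = wgap 0.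
    by apply: (slim_unique hl); apply: slim_eq (slim_cst (wgap 0)); apply: nearW => t; rewrite wgap_const.
  by move: M0; rewrite eq_le -{2}lM l0 -(wgap_const s) m0.
have right D p q s F : gauge_on D p q -> p < s -> s < q -> UltraFilter F -> F `=>` at_right s ->
    exists2 de1, visd (F := F) (fun t => D t - D s) e (e s) de1 & det de1 (e s) = 0.
  move=> gD ps sq FU sF; have FF : ProperFilter F by exact: ultra_proper.
  have [k [de1 [k0 hd kE hM]]] := wgap_deriv gD ps sq FU sF; exists de1 => //.
  have Z : - k * det (r s) (e s) * gap_at s ^+ 2 = 0.
    apply: (isd_unique (F := F) hM); apply: isd_eq (isd_cst _ (wgap 0)); last by rewrite wgap_const.
    by apply: nearW => t; rewrite wgap_const.
  have [[_ _ _ p4 _] _ _ _ _] := frP s.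
  have g0 : gap_at s != 0.
    by apply: contraNneq M0 => g0; rewrite -(wgap_const s) /wgap g0 mulr0.
  move/eqP: Z; rewrite expr2 !mulf_eq0 oppr_eq0 (gt_eqF p4) (negbTE g0) !orbF.
  by move=> /eqP k00; rewrite kE k00 oppr0 mul0r.
have loc t0 : exists2 d, 0 < d & forall s t, t0 - d < s -> s < t -> t < t0 + d -> e t = e s.
  have [d1 d10 [D gD]] := gauge_exists t0.
  have [c c0 hc] := supp_lower nn.
  have N2 : \forall t \near nbhs t0, n (r t0 - r t) < 1 / 2.
    apply: slim_lt (vlim_n nn (vlimB (vlim_cst (r t0)) (rlim rc t0))) _.
    by rewrite subrr (n0 nn); lra.
  have [d2 /= d20 h2] := N2.
  pose d := Num.min d1 d2.
  have d0 : 0 < d by rewrite lt_min d10.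
  have dd1 : d <= d1 by rewrite ge_min lexx.
  have dd2 : d <= d2 by rewrite ge_min lexx orbT.
  have pos t : t0 - d < t -> t < t0 + d -> 0 < det (r t0) (e t).
    move=> a b; have [a' b'] := shrink_ball dd2 a b.
    have k : n (r t0 - r t) < 1 / 2.
      by apply: h2; rewrite /ball /= ltr_distlC; apply/andP.
    have L := hc _ _ (r1 rc t) (tgc_supp nn rc t).
    have := proj2 (tgc_supp nn rc t) (r t0 - r t); rewrite (r1 rc) mulr1.
    have -> : det (r t0 - r t) (e t) = det (r t0) (e t) - det (r t) (e t).
      by rewrite /det !vE; ring.
    by rewrite ler_norml => /andP[k1 _]; exact: pos_of_close c0 L k k1.
  exists d => // s t as_ st tb.
  (* Up to the sign [sg], minus the cotangent of the angle from [r t0] to [e t]; it has zero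
     derivative and no jumps, so it is constant near [t0]. *)
  pose f (sg : R) t := sg * (det (rot (r t0)) (e t) / det (r t0) (e t)).
  have fD sg : f sg t <= f sg s.
    apply: (@gauged_decr _ (f sg) D (t0 - d) (t0 + d)) => //; last exact: ltW.
      move=> s' t' a b c'; have [a' _] := shrink_ball dd1 a (lt_trans b c').
      have [_ b'] := shrink_ball dd1 (lt_trans a b) c'.
      by have [] := gD s' t' a' b b'.
    move=> u pu uq; have [pu' uq'] := shrink_ball dd1 pu uq.
    have pu0 := pos u pu uq.
    split=> F FU sF; have FF : ProperFilter F by [exact: ultra_proper|].
      have [de hd de0] := right _ _ _ _ _ gD pu' uq' FU sF.
      have cs v : visd (F := F) (fun t => D t - D u) (fun=> v) v 0.
        split; last exact: vlim_cst.
        by apply: vlim_eq (vlim_cst 0); apply: nearW => t'; rewrite subrr scaler0.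
      have H := isdM (isd_cst (fun t => D t - D u) sg) (isdM (visd_det (cs (rot (r t0))) hd)
        (isdV (lt0r_neq0 pu0) (visd_det (cs (r t0)) hd))).
      have Z (w : V) : det 0 w = 0 by rewrite /det !vE; ring.
      exists 0 => //; move: H => [H _]; move: H; rewrite !Z !add0r mul0r add0r.
      suff -> : det (rot (r t0)) de * (det (r t0) (e u))^-1 +
          det (rot (r t0)) (e u) * (- det (r t0) de / det (r t0) (e u) ^+ 2) = 0.
        by rewrite mulr0.
      rewrite (quotient_rule _ _ (lt0r_neq0 pu0)).
      by rewrite de0 mulr0 mul0r.
    exists (f sg u) => //; apply: slimM; first exact: slim_cst.
    apply: slim_div; first exact: lt0r_neq0.
      exact: (vlim_det (vlim_cst _) (left u F FU sF)).
    exact: (vlim_det (vlim_cst _) (left u F FU sF)).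
  have fE : f 1 t = f 1 s.
    by apply/eqP; rewrite eq_le fD /=; have := fD (-1); rewrite /f !mulN1r !mul1r lerN2.
  have ps := pos s as_ (lt_trans st tb); have pt := pos t (lt_trans as_ st) tb.
  move: fE; rewrite /f !mul1r => /(eq_divP _ _ pt ps) fE.
  have r0 := sqr_sum_gt0 (r_neq0 nn rc t0).
  have d00 : det (e s) (e t) = 0.
    have := rot_slope fE.
    by move=> /eqP; rewrite mulf_eq0 (gt_eqF r0) => /eqP.
  have [//|eN] := unit_det0 nn (proj1 (tgc_supp nn rc s)) (proj1 (tgc_supp nn rc t)) d00.
  by move: pt; rewrite eN detrN oppr_gt0 => k; have := lt_trans k ps; rewrite ltxx.
(* Constant tangents contradict the change of sign of the tangent over a half turn. *)
have C1 : (e 0).1 = (e (0 + pi)).1.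
  apply: (cst_of_local (f := fun t => (e t).1)) => t0.
  by have [d d0 hd] := loc t0; exists d => // s t a b c; rewrite (hd s t).
have C2 : (e 0).2 = (e (0 + pi)).2.
  apply: (cst_of_local (f := fun t => (e t).2)) => t0.
  by have [d d0 hd] := loc t0; exists d => // s t a b c; rewrite (hd s t).
have := supp_neq0 nn (tgc_supp nn rc 0); apply/negP/negPn/eqP.
have eN := e_pi nn rc 0; rewrite eN opp1 in C1; rewrite eN opp2 in C2.
apply: vP; [rewrite zero1|rewrite zero2]; lra.
Qed.

Lemma gap_zero t : gap_at t = 0.
Proof. by apply: wgap_eq0; rewrite wgap_const wgap_zero. Qed.

(** [A w t] is the image of [w] under the linear map that carries the hexagon vertices x, z at
    parameter [t] to their images; by [stationary] and left continuity it does not depend on [t]. *)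
Lemma core_linear : exists a b c d : R, forall t,
  rho t = (a * (r t).1 + b * (r t).2, c * (r t).1 + d * (r t).2).
Proof.
pose A w t := (det w (r (h (h t))) / det (r t) (r (h (h t)))) *: rho t +
             (det (r t) w / det (r t) (r (h (h t)))) *: rho (h (h t)).
have xz t : 0 < det (r t) (r (h (h t))).
  have -> : det (r t) (r (h (h t))) = det (r t) (r (h t)).
    by rewrite (hex t) /det !vE; ring.
  exact: (rdet rc).
have Acst w t : A w t = A w 0.
  have aux (pr : V -> R) : (forall (c : R) v, pr (c *: v) = c * pr v) ->
      (forall v v', pr (v - v') = pr v - pr v') ->
      (forall T (F : set_system T) (u : T -> V) p, vlim F u p -> slim F (fun t => pr (u t)) (pr p)) ->
      pr (A w t) = pr (A w 0).
    move=> prZ prB prl.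
    have D (sg : R) a b : a <= b -> sg * pr (A w b) <= sg * pr (A w a).
      apply: (@locally_gauged_decr _ (fun t => sg * pr (A w t))) => t0.
      have [d d0 [D gD]] := gauge_exists t0.
      exists d => //; exists D; split=> [s' t' *|s ps sq]; first by have [] := gD s' t'.
      split=> F FU sF; have FF : ProperFilter F by [exact: ultra_proper|].
        exists 0 => //; have [H _] := stationary gD ps sq FU sF w (gap_zero s).
        have H' := slimM (FF := FF) (slim_cst (FF := FF) sg) (prl _ _ _ _ H).
        have p0 : pr 0 = 0 by rewrite -(scale0r 0) prZ mul0r.
        rewrite p0 mulr0 in H'; apply: slim_eq H'; apply: nearW => u.
        by rewrite prZ prB -/(A w u) -/(A w s); ring.
      exists (sg * pr (A w s)) => //; apply: slimM; first exact: slim_cst.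
      have u1 := at_left_from sF.
      have u2 := h_left (FF := FF) nn rc nl h_gt h_lt h_dist u1.
      have u3 := h_left (FF := FF) nn rc nl h_gt h_lt h_dist u2.
      have X1 := curve_lim rc (proj2 u1); have X3 := curve_lim rc (proj2 u3).
      have Y1 := curve_lim rhoc (proj2 u1); have Y3 := curve_lim rhoc (proj2 u3).
      have cw : vlim F (fun=> w) w by exact: vlim_cst.
      apply: prl; apply: vlimD; apply: vlimZ => //; apply: slim_div; rewrite ?lt0r_neq0//;
        exact: vlim_det.
    have [ab|/ltW ab] := leP 0 t.
      by apply/eqP; rewrite eq_le; have := D 1 0 t ab; have := D (-1) 0 t ab;
        rewrite !mul1r !mulN1r lerN2 => -> ->.
    by apply/eqP; rewrite eq_le; have := D 1 t 0 ab; have := D (-1) t 0 ab;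
      rewrite !mul1r !mulN1r lerN2 => -> ->.
  by apply: vP; [apply: aux|apply: aux] => // T F u p [].
(* The map at parameter [t] sends [r t] to [rho t], and it equals the map at parameter 0. *)
have AE t : rho t = A (r t) 0.
  rewrite -(Acst _ t) /A divff ?gt_eqF// scale1r.
  by have -> : det (r t) (r t) = 0 by [exact: detrr]; rewrite mul0r scale0r addr0.
have [x z] := (r 0, r (h (h 0))).
pose q := (det (r 0) (r (h (h 0))))^-1.
exists (q * ((r (h (h 0))).2 * (rho 0).1 - (r 0).2 * (rho (h (h 0))).1)).
exists (q * ((r 0).1 * (rho (h (h 0))).1 - (r (h (h 0))).1 * (rho 0).1)).
exists (q * ((r (h (h 0))).2 * (rho 0).2 - (r 0).2 * (rho (h (h 0))).2)).
exists (q * ((r 0).1 * (rho (h (h 0))).2 - (r (h (h 0))).1 * (rho 0).2)).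
move=> t; rewrite AE /A -/q; apply: vP; rewrite !vE /=.
  by rewrite /q; move: (det (r 0) _)^-1 => i; rewrite /det; ring.
by rewrite /q; move: (det (r 0) _)^-1 => i; rewrite /det; ring.
Qed.

End Core.

(** * Segments in the sphere *)

Lemma norm_combo_lt (R : realFieldType) (a v t i : R) :
  0 < a -> `|v| <= 1 -> 0 < t -> 0 < i -> i < 1 -> `|a * v + t * i| < a + t.
Proof.
move=> a0 v1 t0 i0 i1; apply: le_lt_trans (ler_normD _ _) _.
rewrite !normrM (gtr0_norm a0) (gtr0_norm t0) (gtr0_norm i0) ler_ltD//.
  by rewrite ger_pMr.
by rewrite gtr_pMr.
Qed.

Lemma interior_approx (R : realFieldType) (d l eps : R) : 0 < eps -> 0 < l -> 0 <= d -> d <= l ->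
  exists2 d', 0 < d' /\ d' < l & `|d - d'| <= eps.
Proof.
move=> e0 l0 d0 dl; pose m := Num.min eps (l / 4).
have m0 : 0 < m by rewrite lt_min e0; lra.
have ml : m <= l / 4 by rewrite ge_min lexx orbT.
have me : m <= eps by rewrite ge_min lexx.
have [h|h] := leP d (l / 2).
  by exists (d + m); [lra|rewrite opprD addrA subrr sub0r normrN gtr0_norm].
by exists (d - m); [lra|rewrite opprB addrCA subrr addr0 gtr0_norm].
Qed.

Section Segments.
Variables (R : realType) (n : R * R -> R).
Hypothesis nn : plane_norm n.
Local Notation V := (R * R)%type.
Implicit Types p q u w : V.

(** For [a <= b], the vector [b *: (p + q)] of norm [2 * b] is the sum of [a *: p + b *: q] and
    [(b - a) *: p]. *)
Lemma cone_add p q (a b : R) : n p = 1 -> n q = 1 -> n (p + q) = 2 -> 0 <= a -> 0 <= b ->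
  n (a *: p + b *: q) = a + b.
Proof.
wlog ab : p q a b / a <= b.
  move=> H p1 q1 pq a0 b0; have [ab|/ltW ba] := leP a b; first exact: H.
  by rewrite addrC [a + b]addrC; apply: H => //; rewrite addrC.
move=> p1 q1 pq a0 b0; apply/eqP; rewrite eq_le; apply/andP; split.
  by apply: le_trans (nD nn _ _) _; rewrite !(nZ nn) p1 q1 !ger0_norm// !mulr1.
have := nD nn (a *: p + b *: q) ((b - a) *: p).
have -> : a *: p + b *: q + (b - a) *: p = b *: (p + q) by apply: vP; rewrite !vE; ring.
have ba : 0 <= b - a by lra.
by rewrite !(nZ nn) p1 pq (ger0_norm b0) (ger0_norm ba); lra.
Qed.

Lemma line_convex p z (a b c : R) : a <= b -> b <= c ->
  n (p - b *: z) * (c - a) <= n (p - a *: z) * (c - b) + n (p - c *: z) * (b - a).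
Proof.
move=> ab bc; have ca : 0 <= c - a by rewrite subr_ge0 (le_trans ab).
have := nD nn ((c - b) *: (p - a *: z)) ((b - a) *: (p - c *: z)).
have -> : (c - b) *: (p - a *: z) + (b - a) *: (p - c *: z) = (c - a) *: (p - b *: z).
  by apply: vP; rewrite !vE; ring.
rewrite !(nZ nn) (ger0_norm ca) !ger0_norm ?subr_ge0// !(mulrC _ (n _)).
by [].
Qed.

(** A convex function that takes the value 1 at three points of a line is nowhere below 1 on it. *)
Lemma line_ge1 p z (d c : R) : 0 < d -> n p = 1 -> n (p - (d / 2) *: z) = 1 ->
  n (p - d *: z) = 1 -> 1 <= n (p - c *: z).
Proof.
move=> d0 p1 h1 d1; have [cd|cd] := leP c (d / 2).
  have h2 : d / 2 <= d by lra.
  by have := line_convex p z cd h2; rewrite h1 d1; nra.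
have h2 : 0 <= d / 2 by lra.
by have := line_convex p z h2 (ltW cd); rewrite h1 scale0r !subr0 p1; nra.
Qed.

Lemma line_last p z : n z = 1 -> n p <= 1 -> exists l : R,
  [/\ 0 <= l, n (p - l *: z) <= 1 & forall c, n (p - c *: z) <= 1 -> c <= l].
Proof.
move=> z1 p1; pose L : set R := [set c | n (p - c *: z) <= 1].
have L0 : L 0 by rewrite /L /= scale0r subr0.
have hL : has_ubound L.
  exists 2 => c; rewrite /L /= => h; have := nB nn p (p - c *: z).
  rewrite opprB addrCA subrr addr0 (nZ nn) z1 mulr1 => k.
  have := le_trans k (lerD p1 h); rewrite ler_norml => /andP[_].
  by rewrite -[1 + 1]/2.
have ub c : L c -> c <= sup L by move=> Lc; exact: ub_le_sup.
exists (sup L); split=> //; first exact: ub.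
have cl : closure L (sup L) by apply: closure_sup => //; exists 0.
rewrite leNgt; apply/negP => gt1.
have lim : slim (nbhs (sup L)) (fun c : R => n (p - c *: z)) (n (p - sup L *: z)).
  apply: (vlim_n nn); apply: vlimB (vlim_cst _) (vlimZ _ (vlim_cst _)).
  by split; exact: cvg_id.
by have [c [Lc]] := cl _ (slim_gt lim gt1); rewrite /= ltNge; move: Lc; rewrite /L /= => ->.
Qed.

(** The segment runs from [b] to [b - l *: z]; the last clause expresses maximality by requiring
    that the line of the segment leave the unit ball outside it. *)
Definition maxseg (b z : V) (l : R) :=
  [/\ n z = 1, 0 < l, forall c : R, 0 <= c -> c <= l -> n (b - c *: z) = 1
    & forall c : R, n (b - c *: z) <= 1 -> 0 <= c /\ c <= l].

(** The line through [p] and [q] is followed in both directions to the last point of the ball; by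
    [line_ge1] everything in between has norm exactly 1. *)
Lemma maxseg_exists p q : n p = 1 -> n q = 1 -> n (p + q) = 2 -> p != q ->
  exists (b z : V) (l c d : R), [/\ maxseg b z l, n (p - q) <= l,
    [/\ 0 <= c, c <= l & p = b - c *: z] & [/\ 0 <= d, d <= l & q = b - d *: z]].
Proof.
move=> p1 q1 pq npq; have d0 : 0 < n (p - q) by apply: (n_gt0 nn); rewrite subr_eq0.
have [d dE] : exists d, d = n (p - q) by eexists.
rewrite -dE in d0 *.
have [z zE] : exists z, z = d^-1 *: (p - q) by eexists.
have z1 : n z = 1 by rewrite zE (nZ nn) gtr0_norm ?invr_gt0// -dE mulVf// gt_eqF.
have qE : q = p - d *: z by rewrite zE scalerA divff ?gt_eqF// scale1r opprB addrC subrK.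
have mid : n (p - (d / 2) *: z) = 1.
  have -> : p - (d / 2) *: z = (1 / 2) *: p + (1 / 2) *: q.
    by rewrite qE; apply: vP; rewrite !vE; field.
  by rewrite cone_add//; lra.
have ge1 c : 1 <= n (p - c *: z) by apply: line_ge1 d0 p1 mid _; rewrite -qE.
have [u [u0 nu ulast]] : exists u : R,
    [/\ 0 <= u, n (p - u *: z) <= 1 & forall c, n (p - c *: z) <= 1 -> c <= u].
  by apply: line_last; rewrite ?p1.
have [v [v0 nv vlast]] : exists v : R,
    [/\ 0 <= v, n (p - v *: - z) <= 1 & forall c, n (p - c *: - z) <= 1 -> c <= v].
  by apply: line_last; rewrite ?p1 ?(nN nn).
have du : d <= u by apply: ulast; rewrite -qE q1.
rewrite scalerN -scaleNr in nv.
have le1 c : - v <= c -> c <= u -> n (p - c *: z) <= 1.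
  move=> vc cu; have uv : 0 < u - - v by lra.
  rewrite -(ler_pM2r uv) mul1r; apply: (le_trans (line_convex p z vc cu)).
  have k1 : n (p - (- v) *: z) * (u - c) <= 1 * (u - c) by apply: ler_wpM2r => //; lra.
  have k2 : n (p - u *: z) * (c - - v) <= 1 * (c - - v) by apply: ler_wpM2r => //; lra.
  by lra.
have sh c : p - (- v) *: z - c *: z = p - (c - v) *: z.
  by rewrite -addrA -opprD -scalerDl [- v + c]addrC.
have seg c : 0 <= c -> c <= v + u -> n (p - (- v) *: z - c *: z) = 1.
  by move=> c0 cl; apply/eqP; rewrite eq_le sh ge1 andbT le1//; lra.
exists (p - (- v) *: z), z, (v + u), v, (d + v); split.
- split=> //; first by lra.
  move=> c; rewrite sh => h; have := ulast _ h.
  by have := vlast (v - c); rewrite scalerN -scaleNr opprB => /(_ h); lra.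
- by lra.
- by split; [|lra|rewrite sh subrr scale0r subr0].
- by split; [lra|lra|rewrite sh addrK].
Qed.

Section OneSegment.
Variables (b z : V) (l : R).
Hypothesis ms : maxseg b z l.

Let z1 : n z = 1. Proof. by case: ms. Qed.
Let l0 : 0 < l. Proof. by case: ms. Qed.
Let seg c : 0 <= c -> c <= l -> n (b - c *: z) = 1. Proof. by case: ms => _ _ h _; exact: h. Qed.
Let smax c : n (b - c *: z) <= 1 -> 0 <= c /\ c <= l. Proof. by case: ms => _ _ _ h; exact: h. Qed.

Lemma b1 : n b = 1.
Proof. by have := seg (lexx 0) (ltW l0); rewrite scale0r subr0. Qed.

Lemma line_dist (s t : R) : n (b - s *: z - (b - t *: z)) = `|s - t|.
Proof.
have -> : b - s *: z - (b - t *: z) = (t - s) *: z by apply: vP; rewrite !vE; ring.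
by rewrite (nZ nn) z1 mulr1 distrC.
Qed.

Lemma line_ge c : 1 <= n (b - c *: z).
Proof.
have [h|h] := leP (n (b - c *: z)) 1; last exact: ltW.
by have [c0 cl] := smax h; rewrite seg.
Qed.

Lemma bz_neq0 : det b z != 0.
Proof.
have hl : l / 2 <= l by have := l0; lra.
have hl0 : 0 <= l / 2 by have := l0; lra.
apply/eqP => h; have [e|e] := unit_det0 nn b1 z1 h.
  have := seg (ltW l0) (lexx l); rewrite e -{1}(scale1r b) -scalerBl (nZ nn) b1 mulr1.
  have := seg hl0 hl; rewrite e -{1}(scale1r b) -scalerBl (nZ nn) b1 mulr1.
  have := l0; move: (l) => {h e}t t0 k' k.
  move: k k'; have [|] := leP 0 (1 - t); have [|] := leP 0 (1 - t / 2) => h1 h2;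
    rewrite ?(ger0_norm h1) ?(ltr0_norm h1) ?(ger0_norm h2) ?(ltr0_norm h2); lra.
have := seg (ltW l0) (lexx l); rewrite e scalerN opprK -{1}(scale1r b) -scalerDl (nZ nn) b1 mulr1.
by have := l0; move: (l) => {h e}t t0; rewrite gtr0_norm; lra.
Qed.

Lemma seg_coord w : exists v e : R, w = v *: b + e *: z.
Proof. by rewrite (vdecomp w bz_neq0); do 2!eexists. Qed.

(** The line of the segment supports the ball, and [v] is the height with respect to that line. *)
Lemma coord_ge (v e : R) : `|v| <= n (v *: b + e *: z).
Proof.
have [->|v0] := eqVneq v 0; first by rewrite normr0 n_ge0.
have -> : v *: b + e *: z = v *: (b - (- e / v) *: z) by apply: vP; rewrite !vE; field.
by rewrite (nZ nn) ler_peMr// line_ge.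
Qed.

Lemma coord_cone (v e : R) : 0 < v -> 0 <= - e -> - e <= v * l -> n (v *: b + e *: z) = v.
Proof.
move=> v0 e0 el.
have -> : v *: b + e *: z = v *: (b - (- e / v) *: z).
  by apply: vP; rewrite !vE; field; rewrite gt_eqF.
rewrite (nZ nn) gtr0_norm// seg ?mulr1//; first by apply: divr_ge0 => //; exact: ltW.
by rewrite ler_pdivrMr// mulrC.
Qed.

Lemma coord_cone_inv (v e : R) : 0 < v -> n (v *: b + e *: z) <= v -> 0 <= - e /\ - e <= v * l.
Proof.
move=> v0.
have -> : v *: b + e *: z = v *: (b - (- e / v) *: z).
  by apply: vP; rewrite !vE; field; rewrite gt_eqF.
rewrite (nZ nn) (gtr0_norm v0) => h.
have /smax[] : n (b - (- e / v) *: z) <= 1 by rewrite -(ler_pM2l v0) mulr1.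
by rewrite pmulr_lge0 ?invr_gt0// ler_pdivrMr// mulrC.
Qed.

(** By [cone_add] the combination of the two vectors that is proportional to [b] has norm [c + e];
    since it equals [(c * v + e) *: b], the height [v] must be 1. *)
Lemma seg_right (v e c : R) : 0 < e -> 0 < c -> c <= l -> n (v *: b + e *: z) = 1 ->
  n (v *: b + e *: z + (b - c *: z)) = 2 -> v = 1.
Proof.
move=> e0 c0 cl w1 h; have v1 : `|v| <= 1 by rewrite -w1 coord_ge.
have := cone_add w1 (seg (ltW c0) cl) h (ltW c0) (ltW e0).
have -> : c *: (v *: b + e *: z) + e *: (b - c *: z) = (c * v + e) *: b.
  by apply: vP; rewrite !vE; ring.
rewrite (nZ nn) b1 mulr1; move: v1; rewrite ler_norml => /andP[v1 v2].
have [h'|h'] := leP 0 (c * v + e); rewrite ?(ger0_norm h') ?(ltr0_norm h') => k; last by nra.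
by apply: (mulfI (lt0r_neq0 c0)); lra.
Qed.

Lemma seg_left (v e c : R) : e < - (v * l) -> 0 <= c -> c < l -> n (v *: b + e *: z) = 1 ->
  n (v *: b + e *: z + (b - c *: z)) = 2 -> v = 1.
Proof.
move=> e0 c0 cl w1 h; have v1 : `|v| <= 1 by rewrite -w1 coord_ge.
have c'0 : 0 < l - c by lra.
have e'0 : 0 < - (e + v * l) by lra.
have := cone_add w1 (seg c0 (ltW cl)) h (ltW c'0) (ltW e'0).
have -> : (l - c) *: (v *: b + e *: z) + (- (e + v * l)) *: (b - c *: z) =
    ((l - c) * v - (e + v * l)) *: (b - l *: z).
  by apply: vP; rewrite !vE; ring.
rewrite (nZ nn) seg ?mulr1//; last exact: ltW.
move: v1; rewrite ler_norml => /andP[v1 v2].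
have [h'|h'] := leP 0 ((l - c) * v - (e + v * l));
  rewrite ?(ger0_norm h') ?(ltr0_norm h') => k; last by nra.
by apply: (mulfI (lt0r_neq0 c'0)); lra.
Qed.

(** A sum of norm 2 only says that two points share a segment, which at an end of this one could be
    a neighbouring segment. One witness different from each end excludes that. *)
Lemma seg_mem w : n w = 1 ->
  (exists c, [/\ 0 < c, c <= l & n (w + (b - c *: z)) = 2]) ->
  (exists c, [/\ 0 <= c, c < l & n (w + (b - c *: z)) = 2]) ->
  exists c, [/\ 0 <= c, c <= l & w = b - c *: z].
Proof.
have [v [e ->]] := seg_coord w => w1 [c [c0 cl hc]] [d [d0 dl hd]].
have v1 : v = 1.
  have [e0|e0] := ltP 0 e; first exact: seg_right hc.
  have [el|el] := ltP e (- (v * l)); first exact: seg_left hd.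
  have [v0|v0] := ltP 0 v; first by rewrite -w1 coord_cone//; lra.
  have vl : v * l <= 0 by nra.
  have e00 : e = 0 by lra.
  have vl0 : v * l = 0 by lra.
  move/eqP: vl0; rewrite mulf_eq0 (gt_eqF l0) orbF => /eqP v00.
  by move: w1; rewrite e00 v00 !scale0r addr0 (n0 nn); lra.
have E : v *: b + e *: z = b - (- e) *: z by rewrite v1 scale1r scaleNr opprK.
rewrite E in w1 *; have [|k1 k2] := smax (c := - e); first by rewrite w1.
by exists (- e).
Qed.

(** A point of the sphere slightly beyond the end [b]: the normalization of [b + eps *: z], of norm
    above 1 by maximality. The factor 8 leaves room for the error [4 * eps] in
    [seg_not_reversed]. *)
Lemma past_end : exists i eps : R, [/\ l = 8 * eps, 0 < i, i < 1, 1 - eps <= i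
  & n (i *: b + (i * eps) *: z) = 1].
Proof.
have l0' := l0; have [eps lE] : exists eps, l = 8 * eps by exists (l / 8); rewrite mulrC divfK.
have e0 : 0 < eps by lra.
have N1 : 1 < n (b + eps *: z).
  rewrite ltNge; apply/negP => h; have [] := smax (c := - eps); last by lra.
  by rewrite scaleNr opprK.
have Ne : n (b + eps *: z) <= 1 + eps.
  by apply: le_trans (nD nn _ _) _; rewrite (nZ nn) z1 b1 mulr1 gtr0_norm.
exists (n (b + eps *: z))^-1, eps; rewrite -scalerA -scalerDr (nZ nn).
move: (n (b + eps *: z)) N1 Ne => N N1 Ne; have N0 : 0 < N by lra.
split=> //; first by rewrite invr_gt0.
- by rewrite invf_lt1.
- by rewrite -[_^-1]mul1r ler_pdivlMr//; nra.
by rewrite gtr0_norm ?invr_gt0// mulVf// lt0r_neq0.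
Qed.

(** Such a [w] lies near the end [b - l *: z], so its [z]-coordinate [e2] is negative. [cone_add]
    then gives norm [i * eps - e2] to the combination of [w] and [v] proportional to [b], while its
    coefficient is strictly smaller because [i < 1]. *)
Lemma seg_not_reversed (i eps : R) w (v := i *: b + (i * eps) *: z) : l = 8 * eps ->
  0 < i -> i < 1 -> 1 - eps <= i -> n v = 1 ->
  n w = 1 -> n (w + v) = 2 -> n (w - (b - l *: z)) = n (v - b) -> False.
Proof.
move=> lE i0 i1 iE v1 w1 wv; have e0 : 0 < eps by have := l0; rewrite lE; lra.
have ie : 0 < i * eps by exact: mulr_gt0.
have vb : n (v - b) <= 2 * eps.
  have -> : v - b = (i - 1) *: b + (i * eps) *: z by rewrite /v; apply: vP; rewrite !vE; ring.
  apply: le_trans (nD nn _ _) _; rewrite !(nZ nn) b1 z1 !mulr1 (gtr0_norm ie).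
  rewrite ltr0_norm ?subr_lt0//; have : i * eps <= eps by rewrite ger_pMl// ltW.
  by lra.
have [v2 [e2 wE]] := seg_coord w; move=> hd; rewrite -hd in vb.
have wl : w - (b - l *: z) = (v2 - 1) *: b + (e2 + l) *: z.
  by rewrite wE; apply: vP; rewrite !vE; ring.
have hd' : `|v2 - 1| <= 2 * eps by apply: le_trans vb; rewrite wl coord_ge.
have e2l : `|e2 + l| <= 4 * eps.
  have := nB nn (w - (b - l *: z)) ((v2 - 1) *: b).
  by rewrite {1}wl addrC addKr !(nZ nn) z1 b1 !mulr1 => h; lra.
have v2l : `|v2| <= 1 by rewrite -w1 wE coord_ge.
have e2p : 0 < - e2 by move: e2l; rewrite ler_norml lE => /andP[_]; lra.
have := cone_add w1 v1 wv (ltW ie) (ltW e2p).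
have -> : (i * eps) *: w + (- e2) *: v = (i * eps * v2 + (- e2) * i) *: b.
  by rewrite wE /v; apply: vP; rewrite !vE; ring.
rewrite (nZ nn) b1 mulr1 => k.
by have := norm_combo_lt ie v2l e2p i0 i1; rewrite k ltxx.
Qed.

End OneSegment.

(** If [x] moved, [x] and [g x] would lie on a maximal segment, which [g] maps isometrically into
    itself. Then [g] fixes an end, hence the segment pointwise, or reverses the segment, against
    [seg_not_reversed]. *)
Lemma id_of_sum_norm2 (g : V -> V) : (forall u, n u = 1 -> n (g u) = 1) ->
  (forall u, n u = 1 -> n (g u + u) = 2) ->
  (forall u w, n u = 1 -> n w = 1 -> n (g u - g w) = n (u - w)) ->
  forall u, n u = 1 -> g u = u.
Proof.
move=> g1 g2 gi x x1; apply/eqP/negPn/negP => gx.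
have [b [z [l [_ [c [ms _ _ [c0 cl xE]]]]]]] := maxseg_exists (g1 x x1) x1 (g2 x x1) gx.
have [z1 l0 seg smax] := ms.
have bb := b1 ms.
have inS (d : R) : 0 < d -> d < l -> exists d', [/\ 0 <= d', d' <= l & g (b - d *: z) = b - (d' : R) *: z].
  move=> d0 dl; have u1 := seg d (ltW d0) (ltW dl).
  by apply: (seg_mem ms (g1 _ u1)); exists d; split; rewrite ?ltW//; exact: g2.
(* At an end of the segment the point is not itself a witness on both sides for [seg_mem]; its image
   is located by approximation from the interior. *)
have inS' (d : R) : 0 <= d -> d <= l -> exists d', [/\ 0 <= d', d' <= l & g (b - d *: z) = b - (d' : R) *: z].
  move=> d0 dl; have u1 := seg d d0 dl; have w1 := g1 _ u1.
  have [v [e wv]] := seg_coord ms (g (b - d *: z)).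
  have v1 : v = 1.
    apply/eqP; rewrite -subr_eq0 -normr_le0; apply/ler_addgt0Pr => eps e0.
    have [d' [d'0 d'l] hd] := interior_approx e0 l0 d0 dl.
    have [f [f0 fl hf]] := inS d' d'0 d'l.
    rewrite add0r; apply: (@le_trans _ _ (n (g (b - d *: z) - g (b - d' *: z)))).
      have -> : g (b - d *: z) - g (b - d' *: z) = (v - 1) *: b + (e + f) *: z.
        by rewrite hf wv; apply: vP; rewrite !vE; ring.
      exact: (coord_ge ms).
    by rewrite gi ?(line_dist ms)//; apply: seg; exact: ltW.
  have E : g (b - d *: z) = b - (- e) *: z by rewrite wv v1 scale1r scaleNr opprK.
  by have [|k1 k2] := smax (- e); [rewrite -E w1|exists (- e)].
have dist (d d' f f' : R) : 0 <= d -> d <= l -> 0 <= d' -> d' <= l ->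
    g (b - d *: z) = b - f *: z -> g (b - d' *: z) = b - f' *: z -> `|f - f'| = `|d - d'|.
  move=> *; have := gi (b - d *: z) (b - d' *: z).
  by rewrite (line_dist ms) => <-; rewrite ?seg// -(line_dist ms); congr (n (_ - _)).
have [be [be0 bel hb]] := inS' 0 (lexx 0) (ltW l0).
have [al [al0 all ha]] := inS' l (ltW l0) (lexx l).
have hab := dist 0 l be al (lexx 0) (ltW l0) (ltW l0) (lexx l) hb ha.
rewrite sub0r normrN (gtr0_norm l0) in hab.
have [bz|bz] : be = 0 \/ be = l.
  move: be0 bel al0 all hab; clear; have [h|h] := leP 0 (be - al);
    by rewrite ?(ger0_norm h) ?(ltr0_norm h); lra.
  have [c' [c'0 c'l hc]] := inS' c c0 cl.
  have := dist 0 c be c' (lexx 0) (ltW l0) c0 cl hb hc.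
  rewrite bz !sub0r !normrN !ger0_norm// => cE.
  by move/eqP: gx; apply; rewrite {2}xE {1}xE hc cE.
have b0 : n (b - 0 *: z) = 1 by rewrite seg// ltW.
have [i [eps [lE i0 i1 iE v1]]] := past_end ms.
apply: (seg_not_reversed ms lE i0 i1 iE v1 (g1 _ v1) (g2 _ v1)).
by have := gi _ _ v1 b0; rewrite hb bz scale0r subr0.
Qed.

End Segments.

(** * Preservation of antipodes *)

Section Antipodal.
Variables (R : realType) (n : R * R -> R) (Y : normedModType R) (F : R * R -> Y).
Hypothesis nn : plane_norm n.
Hypothesis F1 : forall p, n p = 1 -> `|F p| = 1.
Hypothesis Fdist : forall p q, n p = 1 -> n q = 1 -> `|F p - F q| = n (p - q).
Hypothesis Fonto : forall y, `|y| = 1 -> exists2 p, n p = 1 & F p = y.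

Lemma antipodal p : n p = 1 -> F (- p) = - F p.
Proof.
have /choice[g gP] (u : R * R) : exists w, n u = 1 -> n w = 1 /\ F w = - F (- u).
  (* The value 0 off the sphere is a default that makes [g] total. *)
  have [u1|u1] := eqVneq (n u) 1; last by exists 0 => h; rewrite h eqxx in u1.
  have [|w w1 Fw] := Fonto (y := - F (- u)); first by rewrite normrN F1// (nN nn).
  by exists w.
have gid : forall u, n u = 1 -> g u = u.
  apply: (id_of_sum_norm2 nn) => [u u1|u u1|u w u1 w1]; first by have [] := gP u u1.
    have [w1 Fw] := gP u u1.
    rewrite -[X in g u + X]opprK -Fdist ?(nN nn)// Fw -opprD normrN -mulr2n normrMn F1//.
    by rewrite (nN nn).
  have [gu1 Fgu] := gP u u1; have [gw1 Fgw] := gP w w1.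
  rewrite -Fdist// Fgu Fgw opprK addrC Fdist ?(nN nn)//.
  by rewrite opprK addrC.
move=> p1; have [_] := gP p p1; rewrite gid// => ->.
by rewrite opprK.
Qed.

End Antipodal.

(** * Coordinates read off from distances to a segment of length at least 1 *)

Section Heights.
Variables (R : realType) (n : R * R -> R) (b z : R * R) (l : R).
Hypotheses (nn : plane_norm n) (ms : maxseg n b z l) (l1 : 1 <= l).

Lemma coord_bounds (v e : R) : n (v *: b + e *: z) = 1 ->
  [/\ `|v| <= 1, `|e| <= 1 + `|v| & `|e + v * l| <= 1 + `|v|].
Proof.
move=> p1; have [z1 l0 seg _] := ms; split; first by rewrite -p1 (coord_ge nn ms).
  have := nB nn (v *: b + e *: z) (v *: b).
  by rewrite addrC addKr !(nZ nn) z1 (b1 ms) p1 !mulr1.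
have := nB nn (v *: b + e *: z) (v *: (b - l *: z)).
have -> : v *: b + e *: z - v *: (b - l *: z) = (e + v * l) *: z by apply: vP; rewrite !vE; ring.
by rewrite !(nZ nn) z1 p1 seg ?mulr1// ltW.
Qed.

Lemma shiftE (v e c : R) : v *: b + e *: z + (b - c *: z) = (1 + v) *: b + (e - c) *: z.
Proof. by apply: vP; rewrite !vE; ring. Qed.

Lemma height_ge (v e c : R) : 0 <= v -> 1 + v <= n (v *: b + e *: z + (b - c *: z)).
Proof.
by move=> v0; rewrite shiftE; apply: le_trans (coord_ge nn ms _ _); rewrite ler_norm.
Qed.

(** Together with [height_ge]: for [v >= 0] the smallest norm of a sum with a point of the segment
    is [1 + v]. A suitable [c] moves the sum into the cone over the segment, and [l >= 1] ensures
    that some [c] in [[0, l]] does so. *)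
Lemma height_attained (v e : R) : 0 <= v -> n (v *: b + e *: z) = 1 ->
  exists c, [/\ 0 <= c, c <= l & n (v *: b + e *: z + (b - c *: z)) = 1 + v].
Proof.
move=> v0 p1; have l1' := l1; have [_] := coord_bounds p1; rewrite (ger0_norm v0) => he /le_trans h.
have {h} := h _ (lexx _); rewrite ler_norml => /andP[_ hl]; move: he; rewrite ler_norml => /andP[he _].
have v1 : 0 < 1 + v by lra.
have vl : v <= v * l by rewrite ler_peMr.
have vl1 : 1 + v <= (1 + v) * l by rewrite ler_peMr// ltW.
have [e0|e0] := leP 0 e.
  exists e; split=> //; first by lra.
  by rewrite shiftE subrr (coord_cone nn ms)// ?oppr0//; apply: mulr_ge0; lra.
exists 0; split=> //; first by lra.
by rewrite shiftE subr0 (coord_cone nn ms)//; lra.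
Qed.

(** This separates [v <= 0] from [v > 0], where [height_ge] keeps all these norms above 1. *)
Lemma height_le1 (v e : R) : v <= 0 -> n (v *: b + e *: z) = 1 ->
  exists c, [/\ 0 <= c, c <= l & n (v *: b + e *: z + (b - c *: z)) <= 1].
Proof.
move=> v0 p1; have l1' := l1; have [z1 l0 seg _] := ms; have [] := coord_bounds p1.
rewrite (ler0_norm v0) => hv; rewrite !ler_norml => /andP[he1 he2] /andP[hl1 hl2].
have v1 : 0 <= 1 + v by lra.
have vl : v * l <= 0 by rewrite mulr_le0_ge0// ltW.
have [e0|e0] := leP 0 e.
  have [el|el] := leP e l.
    exists e; split=> //; rewrite shiftE subrr scale0r addr0 (nZ nn) (b1 ms) mulr1 ger0_norm//; lra.
  exists l; split=> //; first exact: ltW.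
  rewrite shiftE; apply: le_trans (nD nn _ _) _; rewrite !(nZ nn) (b1 ms) z1 !mulr1 (ger0_norm v1).
  by rewrite ger0_norm; lra.
have E c : (1 + v) *: b + (e - c) *: z =
    (1 + v) *: (b - l *: z) + (e + v * l + l - c) *: z by apply: vP; rewrite !vE; ring.
have [el|el] := leP (- e - v * l) l.
  exists (l - (- e - v * l)); split; [lra|lra|].
  rewrite shiftE E; have -> : e + v * l + l - (l - (- e - v * l)) = 0 by ring.
  by rewrite scale0r addr0 (nZ nn) seg ?mulr1 ?ger0_norm//; lra.
exists 0; split=> //; first exact: ltW.
rewrite shiftE E; apply: le_trans (nD nn _ _) _; rewrite !(nZ nn) z1 seg//; last exact: ltW.
by rewrite !mulr1 (ger0_norm v1) ler0_norm; lra.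
Qed.

(* In the range [-1 < v <= 0] these c form the interval [max 0 (- e), min l ((1 - v) l - e)],
   one end of which always determines e. *)
Lemma depth_iff (v e c : R) : v <= 0 ->
  n (v *: b + e *: z - (b - c *: z)) = 1 - v <-> 0 <= e + c /\ e + c <= (1 - v) * l.
Proof.
move=> v0; have w0 : 0 < 1 - v by lra.
have -> : v *: b + e *: z - (b - c *: z) = - ((1 - v) *: b + (- (e + c)) *: z).
  by apply: vP; rewrite !vE; ring.
rewrite (nN nn); split=> [h|[h1 h2]].
  have [] := coord_cone_inv nn ms (v := 1 - v) (e := - (e + c)) w0; first by rewrite h.
  by rewrite opprK.
by apply: (coord_cone nn ms) => //; rewrite opprK.
Qed.

(** The two cases say which end of the interval of [depth_iff] falls inside [[0, l]] and reveals
    [e]. In the remaining case the negative of the vector would lie in the cone over the segment and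
    have norm [- v < 1]. *)
Lemma abscissa_range (v e : R) : -1 < v -> v <= 0 -> n (v *: b + e *: z) = 1 ->
  (- l <= e /\ e < 0) \/ (- (v * l) < e /\ e <= (1 - v) * l).
Proof.
move=> v1 v0 p1; have l1' := l1; have [z1 l0 seg _] := ms; have [] := coord_bounds p1.
rewrite (ler0_norm v0) => hv; rewrite !ler_norml => /andP[he1 he2] /andP[hl1 hl2].
have vl : v * l <= v by rewrite ler_neMr.
have w0 : 0 < 1 - v by lra.
have wl : 1 - v <= (1 - v) * l by rewrite ler_peMr// ltW.
have [e0|e0] := ltP e 0; first by left; lra.
have [e1|e1] := ltP (- (v * l)) e; first by right; lra.
exfalso; have [ve|ve] := eqVneq v 0.
  have e00 : e = 0 by move: e1; rewrite ve mul0r oppr0 => e1; apply/eqP; rewrite eq_le e1 e0.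
  by move: p1; rewrite ve e00 !scale0r addr0 (n0 nn) => /esym /eqP; rewrite oner_eq0.
have vp : 0 < - v by rewrite oppr_gt0 lt_neqAle ve.
have := coord_cone nn ms (v := - v) (e := - e) vp; rewrite opprK mulNr => /(_ e0 e1).
by rewrite !scaleNr -opprD (nN nn) p1 => h; lra.
Qed.

End Heights.

Section TwoSegments.
Variables (R : realType) (n m : R * R -> R) (b z b' z' : R * R) (l : R).
Hypotheses (nn : plane_norm n) (mm : plane_norm m).
Hypotheses (ms : maxseg n b z l) (ms' : maxseg m b' z' l) (l1 : 1 <= l).

Lemma height_mono (v e v' e' : R) : n (v *: b + e *: z) = 1 -> m (v' *: b' + e' *: z') = 1 ->
  (forall c, 0 <= c -> c <= l ->
    n (v *: b + e *: z + (b - c *: z)) = m (v' *: b' + e' *: z' + (b' - c *: z'))) ->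
  0 < v -> v <= v'.
Proof.
move=> p1 p1' H v0; have [v'0|v'0] := leP v' 0.
  have [c [c0 cl]] := height_le1 mm ms' l1 v'0 p1'; rewrite -H//.
  by have := height_ge nn ms e c (ltW v0); lra.
have [c [c0 cl]] := height_attained mm ms' l1 (ltW v'0) p1'; rewrite -H//.
by have := height_ge nn ms e c (ltW v0); lra.
Qed.

Lemma abscissa_eq (v e e' : R) : -1 < v -> v <= 0 ->
  n (v *: b + e *: z) = 1 -> m (v *: b' + e' *: z') = 1 ->
  (forall c, 0 <= c -> c <= l ->
    n (v *: b + e *: z - (b - c *: z)) = m (v *: b' + e' *: z' - (b' - c *: z'))) ->
  e = e'.
Proof.
move=> v1 v0 p1 p1' H.
have {}H c : 0 <= c -> c <= l -> (0 <= e + c /\ e + c <= (1 - v) * l) <->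
    (0 <= e' + c /\ e' + c <= (1 - v) * l).
  by move=> c0 cl; rewrite -(depth_iff nn ms)// -(depth_iff mm ms')// H.
have l0 : 0 < l by have := l1; lra.
have vl : v * l <= 0 by rewrite mulr_le0_ge0// ltW.
have H0 := H 0 (lexx 0) (ltW l0); have Hl := H l (ltW l0) (lexx l).
have := abscissa_range nn ms l1 v1 v0 p1; have := abscissa_range mm ms' l1 v1 v0 p1'.
move: H H0 Hl; rewrite mulrBl mul1r; move: (v * l) vl => t t0 {p1 p1'} H H0 Hl.
case=> [[e1' e2']|[e1' e2']] [[e1 e2]|[e1 e2]].
(* The sets of admissible [c] are compared at their lower ends here, and at their upper ends in the
   last case. *)
- have := H (- e); have := H (- e'); lra.
- exfalso; lra.
- exfalso; lra.
have := H (l - t - e); have := H (l - t - e'); lra.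
Qed.

End TwoSegments.

(** [height_mono] compares heights only when the first is positive; applied to a vector and its
    negative, in both directions, it provides these four implications. *)
Lemma sign_mono_eq (R : realDomainType) (v w : R) : (0 < v -> v <= w) -> (v < 0 -> w <= v) ->
  (0 < w -> w <= v) -> (w < 0 -> v <= w) -> v = w.
Proof.
move=> a1 a2 a3 a4; apply/eqP; rewrite eq_le; apply/andP; split.
  have [/a1//|v0] := ltP 0 v; have [/a4//|w0] := ltP w 0; exact: le_trans v0 w0.
have [/a3//|w0] := ltP 0 w; have [/a2//|v0] := ltP v 0; exact: le_trans w0 v0.
Qed.

Section LongSegment.
Variables (R : realType) (n m : R * R -> R) (g : R * R -> R * R).
Hypotheses (nn : plane_norm n) (mm : plane_norm m).
Hypothesis g1 : forall p, n p = 1 -> m (g p) = 1.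
Hypothesis gdist : forall p q, n p = 1 -> n q = 1 -> m (g p - g q) = n (p - q).
Hypothesis gonto : forall q, m q = 1 -> exists2 p, n p = 1 & g p = q.
Hypothesis gN : forall p, n p = 1 -> g (- p) = - g p.

Lemma gsum p q : n p = 1 -> n q = 1 -> m (g p + g q) = n (p + q).
Proof. by move=> p1 q1; rewrite -[g q]opprK -gN// gdist ?(nN nn)// opprK. Qed.

Variables (b z : R * R) (l : R).
Hypothesis ms : maxseg n b z l.

Let z' := l^-1 *: (g b - g (b - l *: z)).

(** A point of the image line inside the ball has norm 1, and its preimage has sums of norm 2 with
    both ends of the segment, so [seg_mem] places it on the segment. The distances to the two ends
    identify its parameter. *)
Lemma image_seg : maxseg m (g b) z' l /\
  forall c, 0 <= c -> c <= l -> g (b - c *: z) = g b - c *: z'.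
Proof.
have [z1 l0 seg smax] := ms; have n_b := b1 ms.
have nl := seg l (ltW l0) (lexx l).
have z'1 : m z' = 1.
  rewrite /z' (nZ mm) gdist// opprB addrCA subrr addr0 (nZ nn) z1 mulr1.
  by rewrite gtr0_norm ?invr_gt0// gtr0_norm// mulVf// lt0r_neq0.
have gl : g (b - l *: z) = g b - l *: z'.
  by rewrite /z' scalerA divff ?lt0r_neq0// scale1r opprB addrCA subrr addr0.
have mb := g1 n_b; have ml := g1 nl; rewrite gl in ml.
have half0 : 0 <= l / 2 by lra.
have halfl : l / 2 <= l by lra.
(* The norm of the sum of the ends is preserved, so the image midpoint is on the sphere, as
   [line_ge1] requires. *)
have mh : m (g b - (l / 2) *: z') = 1.
  have := gsum n_b nl; rewrite gl.
  have -> : g b + (g b - l *: z') = 2 *: (g b - (l / 2) *: z').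
    by move: (g b) z' => u w; apply: vP; rewrite !vE; field.
  have -> : b + (b - l *: z) = 2 *: (b - (l / 2) *: z) by apply: vP; rewrite !vE; field.
  rewrite (nZ nn) (nZ mm) seg// => h; apply: (@mulfI _ `|2|) => //.
  by rewrite normr_eq0.
have ge1 c : 1 <= m (g b - c *: z') by exact: (line_ge1 mm c l0 mb mh ml).
have key c : m (g b - c *: z') <= 1 -> [/\ 0 <= c, c <= l & g (b - c *: z) = g b - c *: z'].
  move=> cle; have c1 : m (g b - c *: z') = 1 by apply/eqP; rewrite eq_le cle ge1.
  have mid d : m (g b - d *: z') = 1 -> m (g b - c *: z' + (g b - d *: z')) = 2.
    move=> d1; apply/eqP; rewrite eq_le; apply/andP; split.
      by apply: le_trans (nD mm _ _) _; rewrite c1 d1.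
    have -> : g b - c *: z' + (g b - d *: z') = 2 *: (g b - ((c + d) / 2) *: z').
      by move: (g b) z' => u w; apply: vP; rewrite !vE; field.
    by rewrite (nZ mm) ger0_norm// ler_peMr.
  have [w w1 gw] := gonto c1.
  have [||c' [c'0 c'l wE]] := seg_mem nn ms w1.
  - by exists l; split=> //; rewrite -gsum// gw gl mid.
  - exists 0; split=> //; rewrite scale0r subr0 -gsum// gw.
    have e0 : g b - 0 *: z' = g b by rewrite scale0r subr0.
    by have := mid 0; rewrite e0 => /(_ mb).
  have e0 : `|c| = c'.
    have sub (x y : R * R) : x - y - x = - y by rewrite addrAC subrr sub0r.
    have := gdist w1 n_b; rewrite gw wE !sub (nN nn) (nN mm) (nZ nn) (nZ mm).
    by rewrite z1 z'1 !mulr1 (ger0_norm c'0).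
  have e1 : `|c - l| = l - c'.
    have := gdist w1 nl; rewrite gw gl wE (line_dist nn ms).
    have -> : g b - c *: z' - (g b - l *: z') = (l - c) *: z'.
      by move: (g b) z' => u v; apply: vP; rewrite !vE; ring.
    by rewrite (nZ mm) z'1 mulr1 distrC => ->; rewrite ler0_norm; lra.
  have cE : c = c'.
    have [h|h] := leP 0 c; first by rewrite -e0 ger0_norm.
    by move: e0 e1; rewrite ltr0_norm// ltr0_norm; lra.
  by split; rewrite cE// -wE gw cE.
have on c : 0 <= c -> c <= l -> m (g b - c *: z') <= 1.
  move=> c0 cl; have := line_convex mm (g b) z' c0 cl.
  by rewrite scale0r !subr0 mb ml !mul1r subrK ger_pMl.
split=> [|c c0 cl]; last by have [] := key c (on c c0 cl).
split=> //.
- by move=> c c0 cl; apply/eqP; rewrite eq_le ge1 on.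
- by move=> c /key[].
Qed.

Lemma long_segment_coord (l1 : 1 <= l) v e : n (v *: b + e *: z) = 1 ->
  g (v *: b + e *: z) = v *: g b + e *: z'.
Proof.
have [ms' gz] := image_seg; have [z1 l0 seg _] := ms.
have half p : n p = 1 -> exists v' e', g p = v' *: g b + e' *: z'.
  by move=> _; have [v' [e' ->]] := seg_coord mm ms' (g p); exists v', e'.
have dist p c : n p = 1 -> 0 <= c -> c <= l ->
    n (p - (b - c *: z)) = m (g p - (g b - c *: z')).
  by move=> p1 c0 cl; rewrite -gz// gdist// seg.
have sum p c : n p = 1 -> 0 <= c -> c <= l ->
    n (p + (b - c *: z)) = m (g p + (g b - c *: z')).
  by move=> p1 c0 cl; rewrite -gz// gsum// seg.
have opp s t (u w : R * R) : (- s) *: u + (- t) *: w = - (s *: u + t *: w).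
  by rewrite !scaleNr opprD.
have same v1 e1 v2 e2 : n (v1 *: b + e1 *: z) = 1 -> g (v1 *: b + e1 *: z) = v2 *: g b + e2 *: z' ->
    v1 = v2.
  move=> p1 gp; have q1 := g1 p1; rewrite gp in q1.
  have p1N : n ((- v1) *: b + (- e1) *: z) = 1 by rewrite opp (nN nn).
  have q1N : m ((- v2) *: g b + (- e2) *: z') = 1 by rewrite opp (nN mm).
  have gpN : g ((- v1) *: b + (- e1) *: z) = (- v2) *: g b + (- e2) *: z'.
    by rewrite !opp gN// gp.
  have H c c0 cl := sum _ c p1 c0 cl; have HN c c0 cl := sum _ c p1N c0 cl.
  rewrite gp in H; rewrite gpN in HN.
  have a1 := height_mono nn mm ms ms' l1 p1 q1 H.
  have a2 := height_mono nn mm ms ms' l1 p1N q1N HN.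
  have a3 := height_mono mm nn ms' ms l1 q1 p1 (fun c c0 cl => esym (H c c0 cl)).
  have a4 := height_mono mm nn ms' ms l1 q1N p1N (fun c c0 cl => esym (HN c c0 cl)).
  by apply: sign_mono_eq a1 _ a3 _ => h; rewrite -lerN2; [apply: a2|apply: a4]; rewrite oppr_gt0.
wlog v0 : v e / v <= 0 => [H p1|p1].
  have [v0|/ltW v0] := leP v 0; first exact: H.
  have p1N : n ((- v) *: b + (- e) *: z) = 1 by rewrite opp (nN nn).
  have := H (- v) (- e) _ p1N; rewrite oppr_le0 => /(_ v0).
  by rewrite !opp gN// => /oppr_inj.
have [v' [e' gp]] := half _ p1; have vv := same _ _ _ _ p1 gp; rewrite -vv in gp.
have vm1 : -1 <= v by have [+ _ _] := coord_bounds nn ms p1; rewrite (ler0_norm v0); lra.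
(* Height -1 means that the opposite point lies on the segment itself, where [image_seg] gives the
   image directly. *)
move: vm1; rewrite le_eqVlt => /predU1P[vE|vm1].
  have ee : v *: b + e *: z = - (b - e *: z) by rewrite -vE scaleN1r opprB addrC.
  have p1' : n (b - e *: z) = 1 by rewrite -(nN nn) -ee.
  have [_ _ _ smax] := ms; have [|e0 el] := smax e; first by rewrite p1'.
  by rewrite ee gN// gz// -vE scaleN1r opprB addrC.
have q1 := g1 p1; rewrite gp in q1.
have H c c0 cl := dist _ c p1 c0 cl; rewrite gp in H.
by rewrite gp -(abscissa_eq nn mm ms ms' l1 vm1 v0 p1 q1 H).
Qed.

Lemma long_segment_linear : 1 <= l -> exists a b c d : R, forall p, n p = 1 ->
  g p = (a * p.1 + b * p.2, c * p.1 + d * p.2).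
Proof.
move=> l1; have bz := bz_neq0 nn ms.
exists ((z.2 * (g b).1 - b.2 * z'.1) / det b z), ((b.1 * z'.1 - z.1 * (g b).1) / det b z),
  ((z.2 * (g b).2 - b.2 * z'.2) / det b z), ((b.1 * z'.2 - z.1 * (g b).2) / det b z) => p.
rewrite {1 2}(vdecomp p bz) => /(long_segment_coord l1) ->.
by move: (g b) z' bz => u w; rewrite /det => bz; apply: vP; rewrite !vE /=; field.
Qed.

End LongSegment.

(** * Reduction to the plane *)

Lemma mix_gt0 (R : realFieldType) (x a b : R) : 0 <= x -> x <= 1 -> 0 < a -> 0 < b ->
  0 < (1 - x) * a + x * b.
Proof. by move=> x0 x1 a0 b0; have [h|h] := leP x (1 / 2); nra. Qed.

Lemma nonvanishing_gt0 (R : realType) (f : R -> R) (a b : R) : a <= b ->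
  (forall t, slim (nbhs t) f (f t)) -> (forall t, a <= t -> t <= b -> f t <> 0) ->
  0 < f a -> 0 < f b.
Proof.
move=> ab fc f0 fa; rewrite ltNge; apply/negP => fb.
have [||t] := @IVT R f a b 0 ab.
- by apply: continuous_subspaceT => t; have [] := fc t.
- by rewrite ge_min le_max fb (ltW fa) orbT.
by rewrite in_itv /= => /andP[ta tb]; exact: f0.
Qed.

Section PolarCurve.
Variables (R : realType) (n : R * R -> R).
Hypothesis nn : plane_norm n.

Definition circle (t : R) : R * R := (cos t, sin t).
Definition polar (t : R) : R * R := (n (circle t))^-1 *: circle t.

Lemma n_circle_gt0 t : 0 < n (circle t).
Proof.
apply: (n_gt0 nn); apply/eqP => [[c s]].
by have := cos2Dsin2 t; rewrite c s expr0n addr0 => /esym/eqP; rewrite oner_eq0.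
Qed.

Lemma circle_lim t : vlim (nbhs t) circle (circle t).
Proof. by split; split; [exact: continuous_cos|exact: continuous_sin]. Qed.

Lemma polar_curve : unit_curve n polar.
Proof.
split=> [t|t|s t st ts|t].
- by rewrite /polar (nZ nn) gtr0_norm ?invr_gt0 ?n_circle_gt0// mulVf// lt0r_neq0// n_circle_gt0.
- have -> : polar (t + pi) = (n (- circle t))^-1 *: (- circle t).
    by rewrite /polar /circle cosDpi sinDpi.
  by rewrite (nN nn) scalerN.
- have -> : det (polar s) (polar t) = (n (circle s))^-1 * (n (circle t))^-1 * sin (t - s).
    by rewrite sinB /polar /det !vE /=; ring.
  rewrite mulr_gt0 ?mulr_gt0 ?invr_gt0 ?n_circle_gt0//.
  by apply: sin_gt0_pi; apply/andP; split; lra.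
- apply: vlimZ; last exact: circle_lim.
  by apply: slimV; [exact/lt0r_neq0/n_circle_gt0|exact: (vlim_n nn (circle_lim t))].
Qed.

End PolarCurve.

Section SphereMap.
Variables (R : realType) (n m : R * R -> R) (g : R * R -> R * R).
Hypotheses (nn : plane_norm n) (mm : plane_norm m).
Hypothesis g1 : forall p, n p = 1 -> m (g p) = 1.
Hypothesis gdist : forall p q, n p = 1 -> n q = 1 -> m (g p - g q) = n (p - q).
Hypothesis gN : forall p, n p = 1 -> g (- p) = - g p.

Lemma image_det_neq0 (p q : R * R) : n p = 1 -> n q = 1 -> det p q <> 0 -> det (g p) (g q) <> 0.
Proof.
move=> p1 q1 pq h; apply: pq.
have inj u w : n u = 1 -> n w = 1 -> g u = g w -> u = w.
  move=> u1 w1 e; have := gdist u1 w1; rewrite e subrr (n0 mm) => /esym h0.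
  by case: nn => _ _ def; apply/eqP; rewrite -subr_eq0; apply/eqP/def.
have [e|e] := unit_det0 mm (g1 p1) (g1 q1) h; first by rewrite (inj _ _ q1 p1 e) detrr.
rewrite -gN// in e; rewrite (inj _ _ q1 _ e) ?(nN nn)//.
by rewrite detrN detrr oppr0.
Qed.

(** The pairs [(s, t)] with [s < t < s + pi] form a convex set on which the determinant of the
    images never vanishes; its sign is carried along a straight path from the pair [(t0, t1)]. *)
Lemma image_curve (r : R -> R * R) : unit_curve n r -> (exists t0 t1, [/\ t0 < t1, t1 < t0 + pi &
  0 < det (g (r t0)) (g (r t1))]) -> unit_curve m (g \o r).
Proof.
move=> rc [t0 [t1 [t01 t10 pos]]]; have r1 := r1 rc.
have lim t : vlim (nbhs t) (g \o r) (g (r t)).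
  apply: (vlim_dist mm); apply: slim_eq (_ : slim (nbhs t) (fun s => n (r s - r t)) 0).
    by apply: nearW => s /=; rewrite gdist.
  rewrite -(n0 nn) -(subrr (r t)).
  exact: (vlim_n nn (vlimB (rlim rc t) (vlim_cst (r t)))).
split=> [t|t|s t st ts|t //]; first exact: g1.
  by rewrite /= (rpi rc) gN.
pose a x := t0 + x * (s - t0); pose b x := t1 + x * (t - t1).
have alim (x u v : R) : slim (nbhs x) (fun x => u + x * v) (u + x * v).
  by apply: slimD (slim_cst _) (slimM _ (slim_cst _)); split; exact: cvg_id.
have := @nonvanishing_gt0 R (fun x => det (g (r (a x))) (g (r (b x)))) 0 1 ler01.
rewrite /a /b !mul0r !mul1r !addr0 !subrKC => H; apply: H => //.
  move=> x; apply: vlim_det; last exact: (vlim_comp (alim x _ _) (lim _)).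
  exact: (vlim_comp (alim x _ _) (lim _)).
move=> x x0 x1; apply: image_det_neq0 => //; apply/eqP/lt0r_neq0/(rdet rc).
  rewrite -subr_gt0; have -> : t1 + x * (t - t1) - (t0 + x * (s - t0)) =
    (1 - x) * (t1 - t0) + x * (t - s) by ring.
  by apply: mix_gt0 => //; rewrite subr_gt0.
rewrite -subr_gt0; have -> : t0 + x * (s - t0) + pi - (t1 + x * (t - t1)) =
  (1 - x) * (t0 + pi - t1) + x * (s + pi - t) by ring.
by apply: mix_gt0 => //; rewrite subr_gt0.
Qed.

Lemma nolong_linear : nolong n -> (exists t0 t1, [/\ t0 < t1, t1 < t0 + pi &
  0 < det (g (polar n t0)) (g (polar n t1))]) -> exists a b c d : R, forall p, n p = 1 ->
  g p = (a * p.1 + b * p.2, c * p.1 + d * p.2).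
Proof.
move=> nl pos; have rc := polar_curve nn; have rhoc := image_curve rc pos.
have /choice[h hP] := next_exists nn rc.
have [||||a [b [c [d H]]]] := @core_linear R n m (polar n) (g \o polar n) nn mm rc rhoc _ nl h.
- by move=> s t /=; rewrite gdist// (r1 rc).
- by move=> t; case: (hP t).
- by move=> t; case: (hP t).
- by move=> t; case: (hP t).
exists a, b, c, d => p /(r_onto nn rc)[t <-].
exact: H.
Qed.

End SphereMap.

Section LinearSpheres.
Variables (R : realType) (n m : R * R -> R) (g : R * R -> R * R).
Hypotheses (nn : plane_norm n) (mm : plane_norm m).
Hypothesis g1 : forall p, n p = 1 -> m (g p) = 1.
Hypothesis gdist : forall p q, n p = 1 -> n q = 1 -> m (g p - g q) = n (p - q).
Hypothesis gonto : forall q, m q = 1 -> exists2 p, n p = 1 & g p = q.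
Hypothesis gN : forall p, n p = 1 -> g (- p) = - g p.

Lemma long_linear : ~ nolong n -> exists a b c d : R, forall p, n p = 1 ->
  g p = (a * p.1 + b * p.2, c * p.1 + d * p.2).
Proof.
move=> /existsNP[p] /existsNP[q] /not_implyP[p1] /not_implyP[q1] /not_implyP[pq1] /negP.
rewrite -leNgt => h2; have pq2 : n (p + q) = 2.
  by apply/eqP; rewrite eq_le h2 andbT (le_trans (nD nn _ _))// p1 q1.
have pq : p != q by apply/eqP => e; move: pq1; rewrite e subrr (n0 nn) => /esym/eqP; rewrite oner_eq0.
have [b [z [l [_ [_ [ms + _ _]]]]]] := maxseg_exists nn p1 q1 pq2 pq.
by rewrite pq1; exact: (long_segment_linear nn mm g1 gdist gonto gN ms).
Qed.

Hypotheses (n10 : n (1, 0) = 1) (n01 : n (0, 1) = 1).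
Hypotheses (g10 : g (1, 0) = (1, 0)) (g01 : g (0, 1) = (0, 1)).

(** Fixing the two basis vectors makes [g] orientation preserving, as the curve argument requires,
    and reduces the matrix of the linear map to the identity. *)
Lemma normalized_id p : n p = 1 -> g p = p.
Proof.
have [a [b [c [d H]]]] : exists a b c d : R, forall p, n p = 1 ->
    g p = (a * p.1 + b * p.2, c * p.1 + d * p.2).
  have [nl|nl] := pselect (nolong n); last exact: long_linear.
  apply: (nolong_linear nn mm g1 gdist gN nl); exists 0, (pi / 2).
  have pi0 := @pi_gt0 R.
  split; [lra|lra|].
  have -> : polar n 0 = (1, 0) by rewrite /polar /circle cos0 sin0 n10 invr1 scale1r.
  have -> : polar n (pi / 2) = (0, 1) by rewrite /polar /circle cos_pihalf sin_pihalf n01 invr1 scale1r.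
  by rewrite g10 g01 /det /=; lra.
move: (H _ n10) (H _ n01); rewrite g10 g01 /= !mulr0 !mulr1 !addr0 !add0r => -[a1 c0] [b0 d1] p1.
by rewrite H// -a1 -b0 -c0 -d1 !mul1r !mul0r addr0 add0r; case: (p).
Qed.

End LinearSpheres.

(** * The target is spanned by the images of two basis vectors *)

Section Span.
Variables (R : realType) (n : R * R -> R) (Y : normedModType R) (F : R * R -> Y).
Hypothesis nn : plane_norm n.
Hypothesis F1 : forall p, n p = 1 -> `|F p| = 1.
Hypothesis Fdist : forall p q, n p = 1 -> n q = 1 -> `|F p - F q| = n (p - q).
Hypothesis Fonto : forall y, `|y| = 1 -> exists2 p, n p = 1 & F p = y.
Hypotheses (n10 : n (1, 0) = 1) (n01 : n (0, 1) = 1).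

Let u := F (1, 0).
Let v := F (0, 1).

Lemma F_inj p q : n p = 1 -> n q = 1 -> F p = F q -> p = q.
Proof.
move=> p1 q1 e; have := Fdist p1 q1; rewrite e subrr normr0 => /esym h0.
by case: nn => _ _ def; apply/eqP; rewrite -subr_eq0; apply/eqP/def.
Qed.

Lemma line_eq p (c : R) : n p = 1 -> F p = c *: u -> p = (1, 0) \/ p = - (1, 0).
Proof.
move=> p1 e; have := F1 p1; rewrite e normrZ F1// mulr1 => /eqP.
rewrite eqr_norml ler01 andbT => /orP[]/eqP cE.
  by left; apply: F_inj => //; rewrite e cE scale1r.
by right; apply: F_inj; rewrite ?(nN nn)// e cE scaleN1r (antipodal nn F1 Fdist Fonto).
Qed.

Lemma v_notin_line (c : R) : v <> c *: u.
Proof. by move=> /(line_eq n01)[] /(congr1 snd) /= /eqP; rewrite ?oppr0 oner_eq0. Qed.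

Lemma sphere_spans y : exists a b : R, y = a *: u + b *: v.
Proof.
(* For [s] from -1 to 1 this path leads from [- v] to [v]. It avoids the line of [u]: where the
   coefficient of [y] is not 0 because [y] is outside the span, and elsewhere because [v] is off
   that line. *)
apply: contrapT => ny; pose P (s : R) := (1 - s ^+ 2) *: y + s *: v.
have offline s (c : R) : P s <> c *: u.
  move=> e; have [s1|s1] := eqVneq (1 - s ^+ 2) 0.
    rewrite /P s1 scale0r add0r in e.
    have s0 : s != 0 by apply/eqP => s0; move: s1; rewrite s0 expr0n subr0 => /eqP; rewrite oner_eq0.
    by apply: (@v_notin_line (s^-1 * c)); rewrite -scalerA -e scalerA mulVf// scale1r.
  apply: ny; exists ((1 - s ^+ 2)^-1 * c), ((1 - s ^+ 2)^-1 * - s).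
  rewrite -!scalerA -e -scalerDr /P -addrA -scalerDl subrr scale0r addr0.
  by rewrite scalerA mulVf// scale1r.
have Pn0 s : `|P s| != 0.
  by rewrite normr_eq0; apply/eqP => e; apply: (@offline s 0); rewrite e scale0r.
pose N s := `|P s|^-1 *: P s.
have N1 s : `|N s| = 1 by rewrite /N normrZ normfV normr_id mulVf.
have /choice[q qP] s : exists q, n q = 1 /\ F q = N s.
  by have [q q1 Fq] := Fonto (N1 s); exists q.
have Pc : continuous P.
  move=> s; apply: cvgD; apply: cvgZr_tmp; last exact: cvg_id.
  by apply: cvgB; [exact: cvg_cst|exact: exprn_continuous].
have Nc : continuous N.
  by move=> s; apply: cvgZ; [apply: cvgV; [exact: Pn0|apply: cvg_norm]|]; exact: Pc.
(* The preimage path is continuous because [F] preserves distances. *)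
have qc s : vlim (nbhs s) q (q s).
  apply: (vlim_dist nn); apply: slim_eq (_ : slim (nbhs s) (fun t => `|N t - N s|) 0).
    apply: nearW => t; have [a1 a2] := qP t; have [b1 b2] := qP s.
    by rewrite -a2 -b2 Fdist.
  split; rewrite -(normr0 Y) -(subrr (N s)); apply: cvg_norm; apply: cvgB; first exact: Nc.
  exact: cvg_cst.
have q_end s (e : R) : s = e -> e ^+ 2 = 1 -> N s = e *: v.
  move=> -> e2; rewrite /N /P e2 subrr scale0r add0r normrZ F1// mulr1.
  have -> : `|e| = 1 by apply/eqP; rewrite -sqrp_eq1// -normrX e2 normr1.
  by rewrite invr1 scale1r.
have q1 : q 1 = (0, 1).
  by have [a1 a2] := qP 1; apply: F_inj => //; rewrite a2 (q_end 1 1)// ?expr1n// scale1r.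
have qm1 : q (-1) = - (0, 1).
  have [a1 a2] := qP (-1); apply: F_inj; rewrite ?(nN nn)// a2 (q_end _ (-1))// ?sqrrN ?expr1n//.
  by rewrite scaleN1r (antipodal nn F1 Fdist Fonto).
(* The second coordinate of the preimage path runs from -1 to 1; at a zero the path meets [(1, 0)]
   or its negative, so [P s] lies on the line of [u]. *)
have := @nonvanishing_gt0 R (fun s => - det (1, 0) (q s)) (-1) 1.
rewrite q1 qm1 detrN opprK /det /= => H.
suff: 0 < - (1 * 1 - 0 * 0) :> R by lra.
apply: H; [lra| | |lra].
  by move=> t; apply: slimN; apply: slimB; apply: slimM; try exact: slim_cst; case: (qc t).
move=> s _ _; rewrite mul0r subr0 mul1r => /eqP; rewrite oppr_eq0 => /eqP h.
have [qs1 Fqs] := qP s.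
have d0 : det (1, 0) (q s) = 0 by rewrite /det h /=; ring.
have scl : P s = `|P s| *: N s by rewrite /N scalerA divff// scale1r.
have [e|e] := unit_det0 nn n10 qs1 d0; rewrite e ?(antipodal nn F1 Fdist Fonto)// in Fqs.
  by apply: (@offline s `|P s|); rewrite {1}scl -Fqs.
by apply: (@offline s (- `|P s|)); rewrite {1}scl -Fqs scalerN scaleNr.
Qed.

Lemma basis_indep (a b : R) : a *: u + b *: v = 0 -> a = 0 /\ b = 0.
Proof.
move=> e; have [b0|b0] := eqVneq b 0.
  split=> //; move: e; rewrite b0 scale0r addr0 => /eqP.
  by rewrite scaler_eq0 -(normr_eq0 u) F1// oner_eq0 orbF => /eqP.
exfalso; apply: (@v_notin_line (- (b^-1 * a))).
rewrite scaleNr -scalerA; apply/eqP; rewrite -subr_eq0 opprK addrC.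
by rewrite -[X in _ + X](scale1r v) -(mulVf b0) -scalerA -scalerDr e scaler0.
Qed.

(** The norm of the target is transported to [R * R] through the basis [u], [v]. Read in these
    coordinates, [F] fixes [(1, 0)] and [(0, 1)], and [normalized_id] applies. *)
Lemma plane_extension p0 : n p0 = 1 -> F p0 = p0.1 *: u + p0.2 *: v.
Proof.
pose E (p : R * R) := p.1 *: u + p.2 *: v; pose m p := `|E p|.
have EB p q : E (p - q) = E p - E q.
  by rewrite /E !vE !scalerBl opprD addrACA.
have mm : plane_norm m.
  split=> [p1 p2|c p1|p1 /eqP].
  - by rewrite /m /E !vE !scalerDl addrACA ler_normD.
  - by rewrite /m /E !vE -!scalerA -scalerDr normrZ.
  by rewrite normr_eq0 => /eqP /basis_indep[*]; apply: vP.
have /choice[g gP] q : exists p, E p = F q.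
  by have [a [b ->]] := sphere_spans (F q); exists (a, b).
have E_inj p q : E p = E q -> p = q.
  move=> e; apply/eqP; rewrite -subr_eq0; apply/eqP.
  by have [_ _ def] := mm; apply: def; rewrite /m EB e subrr normr0.
have g1 q : n q = 1 -> m (g q) = 1 by move=> q1; rewrite /m gP F1.
have gd p q : n p = 1 -> n q = 1 -> m (g p - g q) = n (p - q).
  by move=> p1 q1; rewrite /m EB !gP Fdist.
have go q : m q = 1 -> exists2 p, n p = 1 & g p = q.
  by move=> /Fonto[p' p1 Fp]; exists p' => //; apply: E_inj; rewrite gP.
have gN q : n q = 1 -> g (- q) = - g q.
  move=> q1; apply: E_inj; rewrite gP (antipodal nn F1 Fdist Fonto)// -gP.
  by rewrite -[in RHS]sub0r EB /E !vE !scale0r add0r sub0r.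
move=> p1; rewrite -gP (normalized_id nn mm g1 gd go gN n10 n01)//.
  by apply: E_inj; rewrite gP /E /= scale1r scale0r addr0.
by apply: E_inj; rewrite gP /E /= scale1r scale0r add0r.
Qed.

End Span.

Lemma linear_eqs (R : pzRingType) (U V : lmodType R) (f : U -> V) : linear f ->
  [/\ f 0 = 0, forall x y, f (x + y) = f x + f y & forall a x, f (a *: x) = a *: f x].
Proof.
move=> lin; have f0 : f 0 = 0 by have := lin (-1) 0 0; rewrite scaler0 addr0 scaleN1r addNr.
split=> // [x y|a x]; first by have := lin 1 x y; rewrite !scale1r.
by have := lin a x 0; rewrite f0 !addr0.
Qed.

Theorem theorem1p3 (R : realType) (X : completeNormedModType R)
    (dimX : Vector.axiom 2 X) : mazur_ulam_property X.
Proof.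
move=> Y f [fS fdist].
have [v2r v2r_lin [r2v v2rK r2vK]] := dimX.
have [v0 vD vZ] := linear_eqs v2r_lin.
pose c1 x := v2r x 0 0; pose c2 x := v2r x 0 1.
pose e (i : 'I_2) := r2v (delta_mx 0 i).
have xE x : x = c1 x *: e 0 + c2 x *: e 1.
  apply: (can_inj v2rK); rewrite vD !vZ !r2vK.
  apply/rowP => i; rewrite !mxE /=; case: i => [[|[|]]] //= hi; rewrite !mulr0 ?mulr1 ?addr0 ?add0r.
    by congr (v2r x _ _); apply: val_inj.
  by congr (v2r x _ _); apply: val_inj.
have en0 i : 0 < `|e i|.
  rewrite normr_gt0; apply/eqP => h; have := congr1 v2r h; rewrite r2vK v0 => /rowP /(_ i).
  by rewrite !mxE !eqxx => /eqP; rewrite oner_eq0.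
(* The basis is normalized so that its vectors lie on the sphere, where [f] is controlled. *)
pose s i := `|e i|^-1 *: e i.
have s1 i : `|s i| = 1 by rewrite normrZ normfV normr_id mulVf// lt0r_neq0.
pose E (p : R * R) := p.1 *: s 0 + p.2 *: s 1.
pose co x : R * R := (c1 x * `|e 0|, c2 x * `|e 1|).
have coK x : E (co x) = x.
  rewrite /E /co /= /s !scalerA -!mulrA !divff ?lt0r_neq0// !mulr1 -xE.
  by [].
have coZ a x y : co (a *: x + y) = a *: co x + co y.
  by apply: vP; rewrite /co !vE /= /c1 /c2 vD vZ !mxE; ring.
have EK p : co (E p) = p.
  have s0 i : v2r (s i) = `|e i|^-1 *: delta_mx 0 i by rewrite vZ r2vK.
  rewrite /E /co /c1 /c2 vD (vZ _ (s 0)) (vZ _ (s 1)) !s0; apply: vP; rewrite /= !mxE /=.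
    by field; rewrite !lt0r_neq0.
  by field; rewrite !lt0r_neq0.
pose n p := `|E p|.
have Elin : linear E by move=> a p q; rewrite /E !vE !scalerDl scalerDr !scalerA addrACA.
have [E0 ED EZ] := linear_eqs Elin.
have EB p q : E (p - q) = E p - E q by rewrite ED -(scaleN1r q) EZ scaleN1r.
have nn : plane_norm n.
  split=> [p q|a p|p /eqP]; first by rewrite /n ED ler_normD.
    by rewrite /n EZ normrZ.
  by rewrite normr_eq0 => /eqP h; rewrite -(EK p) h -E0 EK.
pose F p := f (E p).
have f1 x : `|x| = 1 -> `|f x| = 1.
  by move=> x1; have : (f @` @unit_sphere R X) (f x) by [exists x]; rewrite fS.
have F1 p : n p = 1 -> `|F p| = 1 by exact: f1.
have Fdist p q : n p = 1 -> n q = 1 -> `|F p - F q| = n (p - q).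
  by move=> p1 q1; rewrite /F /n EB fdist.
have Fonto y : `|y| = 1 -> exists2 p, n p = 1 & F p = y.
  move=> y1; have : (@unit_sphere R Y) y by [].
  by rewrite -fS => -[x x1 <-]; exists (co x); rewrite /n /F coK.
have n10 : n (1, 0) = 1 by rewrite /n /E /= scale1r scale0r addr0 s1.
have n01 : n (0, 1) = 1 by rewrite /n /E /= scale1r scale0r add0r s1.
pose T x := (co x).1 *: F (1, 0) + (co x).2 *: F (0, 1).
have Tlin : linear T.
  by move=> a x y; rewrite /T coZ !vE !scalerDl scalerDr !scalerA addrACA.
pose TL : {linear X -> Y} := HB.pack T (GRing.isLinear.Build _ _ _ _ T Tlin).
have TS x : `|x| = 1 -> T x = f x.
  move=> x1; rewrite /T -(plane_extension nn F1 Fdist Fonto n10 n01) /n /F coK//.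
have [T0 TD TZ] := linear_eqs Tlin.
have TB x y : T (x - y) = T x - T y by rewrite TD -(scaleN1r y) TZ scaleN1r.
(* By homogeneity it suffices that [T] agrees with [f] on the sphere. *)
have normT x : `|T x| = `|x|.
  have [->|x0] := eqVneq x 0; first by rewrite T0 !normr0.
  have x0' : `|x| != 0 by rewrite normr_eq0.
  have u1 : `| `|x|^-1 *: x| = 1 by rewrite normrZ normfV normr_id mulVf.
  have h : `|T (`|x|^-1 *: x)| = 1 by rewrite TS// f1.
  by rewrite TZ normrZ normfV normr_id in h; rewrite -[LHS](mulVKf x0') h mulr1.
exists TL; split=> [|x y|x x1]; last exact: TS.
  rewrite predeqE => y; split=> // _; have [->|y0] := eqVneq y 0.
    by exists 0 => //; exact: T0.
  have y0' : `|y| != 0 by rewrite normr_eq0.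
  have u1 : `| `|y|^-1 *: y| = 1 by rewrite normrZ normfV normr_id mulVf.
  have : (@unit_sphere R Y) (`|y|^-1 *: y) by [].
  rewrite -fS => -[x x1 fx]; exists (`|y| *: x) => //.
  by rewrite /= TZ TS// fx scalerA divff// scale1r.
by rewrite /= -TB normT.
Qed.
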